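(* Let $r\ge0$ be an integer. There is a constant $C_r$ depending only on $r$ such that for every $N\in\mathbb{N}$ the following holds. Let $D_{R_N}\subseteq\mathbb{R}^2$ be the disk centered at the origin of area $N$ (so $R_N=\sqrt{N/\pi}$), let $K_{h_r,D_{R_N}}(z,z')=\sum_{j=1}^N p_j(z)\overline{p_j(z')}$ be the correlation kernel of the finite Weyl-Heisenberg ensemble with window $h_r$ and domain $D_{R_N}$, and let $K'_{r,N}(z,z')=\sum_{j=0}^{N-1}V_{h_r}h_j(z)\overline{V_{h_r}h_j(z')}$. Then $$\big\|K_{h_r,D_{R_N}}-K'_{r,N}\big\|_{S^1}\le C_r\,|\partial D_{R_N}|_1\le C_r'\sqrt N,$$ where $\|\cdot\|_{S^1}$ is the trace norm of the corresponding integral operators on $L^2(\mathbb{R}^2)$ and $C_r'$ depends only on $r$.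
   Context: $z=(x,\xi)\in\mathbb{R}^2$. Phase-space shift $\pi(z)f(t)=e^{2\pi i\xi t}f(t-x)$; $V_gf(z)=\langle f,\pi(z)g\rangle$; $K^g(z,z')=\langle\pi(z')g,\pi(z)g\rangle$. Hermite functions: $h_r(t)=\frac{2^{1/4}}{\sqrt{r!}}\big(\frac{-1}{2\sqrt\pi}\big)^r e^{\pi t^2}\frac{d^r}{dt^r}(e^{-2\pi t^2})$. For $\|g\|_2=1$ and $\Omega$ of finite measure, $M^g_\Omega$ is the integral operator on $L^2(\mathbb{R}^2)$ with kernel $\int K^g(z,z'')1_\Omega(z'')K^g(z'',z')dz''$; write $M^g_\Omega=\sum_{j\ge1}\lambda_jp_j\otimes p_j$ with nonzero eigenvalues $\lambda_1\ge\lambda_2\ge\dots$ counted with multiplicity and $\{p_j\}$ a corresponding orthonormal family of eigenfunctions. The finite Weyl-Heisenberg ensemble kernel is $\sum_{j=1}^{\lceil|\Omega|\rceil}p_j(z)\overline{p_j(z')}$. $|\partial D_R|_1=2\pi R$ is the perimeter. *)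

(* Defs.v *)
From HB Require Import structures.
From mathcomp Require Import all_boot all_order all_algebra.
From mathcomp Require Import all_classical all_reals all_analysis.
From mathcomp Require Import complex.
Set Implicit Arguments. Unset Strict Implicit. Unset Printing Implicit Defensive.
Import Order.TTheory GRing.Theory Num.Theory.
Import numFieldNormedType.Exports.
Local Open Scope classical_set_scope.
Local Open Scope ring_scope.

Section WH.
Variable R : realType.
Local Notation CC := (R[i]).

Definition cexpi (a : R) : CC := Complex (cos a) (sin a).
Definition conjc (z : CC) : CC := Complex (complex.Re z) (- complex.Im z).
Definition rc (x : R) : CC := Complex x 0.
Definition cabs (z : CC) : R := Num.sqrt (complex.Re z ^+ 2 + complex.Im z ^+ 2).

Definition leb1 := (@lebesgue_measure R).
Definition leb2 := (leb1 \x leb1)%E.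

Definition cint1 (D : set R) (f : R -> CC) : CC :=
  Complex (Rintegral leb1 D (fun x => complex.Re (f x)))
          (Rintegral leb1 D (fun x => complex.Im (f x))).
Definition cint2 (D : set (R * R)) (f : R * R -> CC) : CC :=
  Complex (Rintegral leb2 D (fun x => complex.Re (f x)))
          (Rintegral leb2 D (fun x => complex.Im (f x))).

Definition L2_1 (f : R -> CC) : Prop :=
  measurable_fun setT (fun x => complex.Re (f x)) /\
  measurable_fun setT (fun x => complex.Im (f x)) /\
  leb1.-integrable setT (fun x => ((cabs (f x)) ^+ 2)%:E).
Definition L2_2 (f : R * R -> CC) : Prop :=
  measurable_fun setT (fun x => complex.Re (f x)) /\
  measurable_fun setT (fun x => complex.Im (f x)) /\
  leb2.-integrable setT (fun x => ((cabs (f x)) ^+ 2)%:E).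

Definition ip1 (f g : R -> CC) : CC := cint1 setT (fun t => f t * conjc (g t)).
Definition ip2 (f g : R * R -> CC) : CC := cint2 setT (fun z => f z * conjc (g z)).

Definition l2norm2_2 (f : R * R -> CC) : \bar R :=
  (\int[leb2]_z ((cabs (f z)) ^+ 2)%:E)%E.

Definition tfshift (z : R * R) (g : R -> CC) : R -> CC :=
  fun t => cexpi (2 * pi * z.2 * t) * g (t - z.1).

Definition stft (g f : R -> CC) (z : R * R) : CC := ip1 f (tfshift z g).

Definition rkernel (g : R -> CC) (z z' : R * R) : CC :=
  ip1 (tfshift z' g) (tfshift z g).

Definition Mkernel (g : R -> CC) (Om : set (R * R)) (z z' : R * R) : CC :=
  cint2 Om (fun z'' => rkernel g z z'' * rkernel g z'' z').

Definition intop (k : R * R -> R * R -> CC) (f : R * R -> CC) : R * R -> CC :=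
  fun z => cint2 setT (fun z' => k z z' * f z').

Definition hermite (r : nat) : R -> CC := fun t =>
  rc ((2 `^ (4^-1)) / Num.sqrt (r`!)%:R * (- 1 / (2 * Num.sqrt pi)) ^+ r
     * expR (pi * t ^+ 2)
     * (derive1n r (fun s : R => expR (- (2 * pi) * s ^+ 2))) t).

(* The family of nonzero eigenvalues may be finite (card = Some n, indices
   0..n-1) or infinite (card = None).  Index j here corresponds to j+1 in
   the paper. *)
Definition in_index (card : option nat) (j : nat) : bool :=
  if card is Some n then (j < n)%N else true.

Definition spectral_decomposition (g : R -> CC) (Om : set (R * R))
    (card : option nat) (lam : nat -> R) (p : nat -> R * R -> CC) : Prop :=
  [/\ (forall j, in_index card j -> L2_2 (p j)),
      (forall j k, in_index card j -> in_index card k ->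
          ip2 (p j) (p k) = (j == k)%:R),
      (forall j, in_index card j -> lam j != 0),
      (forall j k, in_index card j -> in_index card k -> (j <= k)%N ->
          lam k <= lam j) &
      (forall f, L2_2 f ->
        (fun n => l2norm2_2 (fun z => intop (Mkernel g Om) f z -
             \sum_(j < n | in_index card j)
                 rc (lam j) * ip2 f (p j) * p j z)) @ \oo --> 0%E)].

(* finite Weyl-Heisenberg ensemble kernel with n = ceil |Omega| points *)
Definition WH_kernel (n : nat) (p : nat -> R * R -> CC) (z z' : R * R) : CC :=
  \sum_(j < n) p j z * conjc (p j z').

Definition Kprime (r N : nat) (z z' : R * R) : CC :=
  \sum_(j < N) stft (hermite r) (hermite j) z * conjc (stft (hermite r) (hermite j) z').

Definition orthonormal_family (n : nat) (e : nat -> R * R -> CC) : Prop :=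
  (forall i, (i < n)%N -> L2_2 (e i)) /\
  (forall i j, (i < n)%N -> (j < n)%N -> ip2 (e i) (e j) = (i == j)%:R).

Definition trace_norm (k : R * R -> R * R -> CC) : \bar R :=
  ereal_sup [set x : \bar R | exists n (e f : nat -> R * R -> CC),
    [/\ orthonormal_family n e, orthonormal_family n f &
        x = (\sum_(i < n) cabs (ip2 (intop k (e i)) (f i)))%:E]].

Definition disk (rad : R) : set (R * R) :=
  [set z | z.1 ^+ 2 + z.2 ^+ 2 <= rad ^+ 2].
Definition radius_area (N : nat) : R := Num.sqrt (N%:R / pi).
Definition disk_perimeter (rad : R) : R := 2 * pi * rad.

End WH.

(* Main.v *)
(* The functions F_j = V_{h_r} h_j are orthonormal in the phase plane, and
   F_j (rot_t z) is F_j z up to phases and a factor e^{i(r-j)t}; hence they stay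
   orthogonal on every centred disk D, and the localization operator M of D is
   diagonal in them, with eigenvalues w_j = int_D |F_j|^2.  The eigenbasis p_j
   of the hypothesis is therefore only compared with another diagonalization of
   the same operator, and no ordering of the w_j is needed: both rank-N
   projections are close to M, the trace distance being at most
   2 (N - sum_{j<N} lambda_j) + 2 (N - sum_{j<N} w_j), and the first
   term is bounded by the second because the N largest eigenvalues have the
   largest sum (Ky Fan).

   In polar coordinates |F_j z| is a function dsp j r of sqrt (pi |z|^2), and
   multiplication by pi |z|^2 - (j + r + 1) acts on it as a two-term operator.
   So |F_j|^2 has a second moment O(j r + j + r + 1) around pi |z|^2 = j + r + 1,
   and by Chebyshev's inequality 1 - w_j <= 4 N (r + 1) / (N - j - r - 1)^2.
   Capping this by 1 and summing over j < N gives O((r + 1) sqrt N). *)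
Require Import Defs.
From HB Require Import structures.
From mathcomp Require Import all_boot all_order all_algebra.
From mathcomp Require Import all_classical all_reals all_analysis.
From mathcomp Require Import measurable_realfun.
From mathcomp Require Import complex ring lra zify.
Set Implicit Arguments. Unset Strict Implicit. Unset Printing Implicit Defensive.
Import Order.TTheory GRing.Theory Num.Theory.
Import numFieldNormedType.Exports.
Local Open Scope classical_set_scope.
Local Open Scope ring_scope.
Local Notation Re := complex.Re.
Local Notation Im := complex.Im.
Local Notation cj := Defs.conjc.

(** * Complex-valued functions *)

(** All properties of [F_j] are drawn from its value at r = j = 0, a Gaussian, and from two ladder
    relations that come from multiplication by t and integration by parts. They make the profiles
    [dsp] the matrix coefficients of a phase-space displacement in the Hermite basis. The pointwise
    identity sum_j |F_j z|^2 = 1 is then the key analytic input: it expands the reproducing kernel,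
    hence the kernel of M, and gives the trace sum_j w_j = N. The hypothesis on the p_j is only an
    L2-convergent expansion of each M f. That the eigenvalues lie in [0, 1] and that there are at
    least N of them has to be recovered, and both follow from the overlaps |<p_k, F_j>|^2, whose row
    and column sums are at most 1. M itself is given pointwise by an integral, so its expansion in
    the F_j is proved at each point and then lifted to L2 by Fatou's lemma. The trace norm is a
    supremum over pairs of finite orthonormal families; for each pair the two projections are
    compared with truncated expansions of M, whose difference tends to 0. *)

Section ComplexAlgebra.
Variable R : realType.
Implicit Types (a b : R) (z w : R[i]).

Lemma complexP z w : Re z = Re w -> Im z = Im w -> z = w.
Proof. by case: z => a b; case: w => c d /= -> ->. Qed.

Lemma cReD z w : Re (z + w) = Re z + Re w. Proof. by case: z; case: w. Qed.
Lemma cImD z w : Im (z + w) = Im z + Im w. Proof. by case: z; case: w. Qed.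
Lemma cReN z : Re (- z) = - Re z. Proof. by case: z. Qed.
Lemma cImN z : Im (- z) = - Im z. Proof. by case: z. Qed.
Lemma cReB z w : Re (z - w) = Re z - Re w. Proof. by rewrite cReD cReN. Qed.
Lemma cImB z w : Im (z - w) = Im z - Im w. Proof. by rewrite cImD cImN. Qed.
Lemma cReM z w : Re (z * w) = Re z * Re w - Im z * Im w.
Proof. by case: z; case: w. Qed.
Lemma cImM z w : Im (z * w) = Re z * Im w + Im z * Re w.
Proof. by case: z => a b; case: w => c d /=. Qed.
Lemma cRe_cj z : Re (cj z) = Re z. Proof. by []. Qed.
Lemma cIm_cj z : Im (cj z) = - Im z. Proof. by []. Qed.

Definition cE := (cReD, cImD, cReN, cImN, cReM, cImM, cRe_cj, cIm_cj).

Lemma cRe_sum I (s : seq I) (P : pred I) (F : I -> R[i]) :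
  Re (\sum_(i <- s | P i) F i) = \sum_(i <- s | P i) Re (F i).
Proof. by apply: (big_morph (@Re R)) => // z w; rewrite cReD. Qed.

Lemma cjE z : cj z = (z^*)%C. Proof. by case: z. Qed.
Lemma cjK z : cj (cj z) = z. Proof. by rewrite !cjE conjcK. Qed.
Lemma cjB z w : cj (z - w) = cj z - cj w. Proof. by rewrite !cjE rmorphB. Qed.
Lemma cjM z w : cj (z * w) = cj z * cj w. Proof. by rewrite !cjE rmorphM. Qed.
Lemma cjX z n : cj (z ^+ n) = cj z ^+ n. Proof. by rewrite !cjE rmorphXn. Qed.
Lemma cj_sum I (s : seq I) (P : pred I) (F : I -> R[i]) :
  cj (\sum_(i <- s | P i) F i) = \sum_(i <- s | P i) cj (F i).
Proof. by rewrite cjE rmorph_sum; apply: eq_bigr => i _; rewrite cjE. Qed.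
Lemma cj_rc a : cj (rc a) = rc a. Proof. by rewrite /cj /rc /= oppr0. Qed.

Lemma rcD a b : rc (a + b) = rc a + rc b :> R[i].
Proof. by apply: complexP; rewrite !cE /= ?addr0. Qed.
Lemma rcN a : rc (- a) = - rc a :> R[i].
Proof. by apply: complexP; rewrite !cE /= ?oppr0. Qed.
Lemma rcB a b : rc (a - b) = rc a - rc b :> R[i].
Proof. by rewrite rcD rcN. Qed.
Lemma rcM a b : rc (a * b) = rc a * rc b :> R[i].
Proof. by apply: complexP; rewrite !cE /=; ring. Qed.
Lemma rc0 : rc 0 = 0 :> R[i]. Proof. by []. Qed.
Lemma rc1 : rc 1 = 1 :> R[i]. Proof. by []. Qed.
Lemma rc_inj a b : rc a = rc b -> a = b. Proof. by case. Qed.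

Definition csq z : R := Re z ^+ 2 + Im z ^+ 2.

Lemma csq_ge0 z : 0 <= csq z. Proof. by rewrite addr_ge0 ?sqr_ge0. Qed.
Lemma cabsE z : cabs z ^+ 2 = csq z. Proof. by rewrite sqr_sqrtr ?csq_ge0. Qed.
Lemma cabs_ge0 z : 0 <= cabs z. Proof. exact: sqrtr_ge0. Qed.
Lemma mul_cj z : z * cj z = rc (csq z).
Proof. by apply: complexP; rewrite !cE /= /csq; ring. Qed.
Lemma csqM z w : csq (z * w) = csq z * csq w.
Proof. by rewrite /csq !cE; ring. Qed.
Lemma csq_cj z : csq (cj z) = csq z. Proof. by rewrite /csq !cE; ring. Qed.
Lemma csq_rc a : csq (rc a) = a ^+ 2. Proof. by rewrite /csq /=; ring. Qed.
Lemma csqX z n : csq (z ^+ n) = csq z ^+ n.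
Proof.
elim: n => [|n IH]; first by rewrite /csq /=; ring.
by rewrite !exprS csqM IH.
Qed.
Lemma csqD_le z w : csq (z + w) <= 2 * (csq z + csq w).
Proof.
rewrite /csq !cE; have := sqr_ge0 (Re z - Re w); have := sqr_ge0 (Im z - Im w).
by nra.
Qed.
Lemma cabsM z w : cabs (z * w) = cabs z * cabs w.
Proof. by rewrite /cabs -sqrtrM ?csq_ge0// -csqM. Qed.
Lemma cabs_rc a : cabs (rc a) = `|a|.
Proof. by rewrite /cabs /= expr0n addr0 sqrtr_sqr. Qed.
Lemma cabs_cj z : cabs (cj z) = cabs z.
Proof. by rewrite /cabs !cE sqrrN. Qed.
Lemma cabsD z w : cabs (z + w) <= cabs z + cabs w.
Proof. by have := le_normcD z w; case: z; case: w. Qed.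
Lemma cabsN z : cabs (- z) = cabs z.
Proof. by rewrite /cabs !cE !sqrrN. Qed.
Lemma cabsB z w : cabs (z - w) <= cabs z + cabs w.
Proof. by rewrite -(cabsN w) cabsD. Qed.
Lemma cabs0 : cabs 0 = 0 :> R. Proof. by rewrite (cabs_rc 0) normr0. Qed.
Lemma cabs_sum I (s : seq I) (P : pred I) (F : I -> R[i]) :
  cabs (\sum_(i <- s | P i) F i) <= \sum_(i <- s | P i) cabs (F i).
Proof.
elim/big_ind2: _ => [|z a w b za wb|//]; first by rewrite cabs0.
by rewrite (le_trans (cabsD _ _))// lerD.
Qed.
Lemma Re_le_cabs z : `|Re z| <= cabs z.
Proof. by rewrite -sqrtr_sqr ler_wsqrtr// lerDl sqr_ge0. Qed.
Lemma Im_le_cabs z : `|Im z| <= cabs z.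
Proof. by rewrite -sqrtr_sqr ler_wsqrtr// lerDr sqr_ge0. Qed.

Lemma csq_cexpi a : csq (cexpi a) = 1.
Proof. by rewrite /csq /= cos2Dsin2. Qed.
Lemma cexpiD a b : cexpi (a + b) = cexpi a * cexpi b.
Proof. by apply: complexP; rewrite !cE /= ?cosD ?sinD //; ring. Qed.
Lemma cexpi0 : cexpi (0 : R) = 1.
Proof. by apply: complexP; rewrite /= ?cos0 ?sin0. Qed.
Lemma cexpiX a n : cexpi a ^+ n = cexpi (a *+ n).
Proof. by elim: n => [|n IH]; rewrite ?mulr0n ?cexpi0// exprS mulrS cexpiD IH. Qed.
Lemma unit_cj z : csq z = 1 -> z * cj z = 1.
Proof. by rewrite mul_cj => ->. Qed.

Definition ccvg (u : nat -> R[i]) (l : R[i]) : Prop :=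
  (fun n => Re (u n)) @ \oo --> Re l /\ (fun n => Im (u n)) @ \oo --> Im l.

Lemma ccvg_cst l : ccvg (fun=> l) l. Proof. by split; exact: cvg_cst. Qed.

Lemma ccvgD u v l m : ccvg u l -> ccvg v m -> ccvg (fun n => u n + v n) (l + m).
Proof.
move=> [? ?] [? ?]; split; rewrite !cE.
  by under eq_fun do rewrite cReD; exact: cvgD.
by under eq_fun do rewrite cImD; exact: cvgD.
Qed.
Lemma ccvgN u l : ccvg u l -> ccvg (fun n => - u n) (- l).
Proof.
move=> [? ?]; split; rewrite !cE.
  by under eq_fun do rewrite cReN; exact: cvgN.
by under eq_fun do rewrite cImN; exact: cvgN.
Qed.
Lemma ccvgB u v l m : ccvg u l -> ccvg v m -> ccvg (fun n => u n - v n) (l - m).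
Proof. by move=> ul vm; apply: ccvgD => //; exact: ccvgN. Qed.
Lemma ccvgM u v l m : ccvg u l -> ccvg v m -> ccvg (fun n => u n * v n) (l * m).
Proof.
move=> [? ?] [? ?]; split; rewrite !cE.
  by under eq_fun do rewrite cReM; apply: cvgB; exact: cvgM.
by under eq_fun do rewrite cImM; apply: cvgD; exact: cvgM.
Qed.
Lemma ccvg_cj u l : ccvg u l -> ccvg (fun n => cj (u n)) (cj l).
Proof. by move=> [? ?]; split => //; exact: cvgN. Qed.
Lemma ccvg_cabs u l : ccvg u l -> (fun n => cabs (u n)) @ \oo --> cabs l.
Proof.
move=> [ur ui]; apply: continuous_cvg; first exact: sqrt_continuous.
by rewrite !expr2; apply: cvgD; exact: cvgM.
Qed.
Lemma ccvg_csq u l : ccvg u l -> (fun n => csq (u n)) @ \oo --> csq l.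
Proof.
by move=> [ur ui]; rewrite /csq !expr2; apply: cvgD; exact: cvgM.
Qed.
Lemma ccvg_shift u l k : ccvg u l -> ccvg (fun n => u (n + k)%N) l.
Proof. by move=> [ur ui]; split; rewrite (cvg_shiftn k (fun n => _ (u n))). Qed.

Lemma ccvgP u l : (fun n => cabs (u n - l)) @ \oo --> (0 : R) -> ccvg u l.
Proof.
move=> ul; split; apply/cvgrPdist_le => e e0.
  move/cvgrPdist_le : ul => /(_ _ e0); apply: filterS => n.
  rewrite sub0r normrN ger0_norm ?cabs_ge0//; apply: le_trans.
  by rewrite distrC -cReB Re_le_cabs.
move/cvgrPdist_le : ul => /(_ _ e0); apply: filterS => n.
rewrite sub0r normrN ger0_norm ?cabs_ge0//; apply: le_trans.
by rewrite distrC -cImB Im_le_cabs.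
Qed.

End ComplexAlgebra.

Section ComplexIntegral.
Context d (T : measurableType d) (R : realType).
Variable mu : {measure set T -> \bar R}.
Implicit Types (D : set T) (f g h : T -> R[i]).

Definition cmeas D f :=
  measurable_fun D (fun x => Re (f x)) /\ measurable_fun D (fun x => Im (f x)).
Definition cintegrable D f :=
  mu.-integrable D (EFin \o (fun x => Re (f x))) /\
  mu.-integrable D (EFin \o (fun x => Im (f x))).
Definition cint D f : R[i] :=
  Complex (Rintegral mu D (fun x => Re (f x)))
          (Rintegral mu D (fun x => Im (f x))).

Lemma cmeasD D f g : cmeas D f -> cmeas D g -> cmeas D (fun x => f x + g x).
Proof.
move=> [? ?] [? ?]; split.
  by under eq_fun do rewrite cReD; exact: measurable_funD.
by under eq_fun do rewrite cImD; exact: measurable_funD.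
Qed.
Lemma cmeasN D f : cmeas D f -> cmeas D (fun x => - f x).
Proof.
move=> [? ?]; split.
  by under eq_fun do rewrite cReN; exact: measurableT_comp.
by under eq_fun do rewrite cImN; exact: measurableT_comp.
Qed.
Lemma cmeasB D f g : cmeas D f -> cmeas D g -> cmeas D (fun x => f x - g x).
Proof. by move=> mf mg; apply: cmeasD => //; exact: cmeasN. Qed.
Lemma cmeasM D f g : cmeas D f -> cmeas D g -> cmeas D (fun x => f x * g x).
Proof.
move=> [? ?] [? ?]; split.
  by under eq_fun do rewrite cReM; apply: measurable_funB; exact: measurable_funM.
by under eq_fun do rewrite cImM; apply: measurable_funD; exact: measurable_funM.
Qed.
Lemma cmeas_cst D (c : R[i]) : cmeas D (fun=> c).
Proof. by split; exact: measurable_cst. Qed.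
Lemma cmeas_rc D (f : T -> R) : measurable_fun D f -> cmeas D (fun x => rc (f x)).
Proof. by move=> mf; split => //; exact: measurable_cst. Qed.
Lemma cmeas_cj D f : cmeas D f -> cmeas D (fun x => cj (f x)).
Proof. by move=> [? ?]; split => //; exact: measurableT_comp. Qed.
Lemma cmeas_sum D I (s : seq I) (P : pred I) (F : I -> T -> R[i]) :
  (forall i, P i -> cmeas D (F i)) ->
  cmeas D (fun x => \sum_(i <- s | P i) F i x).
Proof.
move=> mF; elim: s => [|i s IH].
  by under eq_fun do rewrite big_nil; exact: cmeas_cst.
under eq_fun do rewrite big_cons; case Pi : (P i) => //.
by apply: cmeasD => //; exact: mF.
Qed.
Lemma cmeas_csq D f : cmeas D f -> measurable_fun D (fun x => csq (f x)).
Proof. by move=> [? ?]; apply: measurable_funD; exact: measurable_funX. Qed.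
Lemma cmeas_cvg D (u : nat -> T -> R[i]) f : measurable D ->
  (forall n, cmeas D (u n)) -> (forall x, D x -> ccvg (u ^~ x) (f x)) ->
  cmeas D f.
Proof.
move=> mD mu_ uf; split.
  apply: (@measurable_fun_cvg _ _ _ _ (fun n x => Re (u n x))) => //.
    by move=> n; have [] := mu_ n.
  by move=> x /uf[].
apply: (@measurable_fun_cvg _ _ _ _ (fun n x => Im (u n x))) => //.
  by move=> n; have [] := mu_ n.
by move=> x /uf[].
Qed.

Lemma integrableZ_EFin D (k : R) (f : T -> R) : measurable D ->
  mu.-integrable D (EFin \o f) ->
  mu.-integrable D (EFin \o (fun x => k * f x)).
Proof.
move=> mD fi; rewrite (_ : EFin \o _ = fun x => k%:E * (EFin \o f) x)%E.
  exact: integrableZl.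
by apply/funext => x /=; rewrite EFinM.
Qed.
Lemma integrableD_EFin D (f g : T -> R) : measurable D ->
  mu.-integrable D (EFin \o f) -> mu.-integrable D (EFin \o g) ->
  mu.-integrable D (EFin \o (fun x => f x + g x)).
Proof.
move=> mD fi gi; rewrite (_ : EFin \o _ = fun x => (EFin \o f) x + (EFin \o g) x)%E.
  exact: integrableD.
by apply/funext => x /=; rewrite EFinD.
Qed.
Lemma integrableB_EFin D (f g : T -> R) : measurable D ->
  mu.-integrable D (EFin \o f) -> mu.-integrable D (EFin \o g) ->
  mu.-integrable D (EFin \o (fun x => f x - g x)).
Proof.
move=> mD fi gi; rewrite (_ : EFin \o _ = fun x => (EFin \o f) x - (EFin \o g) x)%E.
  exact: integrableB.
by apply/funext => x /=; rewrite EFinB.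
Qed.

Lemma cintegrable_dom D f (g : T -> R) : measurable D -> cmeas D f ->
  mu.-integrable D (EFin \o g) -> (forall x, D x -> cabs (f x) <= g x) ->
  cintegrable D f.
Proof.
move=> mD [mr mi] ig fg.
have g0 x : D x -> 0 <= g x by move=> /fg; apply: le_trans; exact: cabs_ge0.
split; apply: (le_integrable _ _ _ ig) => //=.
- exact/measurable_EFinP.
- move=> x Dx; rewrite lee_fin [`|g x|]ger0_norm ?g0//.
  exact: le_trans (Re_le_cabs _) (fg _ Dx).
- exact/measurable_EFinP.
- move=> x Dx; rewrite lee_fin [`|g x|]ger0_norm ?g0//.
  exact: le_trans (Im_le_cabs _) (fg _ Dx).
Qed.

Lemma cintegrableD D f g : measurable D -> cintegrable D f -> cintegrable D g ->
  cintegrable D (fun x => f x + g x).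
Proof.
move=> mD [? ?] [? ?]; split.
  by under [X in EFin \o X]eq_fun do rewrite cReD; exact: integrableD_EFin.
by under [X in EFin \o X]eq_fun do rewrite cImD; exact: integrableD_EFin.
Qed.

Lemma cintegrableZ D f c : measurable D -> cintegrable D f ->
  cintegrable D (fun x => c * f x).
Proof.
move=> mD [? ?]; split.
  under [X in EFin \o X]eq_fun do rewrite cReM.
  by apply: integrableB_EFin => //; exact: integrableZ_EFin.
under [X in EFin \o X]eq_fun do rewrite cImM.
by apply: integrableD_EFin => //; exact: integrableZ_EFin.
Qed.

Lemma cintD D f g : measurable D -> cintegrable D f -> cintegrable D g ->
  cint D (fun x => f x + g x) = cint D f + cint D g.
Proof.
move=> mD [? ?] [? ?]; apply: complexP; rewrite !cE /=.
  by under eq_Rintegral do rewrite cReD; rewrite RintegralD.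
by under eq_Rintegral do rewrite cImD; rewrite RintegralD.
Qed.

Lemma cintZ D f c : measurable D -> cintegrable D f ->
  cint D (fun x => c * f x) = c * cint D f.
Proof.
move=> mD [? ?]; apply: complexP; rewrite !cE /=.
  under eq_Rintegral do rewrite cReM.
  by rewrite RintegralB ?RintegralZl//; exact: integrableZ_EFin.
under eq_Rintegral do rewrite cImM.
by rewrite RintegralD ?RintegralZl//; exact: integrableZ_EFin.
Qed.

Lemma cint_cj D f : measurable D -> cintegrable D f ->
  cint D (fun x => cj (f x)) = cj (cint D f).
Proof.
move=> mD [? ?]; apply: complexP; rewrite !cE //=.
under eq_Rintegral do rewrite -mulN1r.
by rewrite RintegralZl// mulN1r.
Qed.

Lemma cintegrable_sum D I (s : seq I) (F : I -> T -> R[i]) : measurable D ->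
  (forall i, cintegrable D (F i)) ->
  cintegrable D (fun x => \sum_(i <- s) F i x).
Proof.
move=> mD iF; elim: s => [|i s IH].
  by under eq_fun do rewrite big_nil; split; exact: integrable0.
by under eq_fun do rewrite big_cons; exact: cintegrableD.
Qed.

Lemma cint_sum D I (s : seq I) (F : I -> T -> R[i]) : measurable D ->
  (forall i, cintegrable D (F i)) ->
  cint D (fun x => \sum_(i <- s) F i x) = \sum_(i <- s) cint D (F i).
Proof.
move=> mD iF; elim: s => [|i s IH].
  rewrite big_nil; apply: complexP => /=.
    by under eq_Rintegral do rewrite big_nil /=; rewrite Rintegral_cst// mul0r.
  by under eq_Rintegral do rewrite big_nil /=; rewrite Rintegral_cst// mul0r.
rewrite big_cons -IH -cintD//; last exact: cintegrable_sum.
by congr cint; apply/funext => x; rewrite big_cons.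
Qed.

Lemma eq_cint D f g : (forall x, D x -> f x = g x) -> cint D f = cint D g.
Proof.
by move=> fg; apply: complexP; apply: eq_Rintegral => x /set_mem /fg ->.
Qed.

Lemma cint_rc D (f : T -> R) : cint D (fun x => rc (f x)) = rc (Rintegral mu D f).
Proof.
apply: complexP => //=.
by rewrite /Rintegral integral0.
Qed.

Lemma Rintegral_dom_cvg D (u : nat -> T -> R) (f g : T -> R) : measurable D ->
  (forall n, measurable_fun D (u n)) -> measurable_fun D f ->
  (forall x, D x -> (fun n => u n x) @ \oo --> f x) ->
  mu.-integrable D (EFin \o g) ->
  (forall n x, D x -> `|u n x| <= g x) ->
  (fun n => Rintegral mu D (u n)) @ \oo --> Rintegral mu D f.
Proof.
move=> mD mu_ mf uf ig ug.
have mu' n : measurable_fun D (fun x => (u n x)%:E) by apply/measurable_EFinP.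
have mf' : measurable_fun D (EFin \o f) by apply/measurable_EFinP.
have uf' : \forall x \ae mu, D x -> (u n x)%:E @[n --> \oo] --> (EFin \o f) x.
  apply: aeW => x Dx; apply: cvg_EFin; first exact: nearW.
  exact: uf.
have ug' : \forall x \ae mu, forall n, D x -> (`|(u n x)%:E| <= (EFin \o g) x)%E.
  by apply: aeW => x n Dx; rewrite lee_fin ug.
have [ifi _ cv] := dominated_convergence mD mu' mf' uf' ig ug'.
apply: fine_cvg.
rewrite fineK; last exact: integrable_fin_num.
exact: cv.
Qed.

Lemma cint_dom_cvg D (u : nat -> T -> R[i]) f (g : T -> R) : measurable D ->
  (forall n, cmeas D (u n)) ->
  (forall x, D x -> ccvg (fun n => u n x) (f x)) ->
  mu.-integrable D (EFin \o g) ->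
  (forall n x, D x -> cabs (u n x) <= g x) ->
  ccvg (fun n => cint D (u n)) (cint D f).
Proof.
move=> mD mu_ uf ig ug; have [mfr mfi] := cmeas_cvg mD mu_ uf.
split => /=.
  apply: (Rintegral_dom_cvg (g := g)) => //.
  - by move=> n; have [] := mu_ n.
  - by move=> x /uf[].
  - by move=> n x /(ug n); exact: le_trans (Re_le_cabs _).
apply: (Rintegral_dom_cvg (g := g)) => //.
- by move=> n; have [] := mu_ n.
- by move=> x /uf[].
- by move=> n x /(ug n); exact: le_trans (Im_le_cabs _).
Qed.

End ComplexIntegral.

(** * Square-integrable functions for a general measure *)

Section SquareIntegrable.
Context d (T : measurableType d) (R : realType).
Variable mu : {measure set T -> \bar R}.
Implicit Types (f g h : T -> R[i]).

(** Written so that at [leb2] it unfolds to [L2_2]; likewise [ip] unfolds to [ip2] at [leb2] and to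
    [ip1] on the line. Passing between the two versions is then conversion. *)
Definition L2 f := measurable_fun setT (fun x => Re (f x)) /\
  measurable_fun setT (fun x => Im (f x)) /\
  mu.-integrable setT (fun x => ((cabs (f x)) ^+ 2)%:E).
Definition ip f g : R[i] := cint mu setT (fun x => f x * cj (g x)).
Definition nsq f : R := Rintegral mu setT (fun x => csq (f x)).

Lemma L2P f : L2 f <->
  cmeas setT f /\ mu.-integrable setT (EFin \o (fun x => csq (f x))).
Proof.
rewrite /L2 /cmeas (_ : EFin \o _ = (fun x => ((cabs (f x)) ^+ 2)%:E)).
  by split => [[? [? ?]]|[[? ?] ?]].
by apply/funext => x /=; rewrite cabsE.
Qed.

Lemma L2_meas f : L2 f -> cmeas setT f. Proof. by move=> /L2P[]. Qed.

Lemma L2D f g : L2 f -> L2 g -> L2 (fun x => f x + g x).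
Proof.
move=> /L2P[mf fi] /L2P[mg gi]; apply/L2P; split; first exact: cmeasD.
have ifg : mu.-integrable setT (EFin \o (fun x => 2 * (csq (f x) + csq (g x)))).
  by apply: integrableZ_EFin => //; exact: integrableD_EFin.
apply: (le_integrable _ _ _ ifg) => //=.
  by apply/measurable_EFinP; apply: cmeas_csq; exact: cmeasD.
move=> x _; rewrite lee_fin !ger0_norm ?csq_ge0 ?csqD_le//.
by rewrite mulr_ge0// addr_ge0 ?csq_ge0.
Qed.
Lemma L2Z c f : L2 f -> L2 (fun x => c * f x).
Proof.
move=> /L2P[mf fi]; apply/L2P; split.
  by apply: cmeasM => //; exact: cmeas_cst.
rewrite (_ : EFin \o _ = fun x => (csq c)%:E * (csq (f x))%:E)%E.
  exact: integrableZl.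
by apply/funext => x /=; rewrite csqM EFinM.
Qed.
Lemma L20 : L2 (fun=> 0).
Proof.
apply/L2P; split; first exact: cmeas_cst.
rewrite (_ : EFin \o _ = cst 0%E); first exact: integrable0.
by apply/funext => x /=; rewrite (csq_rc 0) expr0n.
Qed.
Lemma L2N f : L2 f -> L2 (fun x => - f x).
Proof. by move=> /(L2Z (-1)); under eq_fun do rewrite mulN1r. Qed.
Lemma L2B f g : L2 f -> L2 g -> L2 (fun x => f x - g x).
Proof. by move=> Lf Lg; apply: L2D => //; exact: L2N. Qed.
Lemma L2_sum I (s : seq I) (P : pred I) (F : I -> T -> R[i]) :
  (forall i, P i -> L2 (F i)) -> L2 (fun x => \sum_(i <- s | P i) F i x).
Proof.
move=> LF; elim: s => [|i s IH].
  by under eq_fun do rewrite big_nil; exact: L20.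
under eq_fun do rewrite big_cons; case Pi : (P i) => //.
by apply: L2D => //; exact: LF.
Qed.

Lemma L2_integrable f g : L2 f -> L2 g -> cintegrable mu setT (fun x => f x * cj (g x)).
Proof.
move=> /L2P[mf fi] /L2P[mg gi].
apply: (@cintegrable_dom _ _ _ _ _ _ (fun x => csq (f x) + csq (g x))) => //.
- by apply: cmeasM => //; exact: cmeas_cj.
- exact: integrableD_EFin.
- move=> x _; rewrite cabsM cabs_cj -!cabsE.
  by have := sqr_ge0 (cabs (f x) - cabs (g x)); have := cabs_ge0 (f x);
     have := cabs_ge0 (g x); nra.
Qed.

Lemma ipDl f g h : L2 f -> L2 g -> L2 h ->
  ip (fun x => f x + g x) h = ip f h + ip g h.
Proof.
move=> Lf Lg Lh; rewrite /ip -cintD//; try exact: L2_integrable.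
by congr cint; apply/funext => x; rewrite mulrDl.
Qed.
Lemma ipZl c f g : L2 f -> L2 g -> ip (fun x => c * f x) g = c * ip f g.
Proof.
move=> Lf Lg; rewrite /ip -cintZ//; last exact: L2_integrable.
by congr cint; apply/funext => x; rewrite mulrA.
Qed.
Lemma ipC f g : L2 f -> L2 g -> ip g f = cj (ip f g).
Proof.
move=> Lf Lg; rewrite /ip -cint_cj//; last exact: L2_integrable.
by congr cint; apply/funext => x; rewrite cjM cjK mulrC.
Qed.
Lemma ipff f : ip f f = rc (nsq f).
Proof. by rewrite -cint_rc; congr cint; apply/funext => x; rewrite mul_cj. Qed.
Lemma nsq_ge0 f : 0 <= nsq f.
Proof. by apply: Rintegral_ge0 => x _; exact: csq_ge0. Qed.

Lemma nsqE f : L2 f -> (\int[mu]_x ((cabs (f x)) ^+ 2)%:E)%E = (nsq f)%:E.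
Proof.
move=> /L2P[mf fi]; rewrite /nsq /Rintegral fineK; last exact: integrable_fin_num.
by apply: eq_integral => x _ /=; rewrite cabsE.
Qed.

(** Fatou's lemma, applied in m to [|u (m + n) - u n|^2], carries a Cauchy-type rate over to the
    pointwise limit. It yields the square integrability of the kernel rows and of the image of the
    localization operator. *)
Lemma L2_fatou (u : nat -> T -> R[i]) f (e : nat -> R) :
  (forall n, L2 (u n)) -> (forall x, ccvg (u ^~ x) (f x)) ->
  (forall n m, (n <= m)%N -> nsq (fun x => u m x - u n x) <= e n) ->
  L2 f /\ forall n, nsq (fun x => f x - u n x) <= e n.
Proof.
move=> Lu uf ue.
have mf : cmeas setT f by apply: (cmeas_cvg _ (fun n => L2_meas (Lu n))).
have fat n : (\int[mu]_x (csq (f x - u n x))%:E <= (e n)%:E)%E.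
  pose v m x := (csq (u (m + n)%N x - u n x))%:E.
  have mv m : measurable_fun setT (v m).
    by apply/measurable_EFinP/cmeas_csq/cmeasB; exact: L2_meas.
  have v0 m x : setT x -> (0 <= v m x)%E by rewrite lee_fin csq_ge0.
  have := fatou mu measurableT mv v0.
  rewrite (_ : (fun x => limn_einf _) = (fun x => (csq (f x - u n x))%:E)).
    move=> /le_trans; apply.
    rewrite limn_einf_lim; apply: (lime_le (@is_cvg_einfs _ _)).
    apply: nearW => m; rewrite /einfs.
    apply: (@le_trans _ _ (\int[mu]_x v m x)%E).
      by apply: ereal_inf_lbound => /=; exists m => //=.
    rewrite (_ : (\int[mu]_x v m x)%E =
        (nsq (fun x => u (m + n)%N x - u n x))%:E) ?lee_fin ?ue ?leq_addl//.
    rewrite -nsqE; last exact: L2B.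
    by apply: eq_integral => x _; rewrite cabsE.
  apply/funext => x; apply: (cvg_limn_einf_sup _).1.
  apply: cvg_EFin; first exact: nearW.
  by apply: ccvg_csq; apply: ccvgB; [exact: (@ccvg_shift _ (u ^~ x))|exact: ccvg_cst].
have Lfu n : L2 (fun x => f x - u n x).
  apply/L2P; split; first by apply: cmeasB => //; exact: L2_meas.
  apply/integrableP; split.
    by apply/measurable_EFinP/cmeas_csq/cmeasB => //; exact: L2_meas.
  under eq_integral do rewrite /= ger0_norm ?csq_ge0//.
  by rewrite (le_lt_trans (fat n))// ltry.
split => [|n].
  have := L2D (Lfu 0%N) (Lu 0%N).
  by under eq_fun do rewrite subrK.
rewrite -lee_fin -nsqE//; apply: le_trans (fat n).
by under eq_integral do rewrite cabsE.
Qed.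
End SquareIntegrable.

(** * Orthonormal families *)

Section Hilbert.
Context d (T : measurableType d) (R : realType).
Variable mu : {measure set T -> \bar R}.
Local Notation L2 := (L2 mu).
Local Notation ip := (ip mu).
Local Notation nsq := (nsq mu).
Implicit Types (f g h : T -> R[i]).

Lemma eq_ip f f' g g' : f =1 f' -> g =1 g' -> ip f g = ip f' g'.
Proof. by move=> /funext -> /funext ->. Qed.

Lemma ipZr c f g : L2 f -> L2 g -> ip f (fun x => c * g x) = cj c * ip f g.
Proof.
by move=> Lf Lg; rewrite (ipC (L2Z c Lg) Lf) ipZl// cjM -(ipC Lg Lf).
Qed.
Lemma ip0l f : ip (fun=> 0) f = 0.
Proof.
rewrite -[LHS]/(cint mu setT _) (@eq_cint _ _ _ mu _ _ (fun=> rc 0)) ?cint_rc => [|x _]; last by rewrite mul0r.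
by rewrite /Rintegral integral0.
Qed.
Lemma ip_suml I (s : seq I) (P : pred I) (F : I -> T -> R[i]) g :
  (forall i, P i -> L2 (F i)) -> L2 g ->
  ip (fun x => \sum_(i <- s | P i) F i x) g = \sum_(i <- s | P i) ip (F i) g.
Proof.
move=> LF Lg; elim: s => [|i s IH].
  rewrite big_nil -[RHS](ip0l g); apply: eq_ip => x; last by [].
  by rewrite big_nil.
rewrite big_cons -IH; case Pi : (P i).
  rewrite -(ipDl (LF _ Pi) (L2_sum s LF) Lg).
  by apply: eq_ip => // x; rewrite big_cons Pi.
by apply: eq_ip => // x; rewrite big_cons Pi.
Qed.
Lemma ip_sumr I (s : seq I) (P : pred I) (F : I -> T -> R[i]) g :
  (forall i, P i -> L2 (F i)) -> L2 g ->
  ip g (fun x => \sum_(i <- s | P i) F i x) = \sum_(i <- s | P i) ip g (F i).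
Proof.
move=> LF Lg; rewrite (ipC (L2_sum _ LF) Lg) ip_suml// cj_sum.
by apply: eq_bigr => i Pi; rewrite -ipC//; exact: LF.
Qed.
Lemma ipBl f g h : L2 f -> L2 g -> L2 h ->
  ip (fun x => f x - g x) h = ip f h - ip g h.
Proof.
move=> Lf Lg Lh; rewrite -mulN1r -(ipZl (-1) Lg Lh) -ipDl//; last exact: L2Z.
by apply: eq_ip => // x; rewrite mulN1r.
Qed.
Lemma ipBr f g h : L2 f -> L2 g -> L2 h ->
  ip f (fun x => g x - h x) = ip f g - ip f h.
Proof.
move=> Lf Lg Lh; rewrite (ipC (L2B Lg Lh) Lf) ipBl// cjB.
by rewrite -(ipC Lg Lf) -(ipC Lh Lf).
Qed.

Lemma nsqE_ip f : nsq f = Re (ip f f). Proof. by rewrite ipff. Qed.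

Lemma nsqZ c f : L2 f -> nsq (fun x => c * f x) = csq c * nsq f.
Proof.
move=> Lf; rewrite nsqE_ip ipZl ?ipZr//; last exact: L2Z.
by rewrite mulrA mul_cj ipff -rcM.
Qed.
Lemma nsqB f g : L2 f -> L2 g ->
  nsq (fun x => f x - g x) = nsq f + nsq g - 2 * Re (ip f g).
Proof.
move=> Lf Lg; rewrite nsqE_ip ipBl ?ipBr//; last exact: L2B.
by rewrite (ipC Lf Lg) !ipff !cE /=; ring.
Qed.

(** Nonnegativity of [nsq (f - t c g)] for real t, where c is the inner product itself, so that the
    cross term is a real multiple of |c|^2. *)
Lemma cauchy_schwarz f g : L2 f -> L2 g -> csq (ip f g) <= nsq f * nsq g.
Proof.
move=> Lf Lg; set c := ip f g.
have key (t : R) : 0 <= nsq f + t ^+ 2 * csq c * nsq g - 2 * t * csq c.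
  have := nsq_ge0 mu (fun x => f x - rc t * c * g x).
  rewrite nsqB ?nsqZ//; last exact: L2Z.
  rewrite ipZr// -/c csqM csq_rc (_ : Re _ = t * csq c); first by rewrite mulrA.
  by rewrite !cE /csq /=; ring.
have := nsq_ge0 mu g; rewrite le_eqVlt => /predU1P[g0|g0].
  rewrite -g0 mulr0; move: key; rewrite -g0 => key.
  (* With [nsq g = 0] the bound is affine in t; for nonzero c the t chosen here gives it the value
     -1. *)
  rewrite leNgt; apply/negP => c0; have := key ((nsq f + 1) / (2 * csq c)).
  rewrite mulr0 addr0 [2 * _]mulrC -mulrA divfK ?mulf_neq0 ?gt_eqF//.
  by rewrite opprD addrA subrr sub0r oppr_ge0 ler10.
have := key (nsq g)^-1.
rewrite (_ : _ ^-1 ^+ 2 * _ * _ = (nsq g)^-1 * csq c); last first.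
  by field; rewrite gt_eqF.
move=> h; have : 0 <= nsq f - (nsq g)^-1 * csq c by apply: le_trans h _; lra.
by rewrite subr_ge0 mulrC ler_pdivrMr.
Qed.

Section Orthonormal.
Variables (P : pred nat) (e : nat -> T -> R[i]).
Hypothesis Le : forall i, P i -> L2 (e i).
Hypothesis eo : forall i j, P i -> P j -> ip (e i) (e j) = (i == j)%:R.

(** The filter P keeps to valid indices, so that a finite and an infinite family of eigenfunctions
    share one form. *)
Definition lincomb (s : seq nat) (c : nat -> R[i]) (x : T) : R[i] :=
  \sum_(i <- s | P i) c i * e i x.

Lemma L2_lincomb s c : L2 (lincomb s c).
Proof. by apply: L2_sum => i Pi; apply: L2Z; exact: Le. Qed.

Lemma ip_lincombr f s c : L2 f ->
  ip f (lincomb s c) = \sum_(i <- s | P i) cj (c i) * ip f (e i).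
Proof.
move=> Lf; rewrite ip_sumr//; last by move=> i Pi; apply: L2Z; exact: Le.
by apply: eq_bigr => i Pi; rewrite ipZr//; exact: Le.
Qed.
Lemma ip_lincombl f s c : L2 f ->
  ip (lincomb s c) f = \sum_(i <- s | P i) c i * ip (e i) f.
Proof.
move=> Lf; rewrite ip_suml//; last by move=> i Pi; apply: L2Z; exact: Le.
by apply: eq_bigr => i Pi; rewrite ipZl//; exact: Le.
Qed.

Lemma ip_lincomb_e s c j : uniq s -> P j ->
  ip (lincomb s c) (e j) = if j \in s then c j else 0.
Proof.
move=> us Pj; rewrite ip_lincombl; last exact: Le.
case: ifPn => js.
  rewrite big_mkcond (bigD1_seq j)//= Pj eo// eqxx mulr1 big1 ?addr0// => i ij.
  by case: ifPn => // Pi; rewrite eo// (negbTE ij) mulr0.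
rewrite big_seq_cond big1// => i /andP[iS Pi]; rewrite eo//.
by case: eqP iS js => [->|_ _ _]; rewrite ?mulr0// => ->.
Qed.

Lemma nsq_lincomb s c : uniq s -> nsq (lincomb s c) = \sum_(i <- s | P i) csq (c i).
Proof.
move=> us; rewrite nsqE_ip ip_lincombr; last exact: L2_lincomb.
rewrite cRe_sum big_seq_cond [RHS]big_seq_cond; apply: eq_bigr => i /andP[iS Pi].
by rewrite ip_lincomb_e// iS mulrC mul_cj.
Qed.

Lemma nsq_sub_proj f s : L2 f -> uniq s ->
  nsq (fun x => f x - lincomb s (fun i => ip f (e i)) x) =
  nsq f - \sum_(i <- s | P i) csq (ip f (e i)).
Proof.
move=> Lf us; rewrite nsqB//; last exact: L2_lincomb.
rewrite nsq_lincomb// ip_lincombr// cRe_sum.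
under [X in _ - 2 * X]eq_bigr do rewrite mulrC mul_cj.
by rewrite /=; ring.
Qed.

Lemma bessel f s : L2 f -> uniq s ->
  \sum_(i <- s | P i) csq (ip f (e i)) <= nsq f.
Proof.
by move=> Lf us; rewrite -subr_ge0 -nsq_sub_proj// nsq_ge0.
Qed.

(* Parseval's identity for one function [g] gives the expansion of every inner
   product against [g], without completeness of the whole system. *)
Lemma parseval_ip f g : L2 f -> L2 g ->
  (fun n => \sum_(0 <= i < n | P i) csq (ip g (e i))) @ \oo --> nsq g ->
  ccvg (fun n => \sum_(0 <= i < n | P i) ip f (e i) * cj (ip g (e i))) (ip f g).
Proof.
move=> Lf Lg cg; apply: ccvgP.
have h : (fun n => Num.sqrt (nsq f * (nsq g -
    \sum_(0 <= i < n | P i) csq (ip g (e i))))) @ \oo --> (0 : R).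
  rewrite [X in _ --> X](_ : _ = Num.sqrt (nsq f * (nsq g - nsq g))).
    apply: continuous_cvg; first exact: sqrt_continuous.
    exact: (cvgM (cvg_cst _) (cvgB (cvg_cst _) cg)).
  by rewrite subrr mulr0 sqrtr0.
apply: (@squeeze_cvgr _ _ _ _ (cst 0) _ _ _ _ (cvg_cst _) h).
apply: nearW => n; rewrite cabs_ge0 /= -cabsN opprB.
have -> : ip f g - \sum_(0 <= i < n | P i) ip f (e i) * cj (ip g (e i)) =
    ip f (fun x => g x - lincomb (index_iota 0 n) (fun i => ip g (e i)) x).
  rewrite ipBr//; last exact: L2_lincomb.
  by rewrite ip_lincombr//; congr (_ - _); apply: eq_bigr => i _; rewrite mulrC.
rewrite -[leLHS]ger0_norm ?cabs_ge0// -sqrtr_sqr ler_wsqrtr// cabsE -nsq_sub_proj ?iota_uniq//.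
by apply: cauchy_schwarz => //; apply: L2B => //; exact: L2_lincomb.
Qed.

End Orthonormal.
End Hilbert.

(** * The radial profiles *)

Section RadialFunctions.
Variable R : realType.
Implicit Types (x : R) (j r : nat).
Local Notation rt n := (Num.sqrt n%:R : R).

(* Up to a phase, the value of [V_{h_r} h_j] at a point with [pi |z|^2 = x^2];
   the recursion is the action of the raising operator in [j].  At [r = 0] the
   junk term [dsp k r.-1] has coefficient 0. *)
Fixpoint dsp j r x : R :=
  if j is k.+1 then (x * dsp k r x + rt r * dsp k r.-1 x) / rt k.+1
  else (- x) ^+ r / Num.sqrt (r`!)%:R * expR (- x ^+ 2 / 2).

Lemma rt_sqr n : rt n * rt n = n%:R. Proof. by rewrite -expr2 sqr_sqrtr. Qed.
Lemma rtS_gt0 n : 0 < rt n.+1. Proof. by rewrite sqrtr_gt0. Qed.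
Lemma rtS_neq0 n : rt n.+1 != 0. Proof. by rewrite gt_eqF ?rtS_gt0. Qed.
Lemma rt0 : rt 0 = 0. Proof. exact: sqrtr0. Qed.
Lemma rt_ge0 n : 0 <= rt n. Proof. exact: sqrtr_ge0. Qed.

Lemma rt_fact n : Num.sqrt (n.+1`!)%:R = rt n.+1 * Num.sqrt (n`!)%:R :> R.
Proof. by rewrite factS natrM sqrtrM. Qed.
Lemma rt_fact_neq0 n : Num.sqrt (n`!)%:R != 0 :> R.
Proof. by rewrite gt_eqF// sqrtr_gt0 ltr0n fact_gt0. Qed.

Lemma dspS j r x :
  rt j.+1 * dsp j.+1 r x = x * dsp j r x + rt r * dsp j r.-1 x.
Proof. by rewrite /= mulrC divfK ?rtS_neq0. Qed.

Lemma dspS' j r x :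
  rt j * (rt j * dsp j r x) = rt j * (x * dsp j.-1 r x + rt r * dsp j.-1 r.-1 x).
Proof. by case: j => [|j]; rewrite ?rt0 ?mul0r// dspS. Qed.

Lemma dsp0S r x : x * dsp 0 r x = - rt r.+1 * dsp 0 r.+1 x.
Proof.
rewrite /dsp rt_fact (exprS (- x)); move: (rtS_neq0 r) (rt_fact_neq0 r).
move: (rt _) (Num.sqrt _) (expR _) (_ ^+ r) => a b e y a0 b0.
by field; rewrite a0 b0.
Qed.

(** The companion of the defining recursion: that one raises j and lowers r, this one lowers j and
    raises r. Each induction step uses the claim at r and at r - 1 together with the recursion one
    level down. *)
Lemma dsp_lower j r x :
  x * dsp j r x = rt j * dsp j.-1 r x - rt r.+1 * dsp j r.+1 x.
Proof.
elim: j r => [|j IH] r; first by rewrite dsp0S rt0 mul0r sub0r mulNr.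
apply: (mulfI (rtS_neq0 j)).
have hb : rt r.+1 * (rt r.+1 * dsp j r x) = r.+1%:R * dsp j r x.
  by rewrite mulrA rt_sqr.
rewrite mulrCA dspS [RHS]mulrBr [X in X - _]mulrA rt_sqr [X in _ - X]mulrCA.
rewrite dspS [r.+1.-1]/=.
have h1 := IH r; have h2 := dspS' j r x; rewrite mulrA rt_sqr in h2.
have h3 : rt r * (x * dsp j r.-1 x) =
    rt r * (rt j * dsp j.-1 r.-1 x) - r%:R * dsp j r x.
  case: r {h1 h2 hb} => [|r]; first by rewrite rt0 !mul0r subrr.
  by rewrite IH mulrBr !mulrA rt_sqr.
have h1x : x * (x * dsp j r x) = x * (rt j * dsp j.-1 r x) - x * (rt r.+1 * dsp j r.+1 x).
  by rewrite h1 mulrBr.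
move: hb h1x h2 h3; rewrite -!natr1 [j.+1.-1]/=.
by move: (dsp _ _ _) (dsp _ _ _) (dsp _ _ _) (dsp _ _ _) (dsp _ _ _) => *; lra.
Qed.

(** Eliminating the shift in r between the two ladder relations leaves a recurrence in j alone. It
    is what makes the integrals of consecutive squared profiles equal. *)
Lemma dsp_three j r x :
  x * (rt j * dsp j.-1 r x + rt j.+1 * dsp j.+1 r x) =
  (x ^+ 2 + j%:R - r%:R) * dsp j r x.
Proof.
have h1 := dspS j r x; have h2 := dspS' j r x; rewrite mulrA rt_sqr in h2.
have h3 : rt r * (x * dsp j r.-1 x) =
    rt r * (rt j * dsp j.-1 r.-1 x) - r%:R * dsp j r x.
  case: r {h1 h2} => [|r]; first by rewrite rt0 !mul0r subrr.
  by rewrite dsp_lower mulrBr !mulrA rt_sqr.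
rewrite mulrDr h1; move: h2 h3; rewrite expr2.
by move: (dsp _ _ _) (dsp _ _ _) (dsp _ _ _) (dsp _ _ _) => *; lra.
Qed.

(** Here j and r move together: for a fixed difference j - r this is the Laguerre three-term
    recurrence in x^2, centred at j + r + 1. *)
Lemma dsp_square j r x : (x ^+ 2 - (j + r + 1)%:R) * dsp j r x =
  - (rt j.+1 * rt r.+1 * dsp j.+1 r.+1 x + rt j * rt r * dsp j.-1 r.-1 x).
Proof.
have h1 := dsp_lower j.+1 r x; rewrite /= in h1.
have h2 : rt r * (x * dsp j r.-1 x) =
    rt r * (rt j * dsp j.-1 r.-1 x) - r%:R * dsp j r x.
  case: r {h1} => [|r]; first by rewrite rt0 !mul0r subrr.
  by rewrite dsp_lower mulrBr !mulrA rt_sqr.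
have h3 := dspS j r x.
have h4 : x * (rt j.+1 * dsp j.+1 r x) =
    j.+1%:R * dsp j r x - rt j.+1 * rt r.+1 * dsp j.+1 r.+1 x.
  by rewrite mulrCA h1 mulrBr !mulrA rt_sqr.
move: h2 h4; rewrite h3 !natrD -!natr1 expr2.
by move: (dsp _ _ _) (dsp _ _ _) (dsp _ _ _) (dsp _ _ _) => *; lra.
Qed.

(** On the column of profiles indexed by j, differentiation is a skew-symmetric tridiagonal matrix:
    the generator of a one-parameter group of displacements, a lowering operator minus a raising
    one. *)
Lemma is_derive_dsp j r x :
  is_derive x 1 (dsp j r) (rt j * dsp j.-1 r x - rt j.+1 * dsp j.+1 r x).
Proof.
elim: j r => [|j IH] r.
  rewrite rt0 mul0r sub0r dspS.
  have -> : dsp 0 r = fun y => (Num.sqrt (r`!)%:R)^-1 * ((- y) ^+ r * expR (- 2^-1 * y ^+ 2)).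
    by apply/funext => y /=; rewrite mulrA [_ / _]mulrC; congr (_ * expR _); field.
  have hp : is_derive x 1 (fun y => (- y) ^+ r) (- r%:R * (- x) ^+ r.-1).
    rewrite -(exprfctE (fun y : R => - y)); apply: is_derive_eq.
    by rewrite /GRing.scale /= mulrN1 mulNr.
  apply: is_derive_eq.
  rewrite /GRing.scale /= !mulr1 ?addr0 [- x ^+ 2 / 2](_ : _ = - 2^-1 * x ^+ 2); last by field.
  move: (expR _) => e; case: r {hp} => [|r].
    by rewrite rt0 !expr0 /=; field; exact: (rt_fact_neq0 0).
  rewrite rt_fact /= (exprS (- x)).
  have := rt_fact_neq0 r; have := rtS_neq0 r; have := rt_sqr r.+1.
  move: (rt r.+1) (Num.sqrt (r`!)%:R) (_ ^+ r) => a b y <- a0 b0.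
  by field; rewrite a0 b0.
have -> : dsp j.+1 r = fun y => (rt j.+1)^-1 * (y * dsp j r y + rt r * dsp j r.-1 y).
  by apply/funext => y /=; rewrite mulrC.
apply: is_derive_eq.
rewrite /GRing.scale /= !mulr1; apply: (mulfI (rtS_neq0 j)).
rewrite !mulrA divff ?rtS_neq0// mul1r.
have := dspS' j r x; have := rt_sqr j.+1; have := rt_sqr j.
have := rtS_neq0 j; have := rtS_neq0 j.+1.
move: (rt j.+1) (rt j.+2) (rt j) (rt r) (rt r.-1) (@natr1 R j) => a b c e e' J.
move: (dsp j r x) (dsp j r.-1 x) (dsp j.-1 r x) (dsp j.-1 r.-1 x) (dsp j r.-2 x).
move=> D E A B F b0 a0 cc aa h.
rewrite mulrA cc in h.
transitivity (x * (c * A - (x * D + e * E)) + D + e * (c * B - (x * E + e' * F))).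
  by field; rewrite a0.
transitivity (a * a * D - (x * (x * D + e * E) + e * (x * E + e' * F))).
  by rewrite aa -J; lra.
by field; rewrite a0 b0.
Qed.

Lemma dsp_at0 j r : dsp j r 0 = (j == r)%:R.
Proof.
elim: j r => [|j IH] r.
  have e0 : - 0 ^+ 2 / 2 = 0 :> R by rewrite expr0n oppr0 mul0r.
  rewrite /dsp e0 expR0 mulr1 oppr0.
  by case: r => [|r]; rewrite ?expr0 ?fact0 ?sqrtr1 ?divr1// exprS !mul0r.
rewrite /= mul0r add0r IH; case: r => [|r]; first by rewrite rt0 !mul0r.
rewrite eqSS /=; case: eqP => [->|_]; last by rewrite mulr0 mul0r.
by rewrite mulr1 divff ?rtS_neq0.
Qed.

Definition dsp_psum n r x := \sum_(j < n) dsp j r x ^+ 2.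

(** Skew-symmetry cancels the interior products; only the coupling of index n - 1 with index n
    survives. *)
Lemma is_derive_dsp_psum n r x :
  is_derive x 1 (dsp_psum n r) (- (2 * rt n * dsp n.-1 r x * dsp n r x)).
Proof.
elim: n => [|n IH].
  rewrite rt0 mulr0 !mul0r oppr0 (_ : dsp_psum 0 r = cst 0); first exact: is_derive_cst.
  by apply/funext => y; rewrite /dsp_psum big_ord0.
have -> : dsp_psum n.+1 r = fun y => dsp_psum n r y + dsp n r y ^+ 2.
  by apply/funext => y; rewrite /dsp_psum big_ord_recr.
have h := is_derive_dsp n r x.
apply: is_derive_eq; rewrite [n.+1.-1]/=.
move: (rt n) (rt n.+1) (dsp _ _ _) (dsp _ _ _) (dsp _ _ _) => a b D E F.
by rewrite /GRing.scale /=; ring.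
Qed.

Lemma derive_continuous (f df : R -> R) :
  (forall x, is_derive x 1 f (df x)) -> continuous f.
Proof.
move=> h x; apply: differentiable_continuous.
by apply/derivable1_diffP; have [] := h x.
Qed.

Lemma continuous_dsp j r : continuous (dsp j r).
Proof. exact: (derive_continuous (is_derive_dsp j r)). Qed.

Section Completeness.
Variable r : nat.
(** Discharged later by Bessel's inequality, once the Hermite functions are known to be
    orthonormal. *)
Hypothesis dsp_psum_le1 : forall n x, dsp_psum n r x <= 1.

Lemma dsp_psum_homo m n x : (m <= n)%N -> dsp_psum m r x <= dsp_psum n r x.
Proof.
move=> mn; rewrite /dsp_psum -(subnKC mn) big_split_ord /= lerDl.
by apply: sumr_ge0 => i _; exact: sqr_ge0.
Qed.

(* The derivative of a partial sum is a single boundary term of size [sqrt n];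
   as the series of [1 / sqrt n] diverges while the squares are summable, the
   partial sums cannot stay away from their value [1] at the origin. *)
Let G n x := \sum_(m < n) (rt m.+1)^-1 * (1 - dsp_psum m.+1 r x).

Let is_derive_G n x :
  is_derive x 1 (G n) (\sum_(m < n) 2 * dsp m r x * dsp m.+1 r x).
Proof.
elim: n => [|n IH].
  rewrite big_ord0 (_ : G 0 = cst 0); first exact: is_derive_cst.
  by apply/funext => y; rewrite /G big_ord0.
have -> : G n.+1 = fun y => G n y + (rt n.+1)^-1 * (1 - dsp_psum n.+1 r y).
  by apply/funext => y; rewrite /G big_ord_recr.
have h := is_derive_dsp_psum n.+1 r x.
apply: is_derive_eq; rewrite big_ord_recr; congr (_ + _).
rewrite [n.+1.-1]/=; have := rtS_neq0 n.
move: (rt n.+1) (dsp n.+1 r x) (dsp n r x) => a D E a0.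
by rewrite /GRing.scale /=; field.
Qed.

(** The weights in G cancel the factor [sqrt] of the boundary terms. What remains is a sum of
    products of neighbouring profiles, bounded through 2ab <= a^2 + b^2 by two partial sums of
    squares, hence by 2. *)
Let G_lip n x : 0 <= x -> G n x <= G n 0 + 2 * x.
Proof.
move=> x0.
have [|c _ e] := @MVT_segment _ (G n) (fun y => \sum_(m < n) 2 * dsp m r y * dsp m.+1 r y)
  0 x x0 (fun y _ => is_derive_G n y).
  by apply: continuous_subspaceT; exact: (derive_continuous (is_derive_G n)).
rewrite -lerBlDl e subr0; apply: ler_wpM2r => //.
have -> : 2 = 1 + 1 :> R by [].
apply: le_trans (lerD (dsp_psum_le1 n c) (dsp_psum_le1 n.+1 c)).
rewrite /dsp_psum big_ord_recl.
have -> : \sum_(i < n) dsp (lift ord0 i) r c ^+ 2 = \sum_(i < n) dsp i.+1 r c ^+ 2 by [].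
rewrite addrCA -[leLHS]add0r; apply: lerD; first exact: sqr_ge0.
rewrite -big_split; apply: ler_sum => i _ /=.
set u := dsp i r c; set v := (_ / _).
by have := sqr_ge0 (u - v); rewrite !expr2; lra.
Qed.

(** The n defects summed in G are at least the last one, with weights at least [1 / sqrt n], so
    [G n x] is at least [sqrt n] times that defect; it is bounded above by its value at 0 plus
    2x. *)
Lemma dsp_psum_ge n x : (0 < n)%N -> 0 <= x ->
  1 - dsp_psum n r x <= (r%:R + 2 * x) / rt n.
Proof.
move=> n0 x0; have rn0 : 0 < rt n by rewrite sqrtr_gt0 ltr0n.
rewrite ler_pdivlMr//; apply: (@le_trans _ _ (G n x)).
  have -> : (1 - dsp_psum n r x) * rt n =
      \sum_(m < n) (rt n)^-1 * (1 - dsp_psum n r x).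
    rewrite sumr_const card_ord -[RHS]mulr_natl.
    have := rt_sqr n; move: (lt0r_neq0 rn0); move: (rt n) => a a0 <-.
    by field.
  apply: ler_sum => m _; apply: ler_pM.
  - by rewrite invr_ge0 rt_ge0.
  - by rewrite subr_ge0.
  - by rewrite lef_pV2 ?posrE ?rtS_gt0// ler_wsqrtr// ler_nat.
  - by rewrite lerD2l lerN2 dsp_psum_homo.
apply: le_trans (G_lip n x0) _; rewrite lerD2r /G.
(* At the origin the profiles are Kronecker deltas: the defect vanishes as soon as the partial sum
   contains index r, and at most r terms remain. *)
apply: (@le_trans _ _ (\sum_(m < n) (m < r)%:R)).
  apply: ler_sum => m _.
  have [mr|rm] := ltnP m r.
    rewrite -[leRHS]mul1r; apply: ler_pM.
    - by rewrite invr_ge0 rt_ge0.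
    - by rewrite subr_ge0.
    - rewrite invf_le1 ?rtS_gt0// -[leLHS]sqrtr1 ler_wsqrtr//.
      by rewrite ler1n.
    - by rewrite gerBl sumr_ge0// => i _; exact: sqr_ge0.
  rewrite /dsp_psum (bigD1 (Ordinal (n := m.+1) (m := r) rm))//= dsp_at0 eqxx expr1n.
  rewrite big1 ?addr0 ?subrr ?mulr0// => i; rewrite -val_eqE /= => ir.
  by rewrite dsp_at0 (negbTE ir) expr0n.
rewrite -natr_sum ler_nat.
elim: (n) => [|k IH]; first by rewrite big_ord0.
rewrite big_ord_recr /=; have [kr|_] := ltnP k r; last by rewrite addn0.
apply: leq_trans kr; rewrite addn1 ltnS -[leqRHS]card_ord -sum1_card.
by apply: leq_sum => i _; exact: leq_b1.
Qed.

End Completeness.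
End RadialFunctions.

(** * The short-time Fourier transform of Hermite functions *)

Section RealLine.
Variable R : realType.
Local Notation mu := (@lebesgue_measure R).
Implicit Types (f F : R -> R).

Lemma Rintegral_derive0 (F f : R -> R) :
  (forall t : R, is_derive t 1 F (f t)) -> continuous f ->
  mu.-integrable setT (EFin \o f) ->
  (fun n : nat => F n%:R) @ \oo --> (0 : R) ->
  (fun n : nat => F (- n%:R)) @ \oo --> (0 : R) ->
  Rintegral mu setT f = 0.
Proof.
move=> dF cf fi Fp Fn.
pose u (n : nat) t := f t * \1_(`[- n.+1%:R, n.+1%:R] : set R) t.
have uE n : Rintegral mu setT (u n) = F n.+1%:R - F (- n.+1%:R).
  have lt : - n.+1%:R < n.+1%:R :> R by rewrite gtrN.
  rewrite -[RHS]/(fine ((F n.+1%:R)%:E - (F (- n.+1%:R))%:E)%E).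
  rewrite -(@continuous_FTC2 R f F _ _ lt (continuous_subspaceT cf)).
  - rewrite /Rintegral [in RHS]integral_mkcond; congr fine; apply: eq_integral => t _.
    rewrite patchE /u indicE; case: ifPn => _; rewrite ?mulr1 ?mulr0//.
  - have cF := derive_continuous dF; split.
    + by move=> t _; have [] := dF t.
    + exact: cvg_at_right_filter (cF _).
    + exact: cvg_at_left_filter (cF _).
  - by move=> t _; rewrite derive1E; have [_ ->] := dF t.
have cu : (fun n => Rintegral mu setT (u n)) @ \oo --> Rintegral mu setT f.
  apply: (@Rintegral_dom_cvg _ _ _ mu setT u f (fun t => `|f t|)) => //.
  - move=> n; apply: measurable_funM; first exact: continuous_measurable_fun.
    exact: measurable_indic.
  - exact: continuous_measurable_fun.
  - move=> t _; apply: cvg_near_cst; near=> n.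
    rewrite /u indicE mem_set ?mulr1//= in_itv/= -ler_norml.
    near: n; exists (Num.truncn `|t|) => // n /= tn.
    apply: ltW; apply: lt_le_trans (truncnS_gt _) _.
    by rewrite ler_nat ltnS.
  - by have := integrable_norm fi.
  - by move=> n t _; rewrite normrM indicE; case: (_ \in _); rewrite ?normr1 ?mulr1// normr0 mulr0.
have cF : (fun n : nat => F n.+1%:R - F (- n.+1%:R)) @ \oo --> (0 : R).
  rewrite -[X in _ --> X](subrr 0); apply: cvgB.
    by rewrite (cvg_shiftS (fun n : nat => F n%:R)).
  by rewrite (cvg_shiftS (fun n : nat => F (- n%:R))).
apply: (cvg_unique (@Rhausdorff R) cu).
rewrite (_ : (fun n => Rintegral mu setT (u n)) = fun n : nat => F n.+1%:R - F (- n.+1%:R))//.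
exact/funext.
Unshelve. all: end_near. Qed.

End RealLine.

(** * Polynomials times [exp (- pi t^2)], a class stable under d/dt and multiplication by t *)

Section GaussPoly.
Variable R : realType.
Local Notation mu := (@lebesgue_measure R).
Implicit Types (p q : {poly R}) (x t xi : R).

Definition gpoly p t : R := p.[t] * expR (- pi * t ^+ 2).
Definition gder p : {poly R} := p^`() - (2 * pi) *: ('X * p).

Lemma gpolyD p q t : gpoly (p + q) t = gpoly p t + gpoly q t.
Proof. by rewrite /gpoly hornerD mulrDl. Qed.
Lemma gpolyZ a p t : gpoly (a *: p) t = a * gpoly p t.
Proof. by rewrite /gpoly hornerZ mulrA. Qed.
Lemma gpolyX p t : gpoly ('X * p) t = t * gpoly p t.
Proof. rewrite /gpoly hornerM hornerX. by rewrite -mulrA. Qed.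

Lemma is_derive_gpoly p t : is_derive t 1 (gpoly p) (gpoly (gder p) t).
Proof.
apply: is_derive_eq; rewrite /gpoly /gder !hornerE /GRing.scale /=.
by ring.
Qed.

Lemma continuous_gpoly p : continuous (gpoly p).
Proof. exact: (derive_continuous (is_derive_gpoly p)). Qed.

(** After taking n-th roots, [exp y >= 1 + y] at y = t^2 / n reduces the claim to |t| <= (n + 1)(1 +
    t^2 / n). *)
Lemma expr_le_expR (n : nat) t : `|t| ^+ n <= (n.+1)%:R ^+ n * expR (t ^+ 2).
Proof.
case: n => [|n].
  rewrite !expr0 mul1r; apply: le_trans (expR_ge1Dx _).
  by rewrite lerDl sqr_ge0.
set m := n.+1; have m0 : 0 < m%:R :> R by rewrite ltr0n.
have -> : expR (t ^+ 2) = expR (t ^+ 2 / m%:R) ^+ m.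
  by rewrite -expRM_natl mulrC divfK// gt_eqF.
rewrite -exprMn; apply: lerXn2r; rewrite ?nnegrE ?mulr_ge0 ?expR_ge0//.
have h := expR_ge1Dx (t ^+ 2 / m%:R).
apply: (@le_trans _ _ (m.+1%:R * (1 + t ^+ 2 / m%:R))); last by rewrite ler_pM2l.
rewrite -natr1 mulrDr mulr1 [_ * (_ / _)]mulrDl mul1r [_ * (_ / _)]mulrC divfK ?gt_eqF//.
have : 0 <= t ^+ 2 / m%:R by rewrite divr_ge0 ?sqr_ge0// ltW.
have := sqr_ge0 (`|t| - 1); rewrite -(real_normK (num_real t)).
have := normr_ge0 t; move: m0; set M := m%:R; move: `|t| => a; nra.
Qed.

Lemma gpoly_bound p : exists2 C, 0 <= C & forall t, `|gpoly p t| <= C * gauss_fun t.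
Proof.
exists (\sum_(i < size p) `|p`_i| * i.+1%:R ^+ i).
  by apply: sumr_ge0 => i _; rewrite mulr_ge0// exprn_ge0.
move=> t; rewrite /gpoly horner_coef normrM (ger0_norm (expR_ge0 _)).
have : `|\sum_(i < size p) p`_i * t ^+ i| <=
    (\sum_(i < size p) `|p`_i| * i.+1%:R ^+ i) * expR (t ^+ 2).
  apply: le_trans (ler_norm_sum _ _ _) _; rewrite mulr_suml.
  apply: ler_sum => i _; rewrite normrM normrX -mulrA ler_wpM2l//.
  exact: expr_le_expR.
move=> /(ler_wpM2r (expR_ge0 (- pi * t ^+ 2)))/le_trans; apply.
rewrite -mulrA -expRD ler_wpM2l//.
  by apply: sumr_ge0 => i _; rewrite mulr_ge0// exprn_ge0.
(* Since pi >= 2, the product of [exp (t^2)] and [exp (- pi t^2)] is still at most [exp (- t^2)]. *)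
rewrite /gauss_fun ler_expR; have := @pi_ge2 R; have := sqr_ge0 t.
by set T := t ^+ 2; move: pi T => a T; nra.
Qed.

Lemma gpoly_bounded p : exists2 C, 0 <= C & forall t, `|gpoly p t| <= C.
Proof.
have [C C0 h] := gpoly_bound p; exists C => // t.
by apply: le_trans (h t) _; rewrite ler_piMr// gauss_fun_le1.
Qed.

Lemma gpoly_bounded_integrable p (b : R -> R) (C : R) :
  continuous b -> (forall t, `|b t| <= C) ->
  mu.-integrable setT (EFin \o (fun t => gpoly p t * b t)).
Proof.
move=> cb bC; have [D D0 h] := gpoly_bound p.
have ig := integrableZ_EFin (D * C) measurableT (@integrableT_gauss R).
apply: (le_integrable _ _ _ ig) => //=.
  apply/measurable_EFinP; apply: continuous_measurable_fun => t.
  by apply: cvgM; [exact: continuous_gpoly|exact: cb].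
move=> t _; rewrite lee_fin normrM; apply: le_trans (ler_norm _).
by rewrite mulrAC ler_pM.
Qed.

Lemma cvg_gpoly_bounded (s : nat -> R) p (b : R -> R) (C : R) :
  (forall t, `|b t| <= C) -> (forall n, `|s n| = n%:R) ->
  (fun n => gpoly p (s n) * b (s n)) @ \oo --> (0 : R).
Proof.
move=> bC sn; have [D D0 h] := gpoly_bound p.
have C0 : 0 <= C by apply: le_trans (bC 0).
have hn n : `|gpoly p (s n) * b (s n)| <= D * C * n.+1%:R^-1.
  rewrite normrM mulrAC; apply: ler_pM => //; apply: le_trans (h _) _.
  (* [exp (- n^2) <= 1 / (1 + n^2) <= 1 / (n + 1)]. *)
  rewrite ler_wpM2l// /gauss_fun expRN lef_pV2 ?posrE ?expR_gt0//.
  apply: le_trans (expR_ge1Dx _); rewrite -(real_normK (num_real (s n))) sn -natr1 addrC lerD2l.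
  by rewrite -natrX ler_nat; case: n => // n; rewrite expnS leq_pmulr.
have hc : (fun n => D * C * n.+1%:R^-1) @ \oo --> (0 : R).
  rewrite -[X in _ --> X](mulr0 (D * C)).
  by apply: cvgM; [exact: cvg_cst|exact: cvg_harmonic].
apply/cvgrPdist_le => e e0; move/cvgrPdist_le : hc => /(_ _ e0).
apply: filterS => n; rewrite !sub0r !normrN; apply: le_trans.
exact: le_trans (hn n) (ler_norm _).
Qed.

End GaussPoly.

(** * Real integrals behind the short-time Fourier transform on this class *)

Section GaussStft.
Variable R : realType.
Local Notation mu := (@lebesgue_measure R).
Implicit Types (p q : {poly R}) (x t xi : R) (z : R * R).

(** With b the cosine or the sine of 2 pi xi t, this is the real part, or minus the imaginary part,
    of the transform at (x, xi). *)
Definition gint p q x (b : R -> R) : R :=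
  Rintegral mu setT (fun t => gpoly p t * (gpoly q (t - x) * b t)).

Definition bcont (b : R -> R) := continuous b /\ forall t, `|b t| <= 1.

Lemma bcont_cos a : bcont (fun t => cos (a * t)).
Proof.
split => [|t]; last by rewrite ler_norml cos_geN1 cos_le1.
by apply: (@derive_continuous _ _ (fun t => - (a * sin (a * t)))) => t;
  apply: is_derive_eq; rewrite /GRing.scale /=; ring.
Qed.
Lemma bcont_sin a : bcont (fun t => sin (a * t)).
Proof.
split => [|t]; last by rewrite ler_norml sin_geN1 sin_le1.
by apply: (@derive_continuous _ _ (fun t => (a * cos (a * t)))) => t;
  apply: is_derive_eq; rewrite /GRing.scale /=; ring.
Qed.

Lemma is_derive_gpoly_shift q x t :
  is_derive t 1 (fun t => gpoly q (t - x)) (gpoly (gder q) (t - x)).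
Proof.
have h : is_derive t 1 (fun t : R => t - x) 1 by apply: is_derive_eq; rewrite subr0.
have := @is_derive1_comp _ (gpoly q) (fun t => t - x) t _ _ (is_derive_gpoly q (t - x)) h.
by rewrite mulr1.
Qed.

Lemma gint_bounded q x b : bcont b ->
  exists C, continuous (fun t => gpoly q (t - x) * b t) /\
    forall t, `|gpoly q (t - x) * b t| <= C.
Proof.
move=> [cb b1]; have [C C0 h] := gpoly_bounded q; exists C; split => t.
  apply: cvgM; last exact: cb.
  exact: (derive_continuous (is_derive_gpoly_shift q x)).
by rewrite normrM -[C]mulr1 ler_pM.
Qed.

Lemma gint_integrable p q x b : bcont b ->
  mu.-integrable setT (EFin \o (fun t => gpoly p t * (gpoly q (t - x) * b t))).
Proof.
move=> /(gint_bounded q x)[C [cq bq]]; exact: gpoly_bounded_integrable cq bq.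
Qed.

Lemma gintDl p p' q x b : bcont b ->
  gint (p + p') q x b = gint p q x b + gint p' q x b.
Proof.
move=> hb; rewrite /gint -RintegralD//; try exact: gint_integrable.
by apply: eq_Rintegral => t _; rewrite gpolyD mulrDl.
Qed.
Lemma gintZl a p q x b : bcont b -> gint (a *: p) q x b = a * gint p q x b.
Proof.
move=> hb; rewrite /gint -RintegralZl//; last exact: gint_integrable.
by apply: eq_Rintegral => t _; rewrite gpolyZ -mulrA.
Qed.
Lemma gintDr p q q' x b : bcont b ->
  gint p (q + q') x b = gint p q x b + gint p q' x b.
Proof.
move=> hb; rewrite /gint -RintegralD//; try exact: gint_integrable.
by apply: eq_Rintegral => t _; rewrite gpolyD mulrDl mulrDr.
Qed.
Lemma gintZr a p q x b : bcont b -> gint p (a *: q) x b = a * gint p q x b.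
Proof.
move=> hb; rewrite /gint -RintegralZl//; last exact: gint_integrable.
by apply: eq_Rintegral => t _; rewrite gpolyZ; ring.
Qed.
Lemma gint_pos p q x b : bcont b ->
  x * gint p q x b = gint ('X * p) q x b - gint p ('X * q) x b.
Proof.
move=> hb; rewrite /gint -RintegralB//; try exact: gint_integrable.
rewrite -RintegralZl//; last exact: gint_integrable.
by apply: eq_Rintegral => t _; rewrite !gpolyX; ring.
Qed.

(** The integrals add up to that of the derivative of a product which vanishes at both ends. *)
Lemma gint_parts p q x (b db : R -> R) (c : R) : bcont b -> bcont db ->
  (forall t : R, is_derive t 1 b (c * db t)) ->
  gint (gder p) q x b + gint p (gder q) x b + c * gint p q x db = 0.
Proof.
move=> hb hdb hd; rewrite /gint -RintegralZl//; last exact: gint_integrable.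
rewrite -RintegralD//; try exact: gint_integrable.
have i1 := gint_integrable (gder p) q x hb.
have i2 := gint_integrable p (gder q) x hb.
have i3 := integrableZ_EFin c measurableT (gint_integrable p q x hdb).
rewrite -RintegralD//; last exact: (integrableD_EFin measurableT i1 i2).
have [C [cq bq]] := gint_bounded q x hb.
have dF (t : R) : is_derive t 1 (fun t => gpoly p t * (gpoly q (t - x) * b t))
    (gpoly (gder p) t * (gpoly q (t - x) * b t) +
     gpoly p t * (gpoly (gder q) (t - x) * b t) +
     c * (gpoly p t * (gpoly q (t - x) * db t))).
  have h1 := is_derive_gpoly p t; have h2 := is_derive_gpoly_shift q x t.
  have h3 := hd t.
  by apply: is_derive_eq; rewrite /GRing.scale /=; ring.
apply: (Rintegral_derive0 dF).
- have cont a b' u : bcont u -> continuous (fun t => gpoly a t * (gpoly b' (t - x) * u t)).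
    move=> hu t; have [D [cd _]] := gint_bounded b' x hu.
    by apply: cvgM; [exact: continuous_gpoly|exact: cd].
  move=> t; apply: cvgD; first by apply: cvgD; exact: cont.
  by apply: cvgM; [exact: cvg_cst|exact: cont].
- exact: (integrableD_EFin measurableT (integrableD_EFin measurableT i1 i2) i3).
- by apply: cvg_gpoly_bounded bq _ => n; rewrite normr_nat.
- by apply: cvg_gpoly_bounded bq _ => n; rewrite normrN normr_nat.
Qed.

Lemma gint_deriv_freq p q x xi (b db : R -> R) :
  (forall t : R, is_derive t 1 b (db t)) -> (forall t, `|b t| <= 1) ->
  continuous db -> (forall t, `|db t| <= 1) ->
  is_derive xi 1 (fun y => gint p q x (fun t => b (2 * pi * y * t)))
    (2 * pi * gint ('X * p) q x (fun t => db (2 * pi * xi * t))).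
Proof.
move=> hb b1 cdb db1.
have cb := derive_continuous hb.
have bc u y : continuous u -> (forall t, `|u t| <= 1) ->
    bcont (fun t => u (2 * pi * y * t)).
  move=> cu u1; split=> // t.
  apply: (@continuous_comp _ _ _ (fun t => 2 * pi * y * t) u); last exact: cu.
  by apply: cvgM; [exact: cvg_cst|exact: cvg_id].
have bb y : bcont (fun t => b (2 * pi * y * t)) by exact: bc.
pose f y t := gpoly p t * (gpoly q (t - x) * b (2 * pi * y * t)).
have df (y t : R) : is_derive y 1 (f ^~ t)
    (2 * pi * (gpoly ('X * p) t * (gpoly q (t - x) * db (2 * pi * y * t)))).
  have h : is_derive y 1 (fun y : R => 2 * pi * y * t) (2 * pi * t).
    by apply: is_derive_eq; rewrite /GRing.scale /=; ring.
  have h2 := @is_derive1_comp _ b (fun y => 2 * pi * y * t) y _ _ (hb _) h.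
  by apply: is_derive_eq; rewrite /GRing.scale /= gpolyX; ring.
have [C C0 hC] := gpoly_bounded q; have [D D0 hD] := gpoly_bound ('X * p).
pose G t := (2 * pi * D * C) * gauss_fun t.
have G0 t : 0 <= G t.
  by rewrite /G !mulr_ge0 ?pi_ge0 ?gauss_fun_ge0.
have iG : mu.-integrable setT (EFin \o G).
  exact: (integrableZ_EFin _ measurableT (@integrableT_gauss R)).
have Ia : `]xi - 1, xi + 1[%classic xi by rewrite /= in_itv/= gtrBl ltrDl ltr01.
have intf y : `]xi - 1, xi + 1[%classic y -> mu.-integrable setT (EFin \o f y).
  by move=> _; exact: gint_integrable.
have derf1 y t : `]xi - 1, xi + 1[%classic y -> setT t -> derivable (f ^~ t) y 1.
  by move=> _ _; have [] := df y t.
have d1E y t : partial1of2 f y t =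
    2 * pi * (gpoly ('X * p) t * (gpoly q (t - x) * db (2 * pi * y * t))).
  by rewrite partial1of2E; have [_ ->] := df y t.
have Gub y t : `]xi - 1, xi + 1[%classic y -> setT t -> `|partial1of2 f y t| <= G t.
  move=> _ _; rewrite d1E 3!normrM [`|gpoly q _ * _|]normrM [`|2|]ger0_norm//.
  rewrite [`|pi|]ger0_norm ?pi_ge0// /G.
  have -> : 2 * pi * D * C * gauss_fun t = 2 * pi * ((D * gauss_fun t) * (C * 1)).
    by rewrite mulr1; ring.
  rewrite ler_wpM2l ?mulr_ge0 ?pi_ge0//.
  by apply: ler_pM; rewrite ?mulr_ge0//; apply: ler_pM.
apply: DeriveDef.
  exact: (derivable_under_integral measurableT Ia intf derf1 G0 iG Gub).
rewrite -derive1E.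
rewrite (differentiation_under_integral measurableT Ia intf derf1 G0 iG Gub).
rewrite /gint -RintegralZl//.
  by apply: eq_Rintegral => t _; rewrite d1E.
by apply: gint_integrable; exact: bc.
Qed.

End GaussStft.

Section HermiteStft.
Variable R : realType.
Local Notation mu := (@lebesgue_measure R).
Local Notation rt n := (Num.sqrt n%:R : R).
Implicit Types (p q : {poly R}) (x t xi : R) (z : R * R).

Definition gstft q p z : R[i] :=
  stft (fun t => rc (gpoly q t)) (fun t => rc (gpoly p t)) z.

Lemma gstftE q p z : gstft q p z =
  Complex (gint p q z.1 (fun t => cos (2 * pi * z.2 * t)))
          (- gint p q z.1 (fun t => sin (2 * pi * z.2 * t))).
Proof.
rewrite /gstft /stft /ip1 /cint1; congr Complex.
  by apply: eq_Rintegral => t _; rewrite /tfshift !cE /=; ring.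
rewrite -mulN1r -RintegralZl//; last exact: (gint_integrable _ _ _ (bcont_sin _)).
by apply: eq_Rintegral => t _; rewrite /tfshift !cE /=; ring.
Qed.

Lemma gstftDr q p p' z : gstft q (p + p') z = gstft q p z + gstft q p' z.
Proof.
have hc := bcont_cos (2 * pi * z.2); have hs := bcont_sin (2 * pi * z.2).
by rewrite !gstftE !gintDl//; apply: complexP; rewrite !cE //= opprD.
Qed.
Lemma gstftDl q q' p z : gstft (q + q') p z = gstft q p z + gstft q' p z.
Proof.
have hc := bcont_cos (2 * pi * z.2); have hs := bcont_sin (2 * pi * z.2).
by rewrite !gstftE !gintDr//; apply: complexP; rewrite !cE //= opprD.
Qed.
Lemma gstftZr q p a z : gstft q (a *: p) z = rc a * gstft q p z.
Proof.
have hc := bcont_cos (2 * pi * z.2); have hs := bcont_sin (2 * pi * z.2).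
by rewrite !gstftE !gintZl//; apply: complexP; rewrite !cE //=; ring.
Qed.
Lemma gstftZl q p a z : gstft (a *: q) p z = rc a * gstft q p z.
Proof.
have hc := bcont_cos (2 * pi * z.2); have hs := bcont_sin (2 * pi * z.2).
by rewrite !gstftE !gintZr//; apply: complexP; rewrite !cE //=; ring.
Qed.

(** Position and frequency act on signal and window through [X] and [gder]: here because x = t - (t
    - x), in the next lemma by integration by parts. The ladder relations are combinations of the
    two. *)
Lemma gstft_pos q p z :
  rc z.1 * gstft q p z = gstft q ('X * p) z - gstft ('X * q) p z.
Proof.
have hc := bcont_cos (2 * pi * z.2); have hs := bcont_sin (2 * pi * z.2).
rewrite !gstftE; apply: complexP; rewrite !cE /= mul0r ?subr0 ?addr0 ?mulrN gint_pos//.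
by ring.
Qed.

Lemma gstft_freq q p z :
  Complex 0 (2 * pi * z.2) * gstft q p z = gstft q (gder p) z + gstft (gder q) p z.
Proof.
have hc := bcont_cos (2 * pi * z.2); have hs := bcont_sin (2 * pi * z.2).
have := gint_parts p q z.1 (c := - (2 * pi * z.2)) hc hs.
have := gint_parts p q z.1 (c := 2 * pi * z.2) hs hc.
set a := 2 * pi * z.2 => h1 h2.
have {}h1 : gint (gder p) q z.1 (fun t => sin (a * t)) +
    gint p (gder q) z.1 (fun t => sin (a * t)) +
    a * gint p q z.1 (fun t => cos (a * t)) = 0.
  by apply: h1 => t; apply: is_derive_eq; rewrite /GRing.scale /=; ring.
have {}h2 : gint (gder p) q z.1 (fun t => cos (a * t)) +
    gint p (gder q) z.1 (fun t => cos (a * t)) +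
    - a * gint p q z.1 (fun t => sin (a * t)) = 0.
  by apply: h2 => t; apply: is_derive_eq; rewrite /GRing.scale /=; ring.
rewrite !gstftE -/a; apply: complexP; rewrite !cE /=.
  by move: h2; move: (gint _ _ _ _) (gint _ _ _ _) (gint _ _ _ _) => u v w; lra.
by move: h1; move: (gint _ _ _ _) (gint _ _ _ _) (gint _ _ _ _) => u v w; lra.
Qed.

Definition gauss_stft z : R[i] :=
  cexpi (- (pi * z.1 * z.2)) * rc (expR (- (pi * (z.1 ^+ 2 + z.2 ^+ 2)) / 2)).

(** Completing the square: the product of the two Gaussians is a multiple of the normal density with
    mean x / 2 and standard deviation 1 / (2 sqrt pi). *)
Lemma gint1_freq0 x : gint 1 1 x (fun=> 1) = (Num.sqrt 2)^-1 * expR (- pi * x ^+ 2 / 2).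
Proof.
pose s : R := (2 * Num.sqrt pi)^-1.
have sp0 : 0 < Num.sqrt pi :> R by rewrite sqrtr_gt0 pi_gt0.
have spp : Num.sqrt pi * Num.sqrt pi = pi :> R by rewrite -expr2 sqr_sqrtr// pi_ge0.
have s0 : s != 0 by rewrite invr_neq0// gt_eqF// mulr_gt0.
have := integral_normal_pdf (x / 2) s => h.
have np : normal_peak s = Num.sqrt 2.
  rewrite /normal_peak.
  have -> : s ^+ 2 * pi *+ 2 = 2^-1.
    rewrite /s -mulr_natl; move: sp0 spp; move: (Num.sqrt pi) => a a0 <-.
    by field; rewrite gt_eqF.
  by rewrite sqrtrV// invrK.
have e t : gpoly 1 t * (gpoly 1 (t - x) * 1) =
   (Num.sqrt 2)^-1 * expR (- pi * x ^+ 2 / 2) * normal_pdf (x / 2) s t.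
  rewrite /normal_pdf (negbTE s0) np /normal_fun /gpoly !hornerC !mul1r mulr1.
  rewrite mulrAC !mulrA mulVf ?gt_eqF ?sqrtr_gt0// mul1r -!expRD; congr expR.
  rewrite /s -mulr_natl; move: sp0 spp; move: (Num.sqrt pi) => a a0 <-.
  by field; rewrite gt_eqF.
rewrite /gint /Rintegral; under eq_integral do rewrite e EFinM.
rewrite integralZl//=; last first.
  exact: integrable_normal_pdf.
by rewrite h mule1.
Qed.
Lemma const_of_derive0 (f : R -> R) : (forall x : R, is_derive x 1 f 0) ->
  forall x y, f x = f y.
Proof. by move=> h x y; apply: is_derive_0_is_cst. Qed.

(** At fixed x, the real part A and minus the imaginary part B solve a linear differential system in
    xi: since [gder 1] is a multiple of X, position and frequency together express the transform of
    [X] through A and B. The solution is determined by its value at xi = 0. *)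
Lemma gstft11 z : gstft 1 1 z = rc (Num.sqrt 2)^-1 * gauss_stft z.
Proof.
case: z => x xi0.
pose A xi := gint 1 1 x (fun t => cos (2 * pi * xi * t)).
pose B xi := gint 1 1 x (fun t => sin (2 * pi * xi * t)).
have d1 : gder 1 = - (2 * pi) *: ('X * 1) :> {poly R}.
  by rewrite /gder derivC sub0r scaleNr.
have key xi : gstft 1 ('X * 1) (x, xi) = rc (2^-1) * Complex x (- xi) * gstft 1 1 (x, xi).
  have h1 := gstft_pos 1 1 (x, xi); have h2 := gstft_freq 1 1 (x, xi).
  rewrite d1 gstftZr gstftZl /= in h1 h2.
  have p0 : rc (2 * pi) != 0 :> R[i].
    by apply/eqP => /rc_inj/eqP; rewrite mulf_eq0 pnatr_eq0/= gt_eqF// pi_gt0.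
  apply: (mulfI p0); apply: (@mulfI _ 2); first by rewrite pnatr_eq0.
  have -> : 2 * (rc (2 * pi) * (rc (2^-1) * Complex x (- xi) * gstft 1 1 (x, xi))) =
     rc (2 * pi) * (rc x * gstft 1 1 (x, xi)) - Complex 0 (2 * pi * xi) * gstft 1 1 (x, xi).
    have -> : 2 = rc 2 :> R[i] by rewrite (rcD 1 1).
    by apply: complexP; rewrite !cE /=; field.
  rewrite h1 h2 rcN.
  by ring.
have kA xi : gint ('X * 1) 1 x (fun t => cos (2 * pi * xi * t)) =
    (x * A xi - xi * B xi) / 2.
  have := key xi; rewrite !gstftE => /(congr1 (@Re R)); rewrite !cE /= => ->.
  by rewrite -/(A xi) -/(B xi); field.
have kB xi : gint ('X * 1) 1 x (fun t => sin (2 * pi * xi * t)) =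
    (x * B xi + xi * A xi) / 2.
  apply: oppr_inj.
  have := key xi; rewrite !gstftE => /(congr1 (@Im R)); rewrite !cE /= => ->.
  by rewrite -/(A xi) -/(B xi); field.
have cos1 (t : R) : `|cos t| <= 1 by rewrite ler_norml cos_geN1 cos_le1.
have sin1 (t : R) : `|sin t| <= 1 by rewrite ler_norml sin_geN1 sin_le1.
have dA (xi : R) : is_derive xi 1 A (- pi * (x * B xi + xi * A xi)).
  apply: is_derive_eq.
    apply: (@gint_deriv_freq R 1 1 x xi cos (fun t => - sin t)) => //.
      by move=> t; apply: cvgN; exact: continuous_sin.
    by move=> t; rewrite normrN.
  have -> : gint ('X * 1) 1 x (fun t => - sin (2 * pi * xi * t)) =
      -1 * gint ('X * 1) 1 x (fun t => sin (2 * pi * xi * t)).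
    rewrite /gint -RintegralZl//; last exact: (gint_integrable _ _ _ (bcont_sin _)).
    by apply: eq_Rintegral => t _; ring.
  by rewrite kB; field.
have dB (xi : R) : is_derive xi 1 B (pi * (x * A xi - xi * B xi)).
  apply: is_derive_eq.
    apply: (@gint_deriv_freq R 1 1 x xi sin cos) => //.
    exact: continuous_cos.
  by rewrite kA; field.
pose e xi := expR (pi / 2 * xi ^+ 2).
pose c xi := cos (pi * x * xi); pose s xi := sin (pi * x * xi).
have de (xi : R) : is_derive xi 1 e (pi * xi * e xi).
  by apply: is_derive_eq; rewrite /GRing.scale /= /e; field.
have dc (xi : R) : is_derive xi 1 c (- (pi * x) * s xi).
  by apply: is_derive_eq; rewrite /GRing.scale /= /s; ring.
have ds (xi : R) : is_derive xi 1 s (pi * x * c xi).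
  by apply: is_derive_eq; rewrite /GRing.scale /= /c; ring.
(* First integrals of the system: (A, B) multiplied by e, which undoes the Gaussian decay, and
   rotated back by the angle pi x xi. *)
have ca xi : e xi * (A xi * c xi + B xi * s xi) = e 0 * (A 0 * c 0 + B 0 * s 0).
  apply: (@const_of_derive0 (fun xi => e xi * (A xi * c xi + B xi * s xi))) => y.
  by apply: is_derive_eq; rewrite /GRing.scale /=; ring.
have cb xi : e xi * (B xi * c xi - A xi * s xi) = e 0 * (B 0 * c 0 - A 0 * s 0).
  apply: (@const_of_derive0 (fun xi => e xi * (B xi * c xi - A xi * s xi))) => y.
  by apply: is_derive_eq; rewrite /GRing.scale /=; ring.
have e0 : e 0 = 1 by rewrite /e expr0n mulr0 expR0.
have c0 : c 0 = 1 by rewrite /c mulr0 cos0.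
have s0 : s 0 = 0 by rewrite /s mulr0 sin0.
have B0 : B 0 = 0.
  rewrite /B /gint (_ : (fun t => _) = cst 0) ?Rintegral_cst ?mul0r//.
  by apply/funext => t; rewrite mulr0 mul0r sin0 !mulr0.
have A0 : A 0 = (Num.sqrt 2)^-1 * expR (- pi * x ^+ 2 / 2).
  rewrite -gint1_freq0; congr gint; apply/funext => t.
  by rewrite mulr0 mul0r cos0.
have /= {ca}ca := ca xi0; have /= {cb}cb := cb xi0.
rewrite e0 c0 s0 B0 !mulr0 !mulr1 mul1r addr0 in ca.
rewrite e0 c0 s0 B0 !mulr0 mul0r mul1r subr0 in cb.
have cs1 : c xi0 ^+ 2 + s xi0 ^+ 2 = 1 by exact: cos2Dsin2.
have ee : e xi0 * expR (- (pi / 2 * xi0 ^+ 2)) = 1 by rewrite expRxMexpNx_1.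
have E0 : expR (- (pi * (x ^+ 2 + xi0 ^+ 2)) / 2) =
    expR (- pi * x ^+ 2 / 2) * expR (- (pi / 2 * xi0 ^+ 2)).
  by rewrite -expRD; congr expR; field.
have solA : A xi0 = expR (- (pi / 2 * xi0 ^+ 2)) * (A 0 * c xi0).
  transitivity (e xi0 * expR (- (pi / 2 * xi0 ^+ 2)) *
     (c xi0 ^+ 2 + s xi0 ^+ 2) * A xi0); first by rewrite ee cs1 !mul1r.
  rewrite -ca; apply/eqP; rewrite -subr_eq0; apply/eqP.
  transitivity (expR (- (pi / 2 * xi0 ^+ 2)) * - s xi0 *
    (e xi0 * (B xi0 * c xi0 - A xi0 * s xi0))); last by rewrite cb mulr0.
  by ring.
have solB : B xi0 = expR (- (pi / 2 * xi0 ^+ 2)) * (A 0 * s xi0).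
  transitivity (e xi0 * expR (- (pi / 2 * xi0 ^+ 2)) *
     (c xi0 ^+ 2 + s xi0 ^+ 2) * B xi0); first by rewrite ee cs1 !mul1r.
  rewrite -ca; apply/eqP; rewrite -subr_eq0; apply/eqP.
  transitivity (expR (- (pi / 2 * xi0 ^+ 2)) * c xi0 *
    (e xi0 * (B xi0 * c xi0 - A xi0 * s xi0))); last by rewrite cb mulr0.
  by ring.
rewrite gstftE -/(A xi0) -/(B xi0) solA solB A0 /gauss_stft E0.
by apply: complexP; rewrite !cE /= cosN sinN -/(c xi0) -/(s xi0); ring.
Qed.

End HermiteStft.

(** * Hermite functions and the ladder relations of their transforms *)

Section Hermite.
Variable R : realType.
Local Notation rt n := (Num.sqrt n%:R : R).
Local Notation sp := (Num.sqrt (pi : R)).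
Implicit Types (p q : {poly R}) (x t xi : R) (z : R * R).

(** The polynomial factor in the Rodrigues formula before normalization: differentiating
    [p exp (- 2 pi s^2)] replaces p by [p' - 4 pi X p]. *)
Fixpoint hq n : {poly R} :=
  if n is k.+1 then (hq k)^`() - (4 * pi) *: ('X * hq k) else 1.
Definition hcoef n : R :=
  2 `^ (4^-1) / Num.sqrt (n`!)%:R * (- 1 / (2 * Num.sqrt pi)) ^+ n.
Definition hpoly n : {poly R} := hcoef n *: hq n.

Lemma sqrtpi_gt0 : 0 < sp. Proof. by rewrite sqrtr_gt0 pi_gt0. Qed.
Lemma sqrtpi_sqr : sp * sp = pi. Proof. by rewrite -expr2 sqr_sqrtr// pi_ge0. Qed.

Lemma hermite_rodrigues n t :
  derive1n n (fun s : R => expR (- (2 * pi) * s ^+ 2)) t =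
  (hq n).[t] * expR (- (2 * pi) * t ^+ 2).
Proof.
elim: n t => [|n IH] t; first by rewrite /= hornerC mul1r.
have -> : derive1n n.+1 (fun s : R => expR (- (2 * pi) * s ^+ 2)) =
    derive1 (fun t => (hq n).[t] * expR (- (2 * pi) * t ^+ 2)).
  by rewrite derive1nS; congr derive1; apply/funext.
rewrite derive1E; have : is_derive t 1
    (fun t => (hq n).[t] * expR (- (2 * pi) * t ^+ 2))
    ((hq n.+1).[t] * expR (- (2 * pi) * t ^+ 2)).
  apply: is_derive_eq; rewrite /= !hornerE /GRing.scale /=.
  by ring.
by case.
Qed.

Lemma hermiteE n : hermite n = fun t => rc (gpoly (hpoly n) t).
Proof.
apply/funext => t; rewrite /hermite hermite_rodrigues gpolyZ /gpoly; congr rc.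
rewrite -/(hcoef n) -[LHS]mulrA; congr (_ * _); rewrite mulrCA; congr (_ * _).
by rewrite -expRD; congr expR; ring.
Qed.

(** The Appell property of Hermite polynomials; it turns the lowering operator into a shift of the
    index. *)
Lemma hq_deriv n : (hq n)^`() = - (4 * pi * n%:R) *: hq n.-1.
Proof.
elim: n => [|n IH]; first by rewrite /= derivC mulr0 oppr0 scale0r.
have h : (n%:R : R) *: ((hq n.-1)^`() - (4 * pi) *: ('X * hq n.-1)) = n%:R *: hq n.
  by case: n {IH} => [|n] //=; rewrite !scale0r.
rewrite /= derivB derivZ derivM derivX mul1r [in LHS]IH derivZ.
have -> : - (4 * pi * n%:R) *: (hq n.-1)^`() -
    (4 * pi) *: (hq n + 'X * (- (4 * pi * n%:R) *: hq n.-1)) =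
    - (4 * pi) *: (n%:R *: ((hq n.-1)^`() - (4 * pi) *: ('X * hq n.-1))) - (4 * pi) *: hq n.
  by rewrite -!mul_polyC !polyCN !polyCM; ring.
rewrite h -natr1 -!mul_polyC !polyCN !polyCM polyCD; ring.
Qed.

Lemma hcoefS n : hcoef n = - (2 * sp * rt n.+1) * hcoef n.+1.
Proof.
rewrite /hcoef rt_fact exprS.
have := rtS_neq0 R n; have := rt_fact_neq0 R n; have := sqrtpi_gt0.
move: (Num.sqrt _) (rt n.+1) (Num.sqrt _) => a b c a0 c0 b0.
by field; rewrite b0 c0 gt_eqF.
Qed.

Lemma hpoly_lower n :
  gder (hpoly n) + (2 * pi) *: ('X * hpoly n) = (2 * sp * rt n) *: hpoly n.-1.
Proof.
rewrite /gder subrK derivZ hq_deriv /hpoly !scalerA; congr (_ *: _).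
case: n => [|n]; first by rewrite rt0 !mulr0 oppr0 mulr0 mul0r.
rewrite [n.+1.-1]/= (hcoefS n); have := rt_sqr R n.+1; have := sqrtpi_sqr.
by move: sp (rt n.+1) => a b <- <-; ring.
Qed.

Lemma hpoly_raise n :
  (2 * pi) *: ('X * hpoly n) - gder (hpoly n) = (2 * sp * rt n.+1) *: hpoly n.+1.
Proof.
rewrite /gder /hpoly derivZ scalerA /=.
have := hcoefS n; move: (2 * sp * rt n.+1) => a ->.
rewrite (_ : 4 * pi = 2 * pi + 2 * pi); last by ring.
by rewrite -!mul_polyC polyCD !polyCM !polyCN; ring.
Qed.

(** The complex coordinate scaled so that its squared modulus is pi |z|^2, the variable x^2 of
    [dsp]. *)
Definition wcoord z : R[i] := Complex (sp * z.1) (sp * z.2).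
Definition hstft r j z : R[i] := stft (hermite r) (hermite j) z.

Lemma hstftE r j z : hstft r j z = gstft (hpoly r) (hpoly j) z.
Proof. by rewrite /hstft !hermiteE. Qed.

Lemma gstft_hlower_r q j z :
  rc (2 * sp * rt j) * gstft q (hpoly j.-1) z =
  gstft q (gder (hpoly j)) z + rc (2 * pi) * gstft q ('X * hpoly j) z.
Proof. by rewrite -!gstftZr -gstftDr hpoly_lower. Qed.
Lemma gstft_hlower_l p j z :
  rc (2 * sp * rt j) * gstft (hpoly j.-1) p z =
  gstft (gder (hpoly j)) p z + rc (2 * pi) * gstft ('X * hpoly j) p z.
Proof. by rewrite -!gstftZl -gstftDl hpoly_lower. Qed.
Lemma gstft_hraise_r q j z :
  rc (2 * sp * rt j.+1) * gstft q (hpoly j.+1) z =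
  rc (2 * pi) * gstft q ('X * hpoly j) z - gstft q (gder (hpoly j)) z.
Proof.
rewrite -!gstftZr -hpoly_raise gstftDr -scaleN1r [X in _ + X]gstftZr.
by rewrite rcN rc1 mulN1r.
Qed.
Lemma gstft_hraise_l p j z :
  rc (2 * sp * rt j.+1) * gstft (hpoly j.+1) p z =
  rc (2 * pi) * gstft ('X * hpoly j) p z - gstft (gder (hpoly j)) p z.
Proof.
rewrite -!gstftZl -hpoly_raise gstftDl -scaleN1r [X in _ + X]gstftZl.
by rewrite rcN rc1 mulN1r.
Qed.

(** Multiplication by 2 pi (x + i xi) applies the lowering operator to the signal and minus the
    raising operator to the window. For the conjugate factor, in the next lemma, the two operators
    change places. *)
Lemma hstft_lower r j z : wcoord z * hstft r j z =
  rc (rt j) * hstft r j.-1 z - rc (rt r.+1) * hstft r.+1 j z.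
Proof.
have s0 : rc (2 * sp) != 0 :> R[i].
  by apply/eqP => /rc_inj/eqP; rewrite mulf_eq0 pnatr_eq0/= gt_eqF// sqrtpi_gt0.
apply: (mulfI s0).
have -> : rc (2 * sp) * (wcoord z * hstft r j z) =
    rc (2 * pi) * (rc z.1 * hstft r j z) + Complex 0 (2 * pi * z.2) * hstft r j z.
  rewrite /wcoord; move: (hstft r j z) => F; have := sqrtpi_sqr; move: sp => a <-.
  by apply: complexP; rewrite !cE /=; ring.
rewrite !hstftE gstft_pos gstft_freq [RHS]mulrBr ![in RHS]mulrA -!rcM.
by rewrite gstft_hlower_r gstft_hraise_l; ring.
Qed.

Lemma hstft_raise r j z : cj (wcoord z) * hstft r j z =
  rc (rt j.+1) * hstft r j.+1 z - rc (rt r) * hstft r.-1 j z.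
Proof.
have s0 : rc (2 * sp) != 0 :> R[i].
  by apply/eqP => /rc_inj/eqP; rewrite mulf_eq0 pnatr_eq0/= gt_eqF// sqrtpi_gt0.
apply: (mulfI s0).
have -> : rc (2 * sp) * (cj (wcoord z) * hstft r j z) =
    rc (2 * pi) * (rc z.1 * hstft r j z) - Complex 0 (2 * pi * z.2) * hstft r j z.
  rewrite /wcoord; move: (hstft r j z) => F; have := sqrtpi_sqr; move: sp => a <-.
  by apply: complexP; rewrite !cE /=; ring.
rewrite !hstftE gstft_pos gstft_freq [RHS]mulrBr ![in RHS]mulrA -!rcM.
by rewrite gstft_hraise_r gstft_hlower_l; ring.
Qed.

Definition phase z : R[i] := cexpi (- (pi * z.1 * z.2)).

Lemma csq_wcoord z : csq (wcoord z) = pi * (z.1 ^+ 2 + z.2 ^+ 2).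
Proof. by rewrite /csq /= !exprMn expr2 sqrtpi_sqr; ring. Qed.

Lemma hcoef0_sqr : hcoef 0 * hcoef 0 = Num.sqrt 2.
Proof.
rewrite /hcoef fact0 sqrtr1 divr1 expr0 mulr1 -powRD; last first.
  by apply/implyP => _; rewrite pnatr_eq0.
by rewrite -powR12_sqrt//; congr (_ `^ _); field.
Qed.

Lemma hstftS0 r z : hstft r.+1 0 z = - rc (rt r.+1)^-1 * (wcoord z * hstft r 0 z).
Proof.
rewrite hstft_lower rt0 rc0 mul0r sub0r mulrNN mulrA -rcM mulVf ?rtS_neq0//.
by rewrite rc1 mul1r.
Qed.
Lemma hstftSr r j z : hstft r j.+1 z =
  rc (rt j.+1)^-1 * (cj (wcoord z) * hstft r j z + rc (rt r) * hstft r.-1 j z).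
Proof.
by rewrite hstft_raise subrK mulrA -rcM mulVf ?rtS_neq0// mul1r.
Qed.

(** [hstft] and [dsp] obey the same recursions with [rc rho * u] in place of x; a step in r
    contributes a factor u, a step in j a factor [cj u]. The induction starts from the Gaussian,
    runs in r along j = 0, and then in j. *)
Theorem hstft_polar r j z rho u : csq u = 1 -> wcoord z = rc rho * u ->
  hstft r j z = phase z * u ^+ r * cj u ^+ j * rc (dsp j r rho).
Proof.
move=> u1 wE; have uu := unit_cj u1.
have rho2 : rho ^+ 2 = pi * (z.1 ^+ 2 + z.2 ^+ 2).
  by rewrite -csq_wcoord wE csqM u1 mulr1 csq_rc.
have h0 k : hstft k 0 z = phase z * u ^+ k * rc (dsp 0 k rho).
  elim: k => [|k IH].
    rewrite hstftE /hpoly !gstftZl !gstftZr gstft11 /gauss_stft -/(phase z).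
    rewrite expr0 mulr1 /dsp expr0 fact0 sqrtr1 divr1 mul1r -rho2.
    transitivity (rc (hcoef 0 * hcoef 0 * (Num.sqrt 2)^-1) *
      (phase z * rc (expR (- rho ^+ 2 / 2)))); first by rewrite !rcM; ring.
    by rewrite hcoef0_sqr mulfV ?gt_eqF ?sqrtr_gt0// mul1r.
  rewrite hstftS0 IH wE.
  have -> : dsp 0 k.+1 rho = - (rt k.+1)^-1 * (rho * dsp 0 k rho).
    by rewrite dsp0S mulrA mulrNN mulVf ?rtS_neq0// mul1r.
  by move: (dsp 0 k rho) => D; rewrite !rcM rcN (exprS u); ring.
elim: j r => [|j IH] r; first by rewrite expr0 mulr1 h0.
rewrite hstftSr IH IH wE cjM cj_rc /= mulrC [RHS]mulrC rcM rcD !rcM.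
case: r => [|r]; first by rewrite rt0 rc0 !exprS; ring.
rewrite [r.+1.-1]/=; transitivity (rc (rt j.+1)^-1 * (phase z * u ^+ r * cj u ^+ j *
  (rc rho * (u * cj u) * rc (dsp j r.+1 rho) + rc (rt r.+1) * (u * cj u) * rc (dsp j r rho)))).
  transitivity (rc (rt j.+1)^-1 * (phase z * u ^+ r * cj u ^+ j *
    (rc rho * (u * cj u) * rc (dsp j r.+1 rho) + rc (rt r.+1) * rc (dsp j r rho)))).
    by rewrite exprS; ring.
  by rewrite uu !mulr1.
by rewrite !exprS; ring.
Qed.

End Hermite.

(** * Polar coordinates *)

Section MeasurePreserving.
Context d1 d2 (X : measurableType d1) (Y : measurableType d2) (R : realType).
Variables (mu : {measure set X -> \bar R}) (nu : {measure set Y -> \bar R}).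

Definition mpres (phi : X -> Y) :=
  measurable_fun setT phi /\
  forall A, measurable A -> mu (phi @^-1` A) = nu A.

Lemma mpres_ge0_integral phi (D : set Y) (f : Y -> \bar R) : mpres phi ->
  measurable D -> measurable_fun D f -> {in D, forall y, (0 <= f y)%E} ->
  (\int[mu]_(x in phi @^-1` D) (f \o phi) x = \int[nu]_(y in D) f y)%E.
Proof.
move=> [mphi mE] mD mf f0; rewrite -ge0_integral_pushforward//.
by apply: eq_measure_integral => A mA _; rewrite /pushforward /= -mE.
Qed.

Lemma mpres_integrable phi (f : Y -> \bar R) : mpres phi ->
  measurable_fun setT f -> mu.-integrable setT (f \o phi) <-> nu.-integrable setT f.
Proof.
move=> hphi mf; have [mphi _] := hphi.
have mfp : measurable_fun setT (f \o phi) by exact: measurableT_comp.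
have h : (\int[mu]_x `|(f \o phi) x| = \int[nu]_y `|f y|)%E.
  rewrite -[X in integral _ X _](preimage_setT phi).
  rewrite -(mpres_ge0_integral hphi (f := fun y => `|f y|%E))//.
  exact: measurableT_comp.
by split => /integrableP[_ fi]; apply/integrableP; split => //; rewrite ?h// -h.
Qed.

Lemma mpres_Rintegral phi (D : set Y) (f : Y -> R) : mpres phi -> measurable D ->
  measurable_fun setT f -> mu.-integrable (phi @^-1` D) (EFin \o f \o phi) ->
  Rintegral mu (phi @^-1` D) (f \o phi) = Rintegral nu D f.
Proof.
move=> [mphi mE] mD mf fi; rewrite /Rintegral; congr fine.
have mf' : measurable_fun setT (EFin \o f) by apply/measurable_EFinP.
rewrite -[LHS](integral_pushforward mphi mf' fi mD).
by apply: eq_measure_integral => A mA _; rewrite /pushforward /= -mE.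
Qed.

Lemma mpres_cint phi (D : set Y) (f : Y -> R[i]) : mpres phi -> measurable D ->
  cmeas setT f -> cintegrable mu (phi @^-1` D) (f \o phi) ->
  cint mu (phi @^-1` D) (f \o phi) = cint nu D f.
Proof.
move=> hphi mD [mr mi] [ir ii]; apply: complexP.
  exact: (mpres_Rintegral hphi mD mr ir).
exact: (mpres_Rintegral hphi mD mi ii).
Qed.

End MeasurePreserving.

Lemma mpres_comp d1 d2 d3 (X : measurableType d1) (Y : measurableType d2)
  (Z : measurableType d3) (R : realType)
  (mu : {measure set X -> \bar R}) (nu : {measure set Y -> \bar R})
  (rho : {measure set Z -> \bar R}) (f : X -> Y) (g : Y -> Z) :
  mpres mu nu f -> mpres nu rho g -> mpres mu rho (g \o f).
Proof.
move=> [mf fE] [mg gE]; split; first exact: measurableT_comp.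
by move=> A mA; rewrite comp_preimage fE ?gE// -[X in measurable X]setTI; exact: mg.
Qed.

(** * Translations, shears and rotations preserve Lebesgue measure *)

Section Geometry.
Variable R : realType.
Local Notation leb1 := (@Defs.leb1 R).
Local Notation leb2 := (@Defs.leb2 R).
Local Notation mu := (@lebesgue_measure R).

Lemma mpres_shift (a : R) : mpres mu mu (fun x : R => x + a).
Proof.
have ms : measurable_fun [set: R] (fun x : R => x + a).
  by apply: measurable_funD => //; exact: measurable_cst.
split=> // A mA.
rewrite -[LHS]/(pushforward mu (fun x : measurableTypeR R => x + a : measurableTypeR R) A).
apply/esym/lebesgue_measure_unique => //= _ [[b c]] _ <-.
rewrite /pushforward.
have -> : (fun x : R => x + a) @^-1` `]b, c]%classic = `]b - a, c - a]%classic.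
  by apply/seteqP; split => x /=; rewrite !in_itv /= ltrBlDr lerBrDr.
rewrite !lebesgue_measure_itv/= !lte_fin ltrD2r.
by case: ifP => // _; rewrite -!EFinD; congr EFin; ring.
Qed.

Definition shearY (a : R) (z : R * R) : R * R := (z.1, z.2 + a * z.1).
Definition shearX (a : R) (z : R * R) : R * R := (z.1 + a * z.2, z.2).

Lemma measurable_pair (f g : R * R -> R) :
  measurable_fun setT f -> measurable_fun setT g ->
  measurable_fun setT (fun z => (f z, g z)).
Proof. by move=> mf mg; exact: measurable_fun_pair. Qed.

Lemma mpres_shearY a : mpres leb2 leb2 (shearY a).
Proof.
have mS : measurable_fun setT (shearY a).
  apply: measurable_pair => //; apply: measurable_funD => //.
  by apply: measurable_funM => //; exact: measurable_cst.
split=> // A mA; rewrite /Defs.leb2 /product_measure1 /=.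
apply: eq_integral => x _ /=.
have -> : xsection (shearY a @^-1` A) x = (fun y => y + a * x) @^-1` xsection A x.
  by apply/seteqP; split => y; rewrite /xsection /= !inE.
by have [_ ->//] := mpres_shift (a * x); exact: measurable_xsection.
Qed.

(** Allows sections in the other variable, as a horizontal shear requires. *)
Lemma leb2_sym (A : set (R * R)) : measurable A -> leb2 A = (leb1 \x^ leb1)%E A.
Proof.
move=> mA; apply: product_measure_unique => // B C mB mC.
exact: product_measure2E.
Qed.

Lemma mpres_shearX a : mpres leb2 leb2 (shearX a).
Proof.
have mS : measurable_fun setT (shearX a).
  apply: measurable_pair => //; apply: measurable_funD => //.
  by apply: measurable_funM => //; exact: measurable_cst.
split=> // A mA; rewrite -[LHS]/(leb2 _) -[RHS]/(leb2 _) !leb2_sym//; last first.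
  by rewrite -[X in measurable X]setTI; exact: mS.
rewrite /product_measure2 /=; apply: eq_integral => y _ /=.
have -> : ysection (shearX a @^-1` A) y = (fun x => x + a * y) @^-1` ysection A y.
  by apply/seteqP; split => x; rewrite /ysection /= !inE.
have [_ h] := mpres_shift (a * y).
by apply: h; exact: measurable_ysection.
Qed.

Definition rot (t : R) (z : R * R) : R * R :=
  (cos t * z.1 - sin t * z.2, sin t * z.1 + cos t * z.2).

(* A rotation is a product of three shears. *)
Lemma mpres_rot t : sin t != 0 -> mpres leb2 leb2 (rot t).
Proof.
move=> s0; pose a := - ((1 - cos t) / sin t).
have -> : rot t = shearX a \o (shearY (sin t) \o shearX a).
  apply/funext => -[x y]; rewrite /rot /shearX /shearY /a /=.
  have := cos2Dsin2 t; move: s0; move: (cos t) (sin t) => c s s0 cs.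
  have e : c ^+ 2 = 1 - s ^+ 2 by rewrite -cs addrK.
  congr pair; last by field.
  by have : (s * (c * x - s * y) = s * (x + - ((1 - c) / s) * y + - ((1 - c) / s) *
      (y + s * (x + - ((1 - c) / s) * y))));
    [field: e|move/(mulfI s0)].
apply: mpres_comp (mpres_shearX a).
exact: mpres_comp (mpres_shearX a) (mpres_shearY _).
Qed.

End Geometry.

(** * Integration of radial functions in the area variable *)

Section Polar.
Variable R : realType.
Local Notation leb1 := (@Defs.leb1 R).
Local Notation leb2 := (@Defs.leb2 R).
Local Notation mu := (@lebesgue_measure R).

(* The area of the disk through [z], so that [polar] pushes the Lebesgue measure
   of the plane to the Lebesgue measure of the half-line. *)
Definition polar (z : R * R) : R := pi * (z.1 ^+ 2 + z.2 ^+ 2).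

Lemma polar_ge0 z : 0 <= polar z.
Proof. by rewrite mulr_ge0 ?pi_ge0// addr_ge0 ?sqr_ge0. Qed.

Lemma measurable_polar : measurable_fun setT polar.
Proof.
apply: measurable_funM; first exact: measurable_cst.
by apply: measurable_funD; exact: measurable_funX.
Qed.

Definition polar_disk (s : R) : set (R * R) := [set z | polar z <= s].

Lemma measurable_polar_disk s : measurable (polar_disk s).
Proof.
rewrite (_ : polar_disk s = polar @^-1` `]-oo, s]%classic).
  by rewrite -[X in measurable X]setTI; exact: measurable_polar.
by apply/seteqP; split => z /=; rewrite in_itv.
Qed.

Let h (s x : R) : R := 2 * Num.sqrt (s / pi - x ^+ 2).

Let leb2_polar_disk_int s : leb2 (polar_disk s) = (\int[mu]_x (h s x)%:E)%E.
Proof.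
rewrite /Defs.leb2 /product_measure1 /=; apply: eq_integral => x _ /=.
have pi0 := @pi_gt0 R.
have [sx|sx] := leP 0 (s / pi - x ^+ 2).
  have -> : xsection (polar_disk s) x =
      `[- Num.sqrt (s / pi - x ^+ 2), Num.sqrt (s / pi - x ^+ 2)]%classic.
    apply/seteqP; split => y; rewrite /xsection /=.
      move=> /set_mem; rewrite /polar_disk /polar /= in_itv/= => hy.
      rewrite -ler_norml -sqrtr_sqr ler_wsqrtr//.
      by rewrite lerBrDl ler_pdivlMr// mulrC.
    rewrite in_itv/= -ler_norml -sqrtr_sqr ler_sqrt// lerBrDl ler_pdivlMr// mulrC => hy.
    exact/mem_set.
  rewrite -[LHS]/(mu _) lebesgue_measure_itv/= lte_fin.
  have := sqrtr_ge0 (s / pi - x ^+ 2); rewrite /h.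
  move: (Num.sqrt _) => a; rewrite le_eqVlt => /predU1P[<-|a0].
    by rewrite oppr0 ltxx mulr0.
  by rewrite gtrN// -EFinD; congr EFin; ring.
have -> : xsection (polar_disk s) x = set0.
  apply/seteqP; split => y //; rewrite /xsection /= inE /polar_disk /polar /= => hy.
  move: sx; rewrite ltNge => /negP; apply.
  rewrite subr_ge0 ler_pdivlMr// mulrC; apply: le_trans hy.
  by rewrite ler_pM2l// lerDl sqr_ge0.
by rewrite -[LHS]/(mu set0) measure0 /h ltr0_sqrtr// mulr0.
Qed.

Let continuous_h s : continuous (h s).
Proof.
move=> x; apply: cvgM; first exact: cvg_cst.
apply: continuous_cvg; first exact: sqrt_continuous.
by apply: cvgB; [exact: cvg_cst|exact: exprn_continuous].
Qed.

Let leb2_polar_disk_scale s : 0 <= s ->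
  leb2 (polar_disk s) = (s%:E * leb2 (polar_disk 1))%E.
Proof.
rewrite le_eqVlt => /predU1P[<-|s0].
  rewrite mul0e leb2_polar_disk_int integral0_eq// => x _.
  by rewrite /h ler0_sqrtr ?mulr0// mul0r sub0r oppr_le0 sqr_ge0.
pose q := Num.sqrt s; have q0 : 0 < q by rewrite sqrtr_gt0.
have qq : q ^+ 2 = s by rewrite sqr_sqrtr// ltW.
have dF (x : R) : is_derive x 1 (fun x => q * x) q.
  by apply: is_derive_eq; rewrite /GRing.scale /= mulr1.
have dFE : derive1 (fun x : R => q * x) = cst q.
  by apply/funext => x; rewrite derive1E; have [_ ->] := dF x.
rewrite !leb2_polar_disk_int.
rewrite (@increasing_ge0_integration_by_substitutionT _ (fun x => q * x) (h s)); first last.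
- by move=> x; rewrite /h mulr_ge0 ?sqrtr_ge0.
- exact: continuous_h.
- exact: gt0_cvgMry.
- exact: gt0_cvgMrNy.
- by move=> x; have [] := dF x.
- by rewrite dFE; exact: is_cvg_cst.
- by rewrite dFE; exact: is_cvg_cst.
- by rewrite dFE; exact: cst_continuous.
- by move=> x y xy; rewrite ltr_pM2l.
rewrite -ge0_integralZl//=; last 3 first.
- by apply/measurable_EFinP; apply: continuous_measurable_fun; exact: continuous_h.
- by move=> x _; rewrite lee_fin /h mulr_ge0 ?sqrtr_ge0.
- by rewrite lee_fin ltW.
apply: eq_integral => x _; rewrite dFE -EFinM; congr EFin.
rewrite -[LHS]/(h s (q * x) * q) /h exprMn qq mul1r (_ : s / pi - s * x ^+ 2 = s * (pi^-1 - x ^+ 2)); last by ring.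
by rewrite sqrtrM ?ltW// -/q -qq; ring.
Qed.

Let gauss_pi_int : (\int[mu]_x (expR (- pi * x ^+ 2))%:E = 1)%E.
Proof.
pose s : R := (Num.sqrt (2 * pi))^-1.
have p0 : 0 < Num.sqrt (2 * pi) :> R by rewrite sqrtr_gt0 mulr_gt0 ?pi_gt0.
have pp : Num.sqrt (2 * pi) ^+ 2 = 2 * pi :> R by rewrite sqr_sqrtr// mulr_ge0 ?pi_ge0.
have s0 : s != 0 by rewrite invr_neq0// gt_eqF.
rewrite -(@integral_normal_pdf R 0 s); apply: eq_integral => x _; congr EFin.
rewrite /normal_pdf (negbTE s0) /normal_peak /normal_fun subr0 /s exprVn pp.
have := lt0r_neq0 (pi_gt0 R); move: (pi : R) => a a0.
have -> : (2 * a)^-1 * a *+ 2 = 1 by rewrite [_ * a *+ 2]mulr2n; field.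
by rewrite sqrtr1 invr1 mul1r [_^-1 *+ 2]mulr2n; congr expR; field.
Qed.

Let gauss_polar_int : (\int[leb2]_z (expR (- polar z))%:E = 1)%E.
Proof.
have me : measurable_fun setT (fun z => (expR (- polar z))%:E).
  apply/measurable_EFinP; apply: measurableT_comp => //.
  by apply: measurableT_comp => //; exact: measurable_polar.
have e0 z : (0 <= (expR (- polar z))%:E)%E by rewrite lee_fin expR_ge0.
rewrite /Defs.leb2 fubini_tonelli1//.
rewrite -[RHS]gauss_pi_int; apply: eq_integral => x _; rewrite /fubini_F.
have -> : (fun y : R => (expR (- polar (x, y)))%:E) =
    (fun y => (expR (- pi * x ^+ 2))%:E * (expR (- pi * y ^+ 2))%:E)%E.
  by apply/funext => y; rewrite -EFinM -expRD /polar /=; congr (expR _)%:E; ring.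
rewrite ge0_integralZl//=; last first.
  apply/measurable_EFinP; apply: measurableT_comp => //.
  by apply: measurable_funM; [exact: measurable_cst|exact: measurable_funX].
by rewrite [X in (_ * X)%E](_ : _ = 1%E) ?mule1//; exact: gauss_pi_int.
Qed.

Lemma exp_integral0y : (\int[mu]_(t in `[0%R, +oo[) (expR (- t))%:E = 1)%E.
Proof.
have dF (t : R) : is_derive t 1 (fun t : R => - expR (- t)) (expR (- t)).
  by apply: is_derive_eq; rewrite /GRing.scale /=; ring.
have cF := derive_continuous dF.
rewrite (@ge0_continuous_FTC2y _ _ (fun t => - expR (- t)) 0 0).
- by rewrite oppr0 expR0 sub0e -EFinN opprK.
- by move=> x _; exact: expR_ge0.
- apply: continuous_subspaceT => x; apply: continuous_comp; last exact: continuous_expR.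
  exact: cvgN.
- rewrite -[X in _ --> X]oppr0; apply: cvgN.
  exact: cvgr_expR.
- by move=> x _; have [] := dF x.
- exact: cvg_at_right_filter (cF _).
- by move=> x _; rewrite derive1E; have [_ ->] := dF x.
Qed.

(** The measure of the disk where [polar] is at most 1. It is carried as an unknown finite positive
    constant until the integral of [exp (- polar)], evaluated over the plane and over the half-line,
    shows that it equals 1. *)
Let k1 := leb2 (polar_disk 1).

(** Markov's inequality: [exp (- polar)] has integral 1 and is at least [exp (- 1)] on the disk. *)
Let k1_fin : (k1 < +oo)%E.
Proof.
have e1 : (0 < expR (- 1 : R))%R by exact: expR_gt0.
have le1 : ((expR (- 1))%:E * k1 <= 1)%E.
  rewrite -gauss_polar_int -integral_cst; last exact: measurable_polar_disk.
  apply: (@le_trans _ _ (\int[leb2]_(z in polar_disk 1) (expR (- polar z))%:E)%E).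
    apply: ge0_le_integral => //.
    - exact: measurable_polar_disk.
    - by move=> z _; rewrite lee_fin expR_ge0.
    - apply/measurable_EFinP; apply: measurableT_comp => //.
      apply: measurableT_comp => //; apply: measurable_funTS; exact: measurable_polar.
    - by move=> z hz; rewrite lee_fin ler_expR lerN2.
  apply: ge0_subset_integral => //.
  - exact: measurable_polar_disk.
  - apply/measurable_EFinP; apply: measurableT_comp => //.
    by apply: measurableT_comp => //; exact: measurable_polar.
rewrite ltey; apply/eqP => k1y; move: le1; rewrite k1y.
by rewrite gt0_muley ?lte_fin.
Qed.

Let k1_gt0 : (0 < k1)%E.
Proof.
(* A square of side 1/4 at the origin lies in the disk because pi <= 4. *)
pose I := `[0, 2^-2 : R]%classic.
have mI : measurable I by exact: measurable_itv.
have h2 : (leb2 (I `*` I) <= k1)%E.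
  apply: le_measure; rewrite ?inE; [exact: measurableX|exact: measurable_polar_disk|].
  move=> [x y] [] /=; rewrite /I /= !in_itv /= => /andP[x0 x1] /andP[y0 y1].
  rewrite /polar_disk /polar /=.
  have xx : x ^+ 2 <= (2^-2) ^+ 2 by rewrite lerXn2r ?nnegrE//; lra.
  have yy : y ^+ 2 <= (2^-2) ^+ 2 by rewrite lerXn2r ?nnegrE//; lra.
  have p4 : pi <= 4 :> R.
    by have [/andP[_]] := @pihalf_02_cos_pihalf R; rewrite ler_pdivrMr// -natrM.
  have := @pi_ge0 R; move: xx yy p4; move: (x ^+ 2) (y ^+ 2) pi => a b c.
  rewrite -exprVn -!exprM; nra.
have p4 : (0 : R) < 2^-2 by rewrite invr_gt0 exprn_gt0.
have hI : leb1 I = (2^-2)%:E.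
  by rewrite -[LHS]/(mu _) lebesgue_measure_itv/= lte_fin p4 sube0.
apply: lt_le_trans h2; rewrite /Defs.leb2 product_measure1E//.
by rewrite [X in (0 < X * X)%E]hI -EFinM lte_fin mulr_gt0.
Qed.

Let k : R := fine k1.
Let kE : k1 = k%:E.
Proof. by rewrite fineK// ge0_fin_numE ?measure_ge0. Qed.
Let k_gt0 : 0 < k. Proof. by have := k1_gt0; rewrite kE lte_fin. Qed.

Let area s : 0 <= s -> leb2 (polar_disk s) = (s * k)%:E.
Proof. by move=> s0; rewrite leb2_polar_disk_scale// -/k1 kE EFinM. Qed.

Let measurable_polarT :
  measurable_fun [set: (measurableTypeR R * measurableTypeR R)%type]
    (polar : measurableTypeR R * measurableTypeR R -> measurableTypeR R).
Proof. exact: measurable_polar. Qed.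
Let pf : {measure set (measurableTypeR R) -> \bar R} :=
  measure_function_pushforward__canonical__measure_function_Measure leb2 measurable_polarT.

Let kinv_ge0 : 0 <= k^-1. Proof. by rewrite invr_ge0 ltW. Qed.
Let mneg : measurable (`]-oo, 0[%classic : set (measurableTypeR R)).
Proof. exact: measurable_itv. Qed.

(** The normalized pushforward lives on the half-line; Lebesgue measure on the negative reals is
    added so that uniqueness of Lebesgue measure on the whole line applies. *)
Let m : {measure set (measurableTypeR R) -> \bar R} :=
  measure_add (mscale (NngNum kinv_ge0) pf) (mrestr mu mneg).

Let pf_neg b : b < 0 -> pf `]-oo, b]%classic = 0%E.
Proof.
move=> b0; rewrite -[LHS]/(leb2 (polar @^-1` `]-oo, b]%classic)).
rewrite (_ : _ @^-1` _ = set0) ?measure0//.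
apply/seteqP; split => z //=; rewrite in_itv/= => h1.
by have := le_lt_trans h1 b0; rewrite ltNge polar_ge0.
Qed.

Let pf_disk b : pf `]-oo, b]%classic = leb2 (polar_disk b).
Proof. by congr (leb2 _). Qed.

Let pfE b : pf `]-oo, b]%classic = (Num.max b 0 * k)%:E.
Proof.
have [b0|b0] := ltP b 0; first by rewrite pf_neg// mul0r.
by rewrite pf_disk area.
Qed.

Let pf_oc a b : a <= b -> pf `]a, b]%classic = ((Num.max b 0 - Num.max a 0) * k)%:E.
Proof.
move=> ab.
have -> : `]a, b]%classic = `]-oo, b]%classic `\` `]-oo, a]%classic.
  by rewrite -[RHS]setCK setCD setCitvl setUC -[LHS]setCK setCitv.
rewrite measureD//=.
- rewrite setIidr; last exact: subset_itvl.
  by rewrite !pfE -EFinB -mulrBl.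
- by rewrite pfE ltry.
Qed.

Let mE A : m A = ((k^-1)%:E * pf A + mu (A `&` `]-oo, 0%R[%classic))%E.
Proof. exact: measure_addE. Qed.

Let leb_m A : measurable A -> mu A = m A.
Proof.
apply: lebesgue_measure_unique => _ [[a b]] _ <-; rewrite mE.
rewrite [X in mu X = _]/=.
have [ab|ba] := leP a b; last first.
  by rewrite set_itv_ge ?set0I ?measure0 ?mule0 ?adde0// bnd_simp -leNgt ltW.
rewrite pf_oc// -EFinM.
have -> : (k^-1 * ((Num.max b 0 - Num.max a 0) * k) = Num.max b 0 - Num.max a 0)%R.
  by rewrite mulrCA mulVf ?mulr1// gt_eqF.
rewrite !lebesgue_measure_itv/= !lte_fin.
have [b0|b0] := ltP b 0.
  have -> : `]a, b]%classic `&` `]-oo, 0[%classic = `]a, b]%classic.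
    apply/setIidl => x /=; rewrite !in_itv/= => /andP[_ xb].
    exact: le_lt_trans b0.
  rewrite lebesgue_measure_itv/= lte_fin.
  have [a0|a0] := ltP a 0; first by rewrite (subrr (0 : R)) add0e.
  by have := le_lt_trans (le_trans a0 ab) b0; rewrite ltxx.
have [a0|a0] := ltP a 0.
  have -> : `]a, b]%classic `&` `]-oo, 0[%classic = `]a, 0[%classic.
    apply/seteqP; split => x /=; rewrite !in_itv/=.
      by move=> [/andP[-> _] ->].
    by move=> /andP[-> x0]; split => //=; exact: le_trans (ltW x0) b0.
  rewrite lebesgue_measure_itv/= !lte_fin a0 (lt_le_trans a0 b0) -!EFinD.
  by congr EFin; ring.
have -> : `]a, b]%classic `&` `]-oo, 0[%classic = set0.
  apply/seteqP; split => x //=; rewrite !in_itv/= => -[/andP[ax _] x0].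
  by have := lt_trans (le_lt_trans a0 ax) x0; rewrite ltxx.
rewrite measure0 adde0; case: ltP => // ba.
by rewrite (@le_anti _ _ a b) ?ab// subrr.
Qed.

Lemma polar_integral_k (f : R -> \bar R) : measurable_fun setT f ->
  (forall t, (0 <= f t)%E) ->
  (\int[leb2]_z f (polar z) = k%:E * \int[mu]_(t in `[0%R, +oo[) f t)%E.
Proof.
move=> mf f0.
have mD : measurable (`[0%R, +oo[%classic : set (measurableTypeR R)) by exact: measurable_itv.
have -> : (\int[leb2]_z f (polar z) = \int[pf]_(t in `[0%R, +oo[) f t)%E.
  have -> : (\int[pf]_(t in `[0%R, +oo[) f t =
      \int[leb2]_(z in polar @^-1` `[0%R, +oo[) (f \o polar) z)%E.
    have f0' : {in (`[0%R, +oo[%classic : set (measurableTypeR R)), forall y, (0 <= f y)%E}.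
      by move=> y _; exact: f0.
    have mf1 : measurable_fun (`[0%R, +oo[%classic : set (measurableTypeR R)) f.
      exact: measurable_funTS.
    have E := (ge0_integral_pushforward measurable_polarT leb2 mD mf1 f0').
    by rewrite -E.
  congr (integral _ _ _); apply/seteqP; split => z //= _.
  by rewrite in_itv/= polar_ge0.
rewrite -[X in (X%:E * _)%E]/((NngNum (ltW k_gt0))%:num).
rewrite -ge0_integral_mscale//; last exact: measurable_funTS.
apply: eq_measure_integral => A mA AD.
rewrite -[RHS]/(k%:E * mu A)%E leb_m// mE.
have -> : A `&` `]-oo, 0[%classic = set0.
  apply/seteqP; split => t //= -[/AD /=]; rewrite !in_itv/= andbT => t0.
  by rewrite ltNge t0.
rewrite measure0 adde0 muleA -EFinM /= mulfV ?mul1e// gt_eqF//.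
Qed.

Let k_eq1 : k = 1.
Proof.
have := @polar_integral_k (fun t => (expR (- t))%:E).
rewrite gauss_polar_int exp_integral0y mule1 => hk.
apply: EFin_inj; rewrite -hk//.
by apply/measurable_EFinP; apply: measurableT_comp.
Qed.

Lemma polar_integral (f : R -> \bar R) : measurable_fun setT f ->
  (forall t, (0 <= f t)%E) ->
  (\int[leb2]_z f (polar z) = \int[mu]_(t in `[0%R, +oo[) f t)%E.
Proof. by move=> mf f0; rewrite polar_integral_k// k_eq1 mul1e. Qed.

Lemma leb2_polar_disk s : 0 <= s -> leb2 (polar_disk s) = s%:E.
Proof. by move=> s0; rewrite area// k_eq1 mulr1. Qed.

End Polar.

(** * Orthonormality in the phase plane *)

Section HermiteL2.
Variable R : realType.
Local Notation mu := (@lebesgue_measure R).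
Local Notation rt n := (Num.sqrt n%:R : R).
Local Notation sp := (Num.sqrt (pi : R)).
Implicit Types (z : R * R) (r j n : nat) (x : R).

Lemma cj1 : cj 1 = 1 :> R[i]. Proof. exact: (cj_rc 1). Qed.

Lemma exists_polar z : exists rho u,
  [/\ rho = Num.sqrt (polar z), csq u = 1 & wcoord z = rc rho * u].
Proof.
set rho := Num.sqrt (polar z).
have rho2 : rho ^+ 2 = csq (wcoord z) by rewrite csq_wcoord sqr_sqrtr ?polar_ge0.
have [r0|r0] := eqVneq rho 0; last first.
  exists rho, (rc rho^-1 * wcoord z); split => //.
    by rewrite csqM csq_rc -rho2 -exprMn mulVf// expr1n.
  by rewrite mulrA -rcM mulfV// mul1r.
exists rho, 1; split => //; first by rewrite (csq_rc 1) expr1n.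
rewrite r0 mul0r; move: rho2; rewrite r0 expr0n /= => /esym/eqP.
rewrite paddr_eq0 ?sqr_ge0// !sqrf_eq0 => /andP[/eqP a /eqP b].
exact: complexP.
Qed.

Lemma csq_hstft r j z : csq (hstft r j z) = dsp j r (Num.sqrt (polar z)) ^+ 2.
Proof.
have [rho [u [<- u1 wE]]] := exists_polar z.
rewrite (hstft_polar r j u1 wE) !csqM !csqX csq_cj u1 !expr1n !mulr1 csq_rc.
by rewrite /phase csq_cexpi mul1r.
Qed.

Lemma cmeas_gpoly p : cmeas setT (fun t : R => rc (gpoly p t)).
Proof. by apply: cmeas_rc; apply: continuous_measurable_fun; exact: continuous_gpoly. Qed.

Lemma L2_gpoly p : L2 mu (fun t : R => rc (gpoly p t)).
Proof.
apply/L2P; split; first exact: cmeas_gpoly.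
under [X in EFin \o X]eq_fun do rewrite csq_rc expr2.
have [C C0 h] := gpoly_bounded p.
exact: gpoly_bounded_integrable (@continuous_gpoly _ p) h.
Qed.

Lemma L2_hermite r : L2 mu (@hermite R r).
Proof. by rewrite hermiteE; exact: L2_gpoly. Qed.

Lemma csq_tfshift z (g : R -> R[i]) t : csq (tfshift z g t) = csq (g (t - z.1)).
Proof. by rewrite csqM csq_cexpi mul1r. Qed.

Lemma L2_tfshift z (g : R -> R[i]) : L2 mu g -> L2 mu (tfshift z g).
Proof.
move=> /L2P[[mr mi] gi].
have ms : measurable_fun [set: R] (fun t => t - z.1).
  by apply: measurable_funB => //; exact: measurable_cst.
apply/L2P; split.
  apply: cmeasM.
    have mt : measurable_fun [set: R] (fun t => 2 * pi * z.2 * t).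
      by apply: measurable_funM => //; exact: measurable_cst.
    split => /=; apply: measurableT_comp => //.
      by apply: continuous_measurable_fun; exact: continuous_cos.
    by apply: continuous_measurable_fun; exact: continuous_sin.
  split; first exact: (measurableT_comp mr ms).
  exact: (measurableT_comp mi ms).
under [X in EFin \o X]eq_fun do rewrite csq_tfshift.
have mg' : measurable_fun setT (EFin \o (fun t => csq (g t))).
  by apply/measurable_EFinP; apply: (@cmeas_csq _ _ _ setT g).
exact: ((mpres_integrable (mpres_shift (- z.1)) mg').2 gi).
Qed.

Lemma nsq_tfshift z (g : R -> R[i]) : L2 mu g -> nsq mu (tfshift z g) = nsq mu g.
Proof.
move=> Lg; have [[mr mi] gi] := (L2P mu g).1 Lg.
rewrite /nsq; under eq_Rintegral do rewrite csq_tfshift.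
have mg : measurable_fun setT (fun t => csq (g t)) by apply: cmeas_csq.
rewrite -[RHS](@mpres_Rintegral _ _ _ _ _ mu mu (fun t => t - z.1)) //.
  exact: mpres_shift.
have mg' : measurable_fun setT (EFin \o (fun t => csq (g t))) by apply/measurable_EFinP.
by rewrite preimage_setT; apply/(mpres_integrable (mpres_shift (- z.1)) mg').
Qed.

Lemma hstft_ip r j z : hstft r j z = ip mu (hermite j) (tfshift z (hermite r)).
Proof. by []. Qed.

(** The inner product is the transform at the origin, where the profiles are Kronecker deltas. *)
Lemma hermite_orthonormal j k : ip mu (@hermite R j) (hermite k) = (j == k)%:R.
Proof.
have -> : ip mu (@hermite R j) (hermite k) = hstft k j (0, 0).
  rewrite hstft_ip; apply: eq_ip => // t.
  by rewrite /tfshift /= mulr0 mul0r cexpi0 mul1r subr0.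
have w0 : @wcoord R (0, 0) = rc 0 * 1.
  by rewrite mul0r /wcoord /= !mulr0.
rewrite (hstft_polar k j _ w0) ?(csq_rc 1) ?expr1n// dsp_at0.
rewrite /phase /= mulr0 oppr0 cexpi0 cj1 ?expr1n !mul1r.
by case: eqP.
Qed.

Lemma nsq_hermite r : nsq mu (@hermite R r) = 1.
Proof. by apply: rc_inj; rewrite -ipff hermite_orthonormal eqxx. Qed.

(** Bessel's inequality for the unit vector [tfshift z (hermite r)], with z on the position axis at
    distance x / sqrt pi, signed, from the origin. *)
Lemma dsp_psum_le1 r n x : dsp_psum n r x <= 1.
Proof.
pose z : R * R := (x / sp, 0).
have sp0 : sp != 0 by rewrite gt_eqF// sqrtpi_gt0.
have wE : wcoord z = rc x * 1.
  by rewrite mulr1 /wcoord /= mulr0 mulrC divfK.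
have -> : dsp_psum n r x =
    \sum_(0 <= j < n | xpredT j) csq (ip mu (tfshift z (hermite r)) (hermite j)).
  rewrite big_mkord; apply: eq_bigr => j _.
  rewrite (ipC (L2_hermite j) (L2_tfshift z (L2_hermite r))) csq_cj -hstft_ip.
  rewrite (hstft_polar r j _ wE) ?(csq_rc 1) ?expr1n// cj1 ?expr1n !mulr1.
  by rewrite csqM csq_cexpi mul1r csq_rc.
apply: le_trans (bessel (P := xpredT) _ _ _ _) _.
- by move=> i _; exact: L2_hermite.
- by move=> i k _ _; exact: hermite_orthonormal.
- exact: L2_tfshift (L2_hermite r).
- exact: iota_uniq.
by rewrite (nsq_tfshift _ (L2_hermite r)) nsq_hermite.
Qed.

Lemma csq_hstft_le1 r j z : csq (hstft r j z) <= 1.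
Proof.
rewrite csq_hstft; apply: le_trans (dsp_psum_le1 r j.+1 (Num.sqrt (polar z))).
by rewrite /dsp_psum big_ord_recr /= lerDr sumr_ge0// => i _; exact: sqr_ge0.
Qed.

Lemma sum_csq_hstft_le1 r n z : \sum_(0 <= j < n) csq (hstft r j z) <= 1.
Proof.
rewrite big_mkord; under eq_bigr do rewrite csq_hstft.
exact: dsp_psum_le1.
Qed.

Lemma cvg_sum_csq_hstft r z :
  (fun n => \sum_(0 <= j < n) csq (hstft r j z)) @ \oo --> (1 : R).
Proof.
set x := Num.sqrt (polar z).
have c0 : (fun n : nat => (r%:R + 2 * x) / rt n) @ \oo --> (0 : R).
  rewrite -[X in _ --> X](mulr0 (r%:R + 2 * x)); apply: cvgM; first exact: cvg_cst.
  apply/gtr0_cvgV0; first by near=> n; rewrite sqrtr_gt0 ltr0n; near: n; exists 1%N.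
  apply/cvgryPge => A; near=> n.
  apply: le_trans (ler_norm A) _; rewrite -sqrtr_sqr ler_wsqrtr//.
  near: n; exists (Num.truncn (A ^+ 2)).+1 => // n /= hn.
  by apply: ltW; apply: lt_le_trans (truncnS_gt _) _; rewrite ler_nat.
have c1 : (fun n : nat => 1 - (r%:R + 2 * x) / rt n) @ \oo --> (1 : R).
  by rewrite -[X in _ --> X]subr0; apply: cvgB => //; exact: cvg_cst.
apply: (@squeeze_cvgr _ _ _ _ _ (cst 1) _ _ _ c1 (cvg_cst _)).
near=> n; rewrite sum_csq_hstft_le1 andbT.
have n0 : (0 < n)%N by near: n; exists 1%N.
have := dsp_psum_ge (dsp_psum_le1 r) n0 (sqrtr_ge0 (polar z)).
rewrite -/x lerBlDr => h; rewrite lerBlDr; apply: le_trans h _.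
rewrite addrC lerD2r big_mkord /dsp_psum.
by under [leRHS]eq_bigr do rewrite csq_hstft.
Unshelve. all: by end_near. Qed.

(** [parseval_ip] for two shifts of the window; its hypothesis is exactly the identity sum_j |F_j
    z|^2 = 1. *)
Lemma rkernel_expand r z z' :
  ccvg (fun n => \sum_(0 <= j < n) hstft r j z * cj (hstft r j z'))
       (rkernel (hermite r) z z').
Proof.
have L z0 := L2_tfshift z0 (L2_hermite r).
have h j z0 : hstft r j z0 = cj (ip mu (tfshift z0 (hermite r)) (hermite j)).
  by rewrite -(ipC (L z0) (L2_hermite j)).
have := @parseval_ip _ _ _ mu xpredT (@hermite R) (fun i _ => L2_hermite i)
  (fun i k _ _ => hermite_orthonormal i k) _ _ (L z') (L z).
rewrite /rkernel => H; under eq_fun do under eq_bigr do rewrite mulrC !h cjK.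
apply: H; rewrite (nsq_tfshift _ (L2_hermite r)) nsq_hermite.
have := cvg_sum_csq_hstft r z.
by under eq_fun do under eq_bigr do rewrite h csq_cj.
Qed.

End HermiteL2.

(** * Unit norm of the transforms in the plane *)

Section PlaneNorm.
Variable R : realType.
Local Notation leb2 := (@Defs.leb2 R).
Local Notation mu := (@lebesgue_measure R).
Local Notation rt n := (Num.sqrt n%:R : R).
Local Notation sp := (Num.sqrt (pi : R)).
Implicit Types (z : R * R) (r j n : nat) (x t : R).

Lemma dsp_le1 j r x : `|dsp j r x| <= 1.
Proof.
have : dsp j r x ^+ 2 <= 1.
  apply: le_trans (dsp_psum_le1 r j.+1 x).
  by rewrite /dsp_psum big_ord_recr /= lerDr sumr_ge0// => i _; exact: sqr_ge0.
by move=> h; rewrite -(expr_le1 (n := 2))// real_normK ?num_real.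
Qed.

Lemma dsp_decay j r x : `|x * dsp j r x| <= rt j + rt r.+1.
Proof.
rewrite dsp_lower; apply: le_trans (ler_normB _ _) _; apply: lerD.
  by rewrite normrM (ger0_norm (rt_ge0 _ _)) ler_piMr ?rt_ge0 ?dsp_le1.
by rewrite normrM (ger0_norm (rt_ge0 _ _)) ler_piMr ?rt_ge0 ?dsp_le1.
Qed.

Let sq j r t := dsp j r (Num.sqrt t) ^+ 2.

Let continuous_sq j r : continuous (sq j r).
Proof.
move=> t; apply: (@continuous_comp _ _ _ (fun t => dsp j r (Num.sqrt t)) (fun y => y ^+ 2)).
  apply: continuous_comp; first exact: sqrt_continuous.
  exact: continuous_dsp.
exact: exprn_continuous.
Qed.

Let measurable_sq j r : measurable_fun setT (EFin \o sq j r).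
Proof. by apply/measurable_EFinP; apply: continuous_measurable_fun; exact: continuous_sq. Qed.

(** On t > 0 an antiderivative of [sq j r - sq j.+1 r]. It vanishes at 0 and at infinity, so the
    integral of [sq j r] does not depend on j. *)
Let H j r t := (rt j.+1)^-1 *
  (Num.sqrt t * (dsp j r (Num.sqrt t) * dsp j.+1 r (Num.sqrt t))).

Let dH j r t : 0 < t -> is_derive t 1 (H j r) (sq j r t - sq j.+1 r t).
Proof.
move=> t0; set x := Num.sqrt t; have x0 : 0 < x by rewrite sqrtr_gt0.
have hs : is_derive t 1 Num.sqrt (2 * x)^-1 by exact: is_derive1_sqrt.
have h1 := @is_derive1_comp _ (dsp j r) Num.sqrt t _ _ (is_derive_dsp j r x) hs.
have h2 := @is_derive1_comp _ (dsp j.+1 r) Num.sqrt t _ _ (is_derive_dsp j.+1 r x) hs.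
rewrite /H; apply: is_derive_eq; rewrite /sq -/x.
have e1 := dsp_three j r x; have e2 := dsp_three j.+1 r x.
have a0 := rtS_neq0 R j; have x0' := lt0r_neq0 x0.
have hJ := @natr1 R j; move: e1 e2; rewrite [j.+1.-1]/=; clear h1 h2.
move: (dsp j.-1 r x) (dsp j r x) (dsp j.+1 r x) (dsp j.+2 r x) => A D E F.
move: (rt j) (rt j.+1) a0 (rt j.+2) => c a a0 b e1 e2; rewrite /GRing.scale /=.
apply: (mulfI (x := 2 * x * a)); first by rewrite !mulf_neq0// pnatr_eq0.
transitivity (x * (D * (a * D - b * F) + E * (c * A - a * E)) + D * E).
  by field; rewrite a0 x0'.
(* The recurrence at j times profile j + 1, and the recurrence at j + 1 times profile j: in the
   difference the coefficient x^2 - r drops out. *)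
have f1 : E * (x * (c * A + a * E)) = E * ((x ^+ 2 + j%:R - r%:R) * D) by rewrite e1.
have f2 : D * (x * (a * D + b * F)) = D * ((x ^+ 2 + j.+1%:R - r%:R) * E) by rewrite e2.
by move: f1 f2; rewrite -hJ !expr2 => f1 f2; lra.
Qed.

Let continuous_H j r : continuous (H j r).
Proof.
move=> t; apply: cvgM; first exact: cvg_cst.
apply: cvgM; first exact: sqrt_continuous.
have cd k : (fun t => dsp k r (Num.sqrt t)) @ t --> dsp k r (Num.sqrt t).
  by apply: continuous_comp; [exact: sqrt_continuous|exact: continuous_dsp].
exact: cvgM.
Qed.

Let H_at0 j r : H j r 0 = 0. Proof. by rewrite /H sqrtr0 mul0r mulr0. Qed.

(** By [dsp_decay] both profiles are O(1 / x), so x times their product is O(1 / x) with x = sqrt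
    n. *)
Let H_cvg j r : (fun n : nat => H j r n%:R) @ \oo --> (0 : R).
Proof.
pose C := (rt j.+1)^-1 * ((rt j + rt r.+1) * (rt j.+1 + rt r.+1)).
have hb n : `|H j r n%:R| <= C * (rt n)^-1.
  case: n => [|n]; first by rewrite H_at0 normr0 rt0 invr0 mulr0.
  have x0 := rtS_gt0 R n; rewrite /H /C; set x := rt n.+1.
  have -> : x * (dsp j r x * dsp j.+1 r x) = x * dsp j r x * (x * dsp j.+1 r x) * x^-1.
    by field; rewrite gt_eqF.
  rewrite normrM [`|_^-1|]ger0_norm ?invr_ge0 ?rt_ge0// -[leRHS]mulrA ler_wpM2l ?invr_ge0 ?rt_ge0//.
  rewrite normrM [`|x^-1|]ger0_norm ?invr_ge0 ?(ltW x0)// ler_wpM2r ?invr_ge0 ?(ltW x0)//.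
  by rewrite normrM ler_pM// dsp_decay.
have c0 : (fun n : nat => C * (rt n)^-1) @ \oo --> (0 : R).
  rewrite -[X in _ --> X](mulr0 C); apply: cvgM; first exact: cvg_cst.
  apply/gtr0_cvgV0; first by near=> n; rewrite sqrtr_gt0 ltr0n; near: n; exists 1%N.
  apply/cvgryPge => A; near=> n.
  apply: le_trans (ler_norm A) _; rewrite -sqrtr_sqr ler_wsqrtr//.
  near: n; exists (Num.truncn (A ^+ 2)).+1 => // n /= hn.
  by apply: ltW; apply: lt_le_trans (truncnS_gt _) _; rewrite ler_nat.
apply/cvgrPdist_le => e e0; move/cvgrPdist_le : c0 => /(_ _ e0).
apply: filterS => n; rewrite !sub0r !normrN; apply: le_trans.
exact: le_trans (hb n) (ler_norm _).
Unshelve. all: by end_near. Qed.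

Let I j r := (\int[mu]_(t in `[0%R, +oo[) (sq j r t)%:E)%E.
Let In j r (n : nat) := (\int[mu]_(t in `[0%R, n%:R]) (sq j r t)%:E)%E.

Let In_cvg j r : In j r n @[n --> \oo] --> I j r.
Proof.
apply: ge0_cvgn_integral; first by move=> t; exact: sqr_ge0.
by apply: continuous_measurable_fun; exact: continuous_sq.
Qed.

Let In_fin j r n : In j r n \is a fin_num.
Proof.
rewrite -integral_fin_num_abs//; last first.
  by apply: measurable_funTS; apply: continuous_measurable_fun; exact: continuous_sq.
apply: (@le_lt_trans _ _ (\int[mu]_(t in `[0%R, n%:R]) (cst 1%E t))%E).
  apply: ge0_le_integral => //.
  - by apply: measurable_funTS; apply: measurableT_comp => //; exact: measurable_sq.
  - move=> t _; rewrite lee_fin ger0_norm ?sqr_ge0// /sq -real_normK ?num_real//.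
    by rewrite exprn_ile1 ?dsp_le1.
rewrite integral_cst//= lebesgue_measure_itv/= mul1e.
by case: ifP => // _; rewrite sube0 ltry.
Qed.

Let In_diff j r n : (In j r n = In j.+1 r n + (H j r n%:R)%:E)%E.
Proof.
case: n => [|n].
  by rewrite H_at0 adde0 /In set_itv1 !integral_set1.
have hd : (\int[mu]_(t in `[0%R, n.+1%:R]) (sq j r t - sq j.+1 r t)%:E = (H j r n.+1%:R)%:E)%E.
  rewrite (@continuous_FTC2 _ _ (H j r)).
  - by rewrite H_at0 sube0.
  - by rewrite ltr0n.
  - by apply: continuous_subspaceT => t; apply: cvgB; exact: continuous_sq.
  - split.
    + by move=> t; rewrite in_itv/= => /andP[t0 _]; have [] := dH j r t0.
    + exact: cvg_at_right_filter (@continuous_H j r _).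
    + exact: cvg_at_left_filter (@continuous_H j r _).
  - move=> t; rewrite in_itv/= => /andP[t0 _].
    by rewrite derive1E; have [_ ->] := dH j r t0.
have i k : mu.-integrable `[0%R, n.+1%:R] (EFin \o sq k r).
  apply/integrableP; split; first by apply: measurable_funTS; exact: measurable_sq.
  rewrite integral_fin_num_abs//; first exact: In_fin.
  by apply: measurable_funTS; apply: continuous_measurable_fun; exact: continuous_sq.
by rewrite -hd integralB_EFin// addeC subeK//; exact: In_fin.
Qed.

Let I_step j r : I j.+1 r = I j r.
Proof.
have h : (In j.+1 r n + (H j r n%:R)%:E)%E @[n --> \oo] --> (I j.+1 r + 0)%E.
  apply: cvgeD; last 2 first.
  - exact: In_cvg.
  - by apply: cvg_EFin; [exact: nearW|exact: H_cvg].
  by rewrite fin_num_adde_defl.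
have e : (fun n : nat => In j.+1 r n + (H j r n%:R)%:E)%E = In j r.
  by apply/funext => n; rewrite [RHS]In_diff.
rewrite e adde0 in h.
exact: (cvg_unique (@ereal_hausdorff R) h (@In_cvg j r)).
Qed.

Let dsp_r0 r x : dsp r 0 x = x ^+ r / Num.sqrt (r`!)%:R * expR (- x ^+ 2 / 2).
Proof.
elim: r => [|r IH]; first by rewrite /dsp !expr0.
rewrite /= IH rt0 mul0r addr0 rt_fact (exprS x r).
have := rt_fact_neq0 R r; have := rtS_neq0 R r.
move: (rt r.+1) (Num.sqrt (r`!)%:R) (expR _) => a b e a0 b0.
by field; rewrite a0 b0.
Qed.

(** Lower j to 0, exchange the indices there ([dsp 0 r] and [dsp r 0] agree up to sign), and lower
    again: what remains is the integral of [exp (- t)]. *)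
Let I_eq1 j r : I j r = 1%E.
Proof.
have I0 r' : I 0 r' = I r' 0.
  congr (integral _ _ _); apply/funext => t; congr EFin.
  rewrite /sq dsp_r0 /dsp; move: (Num.sqrt t) => x.
  rewrite (exprMn 2 ((- x) ^+ r' / _)) (exprMn 2 ((- x) ^+ r')).
  rewrite (exprMn 2 (x ^+ r' / _)) (exprMn 2 (x ^+ r')).
  by congr (_ * _ * _); rewrite -!exprM mulnC !exprM sqrrN.
have -> : I j r = I 0 r by elim: j => // j <-; rewrite I_step.
rewrite I0; have -> : I r 0 = I 0 0 by elim: r => // k IH; rewrite I_step.
rewrite -(@exp_integral0y R); apply: eq_integral => t; rewrite inE/= in_itv/= andbT => t0.
congr EFin; rewrite /sq /dsp expr0 fact0 sqrtr1 divr1 mul1r sqr_sqrtr//.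
by rewrite -expRM_natl; congr expR; field.
Qed.

Lemma integral_csq_hstft r j : (\int[leb2]_z (csq (hstft r j z))%:E = 1)%E.
Proof.
under eq_integral do rewrite csq_hstft.
rewrite -(I_eq1 j r) (polar_integral (f := EFin \o sq j r))//.
by move=> t; rewrite lee_fin sqr_ge0.
Qed.

End PlaneNorm.

(** * Orthogonality on rotation-invariant sets *)

Section PlaneOrthogonality.
Variable R : realType.
Local Notation leb2 := (@Defs.leb2 R).
Local Notation rt n := (Num.sqrt n%:R : R).
Local Notation sp := (Num.sqrt (pi : R)).
Implicit Types (z : R * R) (r j k n : nat).

Lemma cmeas_wcoord : cmeas setT (@wcoord R).
Proof.
by split => /=; apply: measurable_funM => //; exact: measurable_cst.
Qed.

Lemma cmeas_hstft00 : cmeas setT (@hstft R 0 0).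
Proof.
have -> : @hstft R 0 0 = fun z => phase z * rc (expR (- polar z / 2)).
  apply/funext => z; have [rho [u [rE u1 wE]]] := exists_polar z.
  rewrite (hstft_polar 0 0 u1 wE) !expr0 !mulr1; congr (_ * rc _).
  by rewrite /dsp expr0 fact0 sqrtr1 divr1 mul1r rE sqr_sqrtr ?polar_ge0.
apply: cmeasM; last first.
  apply: cmeas_rc; apply: measurableT_comp => //.
  apply: measurable_funM; last exact: measurable_cst.
  by apply: measurableT_comp => //; exact: measurable_polar.
have ma : measurable_fun setT (fun z : R * R => - (pi * z.1 * z.2)).
  apply: measurableT_comp => //; apply: measurable_funM => //.
  by apply: measurable_funM => //; exact: measurable_cst.
split; apply: measurableT_comp ma; apply: continuous_measurable_fun.
  exact: continuous_cos.
exact: continuous_sin.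
Qed.

Lemma cmeas_hstft r j : cmeas setT (@hstft R r j).
Proof.
elim: j r => [|j IH] r.
  elim: r => [|r IH]; first exact: cmeas_hstft00.
  rewrite (_ : hstft r.+1 0 = fun z => - rc (rt r.+1)^-1 * (wcoord z * hstft r 0 z)).
    apply: cmeasM; first exact: cmeas_cst.
    by apply: cmeasM => //; exact: cmeas_wcoord.
  by apply/funext => z; rewrite hstftS0.
rewrite (_ : hstft r j.+1 = fun z => rc (rt j.+1)^-1 *
    (cj (wcoord z) * hstft r j z + rc (rt r) * hstft r.-1 j z)).
  apply: cmeasM; first exact: cmeas_cst.
  apply: cmeasD; first by apply: cmeasM => //; apply: cmeas_cj; exact: cmeas_wcoord.
  by apply: cmeasM => //; exact: cmeas_cst.
by apply/funext => z; rewrite hstftSr.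
Qed.

Lemma L2_hstft r j : L2 leb2 (@hstft R r j).
Proof.
apply/L2P; split; first exact: cmeas_hstft.
apply/integrableP; split.
  by apply/measurable_EFinP; apply: cmeas_csq; exact: cmeas_hstft.
rewrite (_ : (\int[leb2]_z _)%E = (\int[leb2]_z (csq (hstft r j z))%:E)%E).
  by rewrite integral_csq_hstft ltry.
by apply: eq_integral => z _ /=; rewrite ger0_norm ?csq_ge0.
Qed.

Lemma nsq_hstft r j : nsq leb2 (@hstft R r j) = 1.
Proof. by rewrite /nsq /Rintegral integral_csq_hstft. Qed.

Lemma wcoord_rot t z : wcoord (rot t z) = cexpi t * wcoord z.
Proof. by apply: complexP; rewrite !cE /=; ring. Qed.

Lemma hstft_prod_rot r j k t z :
  hstft r j (rot t z) * cj (hstft r k (rot t z)) =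
  cj (cexpi t) ^+ j * cexpi t ^+ k * (hstft r j z * cj (hstft r k z)).
Proof.
have [rho [u [_ u1 wE]]] := exists_polar z.
have v1 : csq (cexpi t * u) = 1 by rewrite csqM csq_cexpi u1 mulr1.
have wE' : wcoord (rot t z) = rc rho * (cexpi t * u).
  by rewrite wcoord_rot wE; ring.
rewrite (hstft_polar r j v1 wE') (hstft_polar r k v1 wE').
rewrite (hstft_polar r j u1 wE) (hstft_polar r k u1 wE).
rewrite !(cjM, cjX, cjK, cj_rc) !exprMn.
have p1 z0 : phase z0 * cj (phase z0) = 1 by apply: unit_cj; rewrite csq_cexpi.
have ur : cexpi t ^+ r * cj (cexpi t) ^+ r = 1.
  by rewrite -exprMn unit_cj ?csq_cexpi// expr1n.
transitivity ((phase (rot t z) * cj (phase (rot t z))) *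
   (cexpi t ^+ r * cj (cexpi t) ^+ r) * (cj (cexpi t) ^+ j * cexpi t ^+ k) *
   (u ^+ r * cj u ^+ j * rc (dsp j r rho) * (cj u ^+ r * u ^+ k * rc (dsp k r rho)))).
  by ring.
rewrite p1 ur !mul1r -[X in _ * X]mul1r -(p1 z).
by ring.
Qed.

Definition rot_invariant (D : set (R * R)) := forall t, rot t @^-1` D = D.

Lemma polar_rot t z : polar (rot t z) = polar z.
Proof.
have h := cos2Dsin2 t; rewrite /polar /rot /=; congr (_ * _).
transitivity ((cos t ^+ 2 + sin t ^+ 2) * (z.1 ^+ 2 + z.2 ^+ 2)); first by ring.
by rewrite h mul1r.
Qed.

Lemma rot_invariant_disk s : rot_invariant (polar_disk s).
Proof. by move=> t; apply/seteqP; split => z; rewrite /polar_disk /= polar_rot. Qed.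

Lemma cintegrable_hstft r j k D : measurable D ->
  cintegrable leb2 D (fun z => hstft r j z * cj (hstft r k z)).
Proof.
move=> mD; have [h1 h2] := L2_integrable (L2_hstft r j) (L2_hstft r k).
by split; [exact: integrableS h1|exact: integrableS h2].
Qed.

(** A rotation by t preserves the integral over D and multiplies the integrand by exp (i (k - j) t).
    The angle is chosen to make this factor equal to i, so the integral equals i times itself; its
    sine is positive, as [mpres_rot] requires. *)
Lemma cint_hstft_lt r j k D : measurable D -> rot_invariant D -> (j < k)%N ->
  cint leb2 D (fun z => hstft r j z * cj (hstft r k z)) = 0.
Proof.
move=> mD rD jk; set G := fun z => _.
pose m := (k - j)%N; have m0 : (0 < m)%N by rewrite subn_gt0.
pose t : R := pi / 2 / m%:R.
have mt : t *+ m = pi / 2.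
  by rewrite -[LHS]mulr_natr divfK// pnatr_eq0 -lt0n.
have m1 : (1 : R) <= m%:R by rewrite ler1n.
have st : sin t != 0.
  rewrite gt_eqF// sin_gt0_pi// divr_gt0 ?divr_gt0 ?pi_gt0 ?ltr0n//=.
  rewrite ltr_pdivrMr ?ltr0n//; apply: (@lt_le_trans _ _ pi).
    by rewrite ltr_pdivrMr// ltr_pMr ?pi_gt0// ltr1n.
  by rewrite ler_peMr// pi_ge0.
have rm := mpres_rot st.
have e : cj (cexpi t) ^+ j * cexpi t ^+ k = Complex 0 1.
  rewrite -(subnKC (ltnW jk)) exprD mulrA -exprMn mulrC -[cj _ * _]mulrC.
  rewrite unit_cj ?csq_cexpi// expr1n mulr1 cexpiX mt.
  by rewrite /cexpi cos_pihalf sin_pihalf.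
have iG : cintegrable leb2 D G by exact: cintegrable_hstft.
have GE : G \o rot t = fun z => Complex 0 1 * G z.
  by apply/funext => z /=; rewrite /G hstft_prod_rot e.
have mG : cmeas setT G.
  by apply: cmeasM; [|apply: cmeas_cj]; exact: cmeas_hstft.
have key : cint leb2 D G = Complex 0 1 * cint leb2 D G.
  rewrite -cintZ// -GE -{2}(rD t).
  rewrite (mpres_cint rm mD mG)// rD GE.
  exact: cintegrableZ.
apply/eqP; have : (1 - Complex 0 1) * cint leb2 D G = 0.
  by rewrite mulrBl mul1r -key subrr.
move/eqP; rewrite mulf_eq0 => /orP[|//].
by move=> /eqP/(congr1 (@Re R)); rewrite !cE /= oppr0 addr0 => /eqP; rewrite oner_eq0.
Qed.

Definition disk_weight r D j : R := Rintegral leb2 D (fun z => csq (hstft r j z)).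

Lemma cint_hstft r j k D : measurable D -> rot_invariant D ->
  cint leb2 D (fun z => hstft r j z * cj (hstft r k z)) =
  if j == k then rc (disk_weight r D j) else 0.
Proof.
move=> mD rD; case: ltngtP => [jk|kj|->].
- exact: cint_hstft_lt.
- rewrite -[LHS]cjK -cint_cj//; last exact: cintegrable_hstft.
  rewrite (@eq_cint _ _ _ leb2 D _ (fun z => hstft r k z * cj (hstft r j z))).
    by rewrite cint_hstft_lt// (cj_rc 0).
  by move=> z _; rewrite cjM cjK mulrC.
- rewrite -cint_rc; apply: eq_cint => z _; exact: mul_cj.
Qed.

Lemma hstft_orthonormal r j k : ip leb2 (@hstft R r j) (hstft r k) = (j == k)%:R.
Proof.
have rT : rot_invariant [set: R * R] by move=> t; rewrite preimage_setT.
rewrite /ip (cint_hstft r j k measurableT rT).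
by case: eqP => // _; congr Complex; exact: (nsq_hstft r j).
Qed.

End PlaneOrthogonality.

(** * The localization operator of a disk *)

Section Localization.
Variables (R : realType) (r : nat) (s : R).
Hypothesis s0 : 0 <= s.
Local Notation leb2 := (@Defs.leb2 R).
Local Notation D := (polar_disk s).
Local Notation F := (@hstft R r).
Local Notation w := (@disk_weight R r D).
Implicit Types (z : R * R) (j k n : nat) (f : R * R -> R[i]).

Let mD : measurable D. Proof. exact: measurable_polar_disk. Qed.
Let rD : rot_invariant D. Proof. exact: rot_invariant_disk. Qed.

Let icsq j : leb2.-integrable setT (EFin \o (fun z => csq (F j z))).
Proof. by have /L2P[_] := L2_hstft R r j. Qed.

Lemma disk_weight_ge0 j : 0 <= w j.
Proof. by apply: Rintegral_ge0 => z _; exact: csq_ge0. Qed.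

Lemma disk_weight_compl j :
  Rintegral leb2 (~` D) (fun z => csq (F j z)) = 1 - w j.
Proof.
have mDc : measurable (~` D) by exact: measurableC.
rewrite -(nsq_hstft R r j) /nsq /disk_weight -(setUv D) Rintegral_setU//.
- by rewrite addrAC subrr add0r.
- by rewrite setUv.
- by apply/disj_setPS => z [].
Qed.

Lemma disk_weight_le1 j : w j <= 1.
Proof.
by rewrite -subr_ge0 -disk_weight_compl; apply: Rintegral_ge0 => z _; exact: csq_ge0.
Qed.

Let iD1 : leb2.-integrable D (EFin \o cst (1 : R)).
Proof.
apply/integrableP; split; first exact/measurable_EFinP.
rewrite (_ : (\int[leb2]_(z in D) _)%E = (\int[leb2]_(z in D) (cst 1%E z))%E); last first.
  by apply: eq_integral => z _ /=; rewrite normr1.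
by rewrite integral_cst// mul1e [X in (X < _)%E](leb2_polar_disk s0) ltry.
Qed.

Lemma sum_disk_weight n :
  \sum_(0 <= j < n) w j = Rintegral leb2 D (fun z => \sum_(0 <= j < n) csq (F j z)).
Proof.
elim: n => [|n IH].
  rewrite big_nil (_ : (fun z => _) = cst 0) ?Rintegral_cst ?mul0r//.
  by apply/funext => z; rewrite big_nil.
rewrite big_nat_recr//= IH -RintegralD//.
- by apply: eq_Rintegral => z _; rewrite big_nat_recr.
- apply: (integrableS measurableT) => //.
  elim: n {IH} => [|n IH].
    rewrite (_ : EFin \o _ = cst 0%E); first exact: integrable0.
    by apply/funext => z /=; rewrite big_nil.
  under [X in EFin \o X]eq_fun do rewrite big_nat_recr//=.
  exact: integrableD_EFin.
- exact: integrableS (icsq n).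
Qed.

(** The trace of the localization operator is the area of the disk: the partial sums of |F_j|^2 are
    bounded by 1 and tend to 1. *)
Lemma cvg_sum_disk_weight : (fun n => \sum_(0 <= j < n) w j) @ \oo --> s.
Proof.
under eq_fun do rewrite sum_disk_weight.
have sE : Rintegral leb2 D (cst (1 : R)) = s.
  by rewrite Rintegral_cst// mul1r [X in fine X](leb2_polar_disk s0).
have mS n : measurable_fun D (fun z => \sum_(0 <= j < n) csq (F j z)).
  apply: measurable_funTS; elim: n => [|n IH].
    by under eq_fun do rewrite big_nil; exact: measurable_cst.
  under eq_fun do rewrite big_nat_recr//=.
  by apply: measurable_funD => //; apply: cmeas_csq; exact: cmeas_hstft.
have h := @Rintegral_dom_cvg _ _ _ leb2 D (fun n z => \sum_(0 <= j < n) csq (F j z)) (cst 1) (cst 1) mD.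
rewrite sE in h; apply: h => //.
- by move=> z _; exact: cvg_sum_csq_hstft.
- move=> n z _; rewrite ger0_norm ?sum_csq_hstft_le1//.
  by apply: sumr_ge0 => j _; exact: csq_ge0.
Qed.

Let K n z z' : R[i] := \sum_(0 <= j < n) F j z * cj (F j z').

Let K_le1 n z z' : cabs (K n z z') <= 1.
Proof.
apply: le_trans (cabs_sum _ _ _) _.
apply: (@le_trans _ _ (\sum_(0 <= j < n) (csq (F j z) + csq (F j z')) / 2)).
  apply: ler_sum => j _; rewrite cabsM cabs_cj -!cabsE.
  by have := sqr_ge0 (cabs (F j z) - cabs (F j z')); rewrite !expr2; lra.
rewrite -mulr_suml big_split /= ler_pdivrMr// mul1r.
by apply: lerD; exact: sum_csq_hstft_le1.
Qed.

Let cmeas_Kr n z : cmeas setT (K n z).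
Proof.
apply: cmeas_sum => j _; apply: cmeasM; first exact: cmeas_cst.
by apply: cmeas_cj; exact: cmeas_hstft.
Qed.
Let cmeas_Kl n z' : cmeas setT (fun z => K n z z').
Proof.
apply: cmeas_sum => j _; apply: cmeasM; first exact: cmeas_hstft.
exact: cmeas_cst.
Qed.

(** Both reproducing kernels are truncated at n. The truncations are bounded by 1, so dominated
    convergence applies on the disk, and orthogonality on the disk leaves only the diagonal of the
    double sum. *)
Lemma Mkernel_expand z z' :
  ccvg (fun n => \sum_(0 <= j < n) rc (w j) * F j z * cj (F j z'))
       (Mkernel (hermite r) D z z').
Proof.
have cmeasD' f : cmeas setT f -> cmeas D f.
  by move=> [? ?]; split; exact: measurable_funTS.
have h : ccvg (fun n => cint leb2 D (fun y => K n z y * K n y z'))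
    (Mkernel (hermite r) D z z').
  have h := @cint_dom_cvg _ _ _ leb2 D (fun n y => K n z y * K n y z')
    (fun y => rkernel (hermite r) z y * rkernel (hermite r) y z') (cst 1) mD.
  apply: h => //.
  - by move=> n; apply: cmeasD'; apply: cmeasM.
  - by move=> y _; apply: ccvgM; exact: rkernel_expand.
  - by move=> n y _; rewrite cabsM mulr_ile1 ?cabs_ge0.
suff e n : cint leb2 D (fun y => K n z y * K n y z') =
    \sum_(0 <= j < n) rc (w j) * F j z * cj (F j z').
  by under eq_fun do rewrite -e.
pose G j k y := F j z * cj (F k z') * (F k y * cj (F j y)).
have iG j k : cintegrable leb2 D (G j k).
  by apply: cintegrableZ => //; exact: cintegrable_hstft.
have -> : cint leb2 D (fun y => K n z y * K n y z') =
    cint leb2 D (fun y => \sum_(0 <= j < n) \sum_(0 <= k < n) G j k y).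
  apply: eq_cint => y _; rewrite /K mulr_suml; apply: eq_bigr => j _.
  by rewrite mulr_sumr; apply: eq_bigr => k _; rewrite /G; ring.
rewrite cint_sum//; last by move=> j; exact: cintegrable_sum.
rewrite big_seq [RHS]big_seq; apply: eq_bigr => j jn.
rewrite cint_sum// (bigD1_seq j) ?iota_uniq//= big1 => [|k kj].
  rewrite addr0 cintZ//; last exact: cintegrable_hstft.
  by rewrite cint_hstft// eqxx; ring.
rewrite cintZ//; last exact: cintegrable_hstft.
by rewrite cint_hstft// (negbTE kj) mulr0.
Qed.

Let tail n := s - \sum_(0 <= j < n) w j.

Lemma sum_disk_weight_le n : \sum_(0 <= j < n) w j <= s.
Proof.
have nd : nondecreasing_seq (fun n => \sum_(0 <= j < n) w j).
  apply/nondecreasing_seqP => k; rewrite big_nat_recr//= lerDl.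
  exact: disk_weight_ge0.
have h := nondecreasing_cvgn_le nd (cvgP _ cvg_sum_disk_weight) n.
by rewrite (cvg_lim (@Rhausdorff R) cvg_sum_disk_weight) in h.
Qed.

Let tail_ge n m : (n <= m)%N -> \sum_(n <= j < m) w j <= tail n.
Proof.
move=> nm; rewrite lerBrDl -big_cat_nat//.
exact: sum_disk_weight_le.
Qed.

Lemma cvg_tail : tail n @[n --> \oo] --> (0 : R).
Proof.
rewrite -[X in _ --> X](subrr s); apply: cvgB; first exact: cvg_cst.
exact: cvg_sum_disk_weight.
Qed.

Let LF j : xpredT j -> L2 leb2 (F j). Proof. by move=> _; exact: L2_hstft. Qed.
Let oF j k : xpredT j -> xpredT k -> ip leb2 (F j) (F k) = (j == k)%:R.
Proof. by move=> _ _; exact: hstft_orthonormal. Qed.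

Local Notation lc := (lincomb xpredT F).

(** The tail of the convergent trace series is a common rate for all expansions whose squared
    coefficients are dominated by w. *)
Let tail_lincomb c (C : R) n m : 0 <= C -> (forall j, csq (c j) <= C * w j) ->
  (n <= m)%N ->
  nsq leb2 (fun z => lc (index_iota 0 m) c z - lc (index_iota 0 n) c z) <= C * tail n.
Proof.
move=> C0 cC nm.
have -> : (fun z => lc (index_iota 0 m) c z - lc (index_iota 0 n) c z) =
    lc (index_iota n m) c.
  apply/funext => z; rewrite /lincomb.
  by rewrite (big_cat_nat (leq0n n) nm) /= addrAC subrr add0r.
rewrite (nsq_lincomb LF oF) ?iota_uniq//.
apply: le_trans (ler_wpM2l C0 (tail_ge nm)); rewrite mulr_sumr.
by apply: ler_sum.
Qed.

(* This lets the summable [w j] dominate the squared coefficients. *)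
Let wsq_le j : w j ^+ 2 <= w j.
Proof. by rewrite expr2 ler_piMl ?disk_weight_ge0 ?disk_weight_le1. Qed.

(** For fixed z the value is the inner product of f with the conjugated kernel row v. [L2_fatou]
    makes v square integrable with a rate, and Cauchy-Schwarz turns that rate into convergence of
    the series. *)
Lemma intop_pointwise f z : L2 leb2 f ->
  ccvg (fun n => lc (index_iota 0 n) (fun j => rc (w j) * ip leb2 f (F j)) z)
       (intop (Mkernel (hermite r) D) f z).
Proof.
move=> Lf; pose c j := rc (w j) * cj (F j z).
pose v y := cj (Mkernel (hermite r) D z y).
have vc y : ccvg (fun n => lc (index_iota 0 n) c y) (v y).
  have := ccvg_cj (Mkernel_expand z y).
  rewrite (_ : (fun n => cj _) = fun n => lc (index_iota 0 n) c y)//.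
  apply/funext => n; rewrite cj_sum; apply: eq_bigr => j _.
  by rewrite /c !cjM cjK cj_rc.
have cw j : csq (c j) <= 1 * w j.
  rewrite mul1r csqM csq_rc csq_cj; apply: le_trans (wsq_le j).
  by rewrite ler_piMr ?sqr_ge0 ?csq_hstft_le1.
have [Lv hv] := L2_fatou (fun n => L2_lincomb LF (index_iota 0 n) c) vc
  (fun n m => tail_lincomb ler01 cw).
have -> : intop (Mkernel (hermite r) D) f z = ip leb2 f v.
  rewrite /intop -[LHS]/(cint leb2 setT _); apply: eq_cint => y _.
  by rewrite cjK mulrC.
apply: ccvgP.
have h0 : (fun n => Num.sqrt (nsq leb2 f * (1 * tail n))) @ \oo --> (0 : R).
  rewrite [X in _ --> X](_ : _ = Num.sqrt (nsq leb2 f * (1 * 0))).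
    apply: continuous_cvg; first exact: sqrt_continuous.
    apply: cvgM; first exact: cvg_cst.
    by apply: cvgM; [exact: cvg_cst|exact: cvg_tail].
  by rewrite !mulr0 sqrtr0.
apply: (@squeeze_cvgr _ _ _ _ (cst 0) _ _ _ _ (cvg_cst _) h0).
apply: nearW => n; rewrite cabs_ge0 /= -cabsN opprB.
have -> : ip leb2 f v - lc (index_iota 0 n) (fun j => rc (w j) * ip leb2 f (F j)) z =
    ip leb2 f (fun y => v y - lc (index_iota 0 n) c y).
  rewrite ipBr//; last exact: (L2_lincomb LF).
  rewrite (ip_lincombr LF)//; congr (_ - _); apply: eq_bigr => j _.
  by rewrite /c cjM cjK cj_rc; ring.
rewrite -[leLHS]ger0_norm ?cabs_ge0// -sqrtr_sqr ler_wsqrtr// cabsE.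
apply: le_trans (cauchy_schwarz Lf _) _.
  by apply: L2B => //; exact: (L2_lincomb LF).
apply: ler_wpM2l; first exact: nsq_ge0.
exact: hv.
Qed.

(** The squared coefficients are dominated by [nsq f * w j], so [L2_fatou] lifts the pointwise
    expansion to L2. *)
Lemma intop_L2 f : L2 leb2 f ->
  L2 leb2 (intop (Mkernel (hermite r) D) f) /\
  (fun n => nsq leb2 (fun z => intop (Mkernel (hermite r) D) f z -
     lc (index_iota 0 n) (fun j => rc (w j) * ip leb2 f (F j)) z)) @ \oo --> (0 : R).
Proof.
move=> Lf; pose c j := rc (w j) * ip leb2 f (F j).
have cw j : csq (c j) <= nsq leb2 f * w j.
  rewrite csqM csq_rc mulrC; apply: ler_pM; rewrite ?csq_ge0 ?sqr_ge0 ?wsq_le//.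
  by have := cauchy_schwarz Lf (L2_hstft R r j); rewrite nsq_hstft mulr1.
have [L h] := L2_fatou (fun n => L2_lincomb LF (index_iota 0 n) c)
  (fun z => intop_pointwise z Lf) (fun n m => tail_lincomb (nsq_ge0 _ _) cw).
split => //.
have h0 : (fun n => nsq leb2 f * tail n) @ \oo --> (0 : R).
  rewrite -[X in _ --> X](mulr0 (nsq leb2 f)).
  by apply: cvgM; [exact: cvg_cst|exact: cvg_tail].
apply: (@squeeze_cvgr _ _ _ _ (cst 0) _ _ _ _ (cvg_cst _) h0).
by apply: nearW => n; rewrite nsq_ge0 h.
Qed.

End Localization.

(** * Two diagonalizations of one operator *)

Section RealSequences.
Variable R : realType.
Implicit Types (u : nat -> R).

Lemma cvg_le_cst u (l C : R) : u @ \oo --> l -> (forall n, u n <= C) -> l <= C.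
Proof.
move=> ul uC; rewrite -(cvg_lim (@Rhausdorff R) ul).
by apply: limr_le; [exact: cvgP ul|exact: nearW].
Qed.

Lemma cvg_ge_cst u (l C : R) : u @ \oo --> l -> (forall n, C <= u n) -> C <= l.
Proof.
move=> ul uC; rewrite -(cvg_lim (@Rhausdorff R) ul).
by apply: limr_ge; [exact: cvgP ul|exact: nearW].
Qed.

Lemma cvg_sumr (I : Type) (s : seq I) (P : pred I) (u : I -> nat -> R) (l : I -> R) :
  (forall i, P i -> u i @ \oo --> l i) ->
  (fun n => \sum_(i <- s | P i) u i n) @ \oo --> \sum_(i <- s | P i) l i.
Proof.
move=> ul; elim: s => [|i s IH].
  by under eq_fun do rewrite big_nil; rewrite big_nil; exact: cvg_cst.
under eq_fun do rewrite big_cons; rewrite big_cons; case: ifP => // Pi.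
by apply: cvgD => //; exact: ul.
Qed.

Lemma cvg_eventually_cst u (l : R) m : (forall n, (m <= n)%N -> u n = l) -> u @ \oo --> l.
Proof. by move=> ul; apply: cvg_near_cst; exists m. Qed.

End RealSequences.

Section SpectralExpansion.
Context d (T : measurableType d) (R : realType).
Variable mu : {measure set T -> \bar R}.
Local Notation L2 := (L2 mu).
Local Notation ip := (ip mu).
Local Notation nsq := (nsq mu).

(** The last clause of [spectral_decomposition] in abstract form, covering the p_k of the hypothesis
    and the F_j alike. *)
Definition spectral_expansion (A : (T -> R[i]) -> T -> R[i]) (P : pred nat)
    (lam : nat -> R) (e : nat -> T -> R[i]) := forall f, L2 f ->
  (fun n => nsq (fun x => A f x -
     lincomb P e (index_iota 0 n) (fun k => rc (lam k) * ip f (e k)) x)) @ \oo --> (0 : R).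

Variable A : (T -> R[i]) -> T -> R[i].
Hypothesis LA : forall f, L2 f -> L2 (A f).
Variables (P : pred nat) (lam : nat -> R) (e : nat -> T -> R[i]).
Hypothesis Le : forall i, P i -> L2 (e i).
Hypothesis eo : forall i j, P i -> P j -> ip (e i) (e j) = (i == j)%:R.
Hypothesis Ae : spectral_expansion A P lam e.

Lemma spectral_form f g : L2 f -> L2 g ->
  ccvg (fun n => \sum_(0 <= k < n | P k) rc (lam k) * (ip f (e k) * ip (e k) g))
       (ip (A f) g).
Proof.
move=> Lf Lg; apply: ccvgP; pose c k := rc (lam k) * ip f (e k).
have h : (fun n => Num.sqrt (nsq (fun x => A f x -
    lincomb P e (index_iota 0 n) c x) * nsq g)) @ \oo --> (0 : R).
  rewrite [X in _ --> X](_ : _ = Num.sqrt (0 * nsq g)); last by rewrite mul0r sqrtr0.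
  apply: continuous_cvg; first exact: sqrt_continuous.
  by apply: cvgM; [exact: Ae|exact: cvg_cst].
apply: (@squeeze_cvgr _ _ _ _ (cst 0) _ _ _ _ (cvg_cst _) h).
apply: nearW => n; rewrite cabs_ge0 /= -cabsN opprB.
have -> : ip (A f) g - \sum_(0 <= k < n | P k) rc (lam k) * (ip f (e k) * ip (e k) g) =
    ip (fun x => A f x - lincomb P e (index_iota 0 n) c x) g.
  rewrite ipBl//; [|exact: LA|exact: (L2_lincomb Le)].
  rewrite (ip_lincombl Le)//; congr (_ - _); apply: eq_bigr => k _.
  by rewrite /c mulrA.
rewrite -[leLHS]ger0_norm ?cabs_ge0// -sqrtr_sqr ler_wsqrtr// cabsE.
by apply: cauchy_schwarz => //; apply: L2B; [exact: LA|exact: (L2_lincomb Le)].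
Qed.

Lemma spectral_quad f : L2 f ->
  (fun n => \sum_(0 <= k < n | P k) lam k * csq (ip f (e k))) @ \oo --> Re (ip (A f) f).
Proof.
move=> Lf; have [h _] := spectral_form Lf Lf.
rewrite (_ : (fun n => _) = fun n => Re (\sum_(0 <= k < n | P k)
   rc (lam k) * (ip f (e k) * ip (e k) f)))//.
apply/funext => n; rewrite cRe_sum; apply: eq_bigr => k Pk.
by rewrite (ipC Lf (Le Pk)) mul_cj -rcM.
Qed.

(** Recovers each coefficient from the operator alone, so that a second expansion can be tested on
    [e k]. *)
Lemma spectral_eigen k : P k -> Re (ip (A (e k)) (e k)) = lam k.
Proof.
move=> Pk; apply: (cvg_unique (@Rhausdorff R) (spectral_quad (Le Pk))).
apply: (@cvg_eventually_cst _ _ _ k.+1) => n kn.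
rewrite big_mkcond (bigD1_seq k) ?iota_uniq ?mem_index_iota//= Pk eo// eqxx.
rewrite (csq_rc 1) expr1n mulr1 big1 ?addr0// => j jk.
by case: ifP => // Pj; rewrite eo// eq_sym (negbTE jk) (csq_rc 0) expr0n mulr0.
Qed.

End SpectralExpansion.

Section WeightedSums.
Variable R : realType.
Variables (P : pred nat) (c : nat -> R).

Lemma big_nat_split_pred (V : nmodType) (u : nat -> V) N m :
  (forall k, (k < N)%N -> P k) -> (N <= m)%N ->
  \sum_(0 <= k < m | P k) u k = \sum_(0 <= k < N) u k + \sum_(N <= k < m | P k) u k.
Proof.
move=> PN Nm; rewrite (big_cat_nat (leq0n N) Nm)/=; congr (_ + _).
rewrite big_nat_cond [RHS]big_nat_cond; apply: eq_bigl => k.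
by rewrite leq0n /= andbT; case: ltnP => // /PN.
Qed.

(* A bang-bang argument: the threshold [c N] separates the first [N + 1]
   coefficients from the others. *)
Lemma ky_fan N m (b : nat -> R) : (forall k, (k <= N)%N -> P k) -> (N < m)%N ->
  (forall j k, P j -> P k -> (j <= k)%N -> c k <= c j) ->
  (forall k, P k -> 0 <= c k) -> (forall k, P k -> 0 <= b k <= 1) ->
  \sum_(0 <= k < m | P k) b k <= N.+1%:R ->
  \sum_(0 <= k < m | P k) c k * b k <= \sum_(0 <= k < N.+1) c k.
Proof.
move=> PN Nm cdec c0 b01 bN; have PNN : P N by exact: PN.
have -> : \sum_(0 <= k < m | P k) c k * b k =
    \sum_(0 <= k < m | P k) (c k - c N) * b k + c N * \sum_(0 <= k < m | P k) b k.
  by rewrite mulr_sumr -big_split; apply: eq_bigr => k _ /=; rewrite -mulrDl subrK.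
have -> : \sum_(0 <= k < N.+1) c k = \sum_(0 <= k < N.+1) (c k - c N) + c N * N.+1%:R.
  by rewrite sumrB sumr_const_nat subn0 mulr_natr subrK.
apply: lerD; last by apply: ler_wpM2l bN; exact: c0.
rewrite (big_nat_split_pred _ (N := N.+1))// -[leRHS]addr0; apply: lerD.
  apply: ler_sum_nat => k kN; have Pk : P k by exact: PN.
  have /andP[_ b1] := b01 _ Pk.
  by rewrite ler_piMr// subr_ge0 cdec.
rewrite big_nat_cond; apply: sumr_le0 => k /andP[/andP[Nk _] Pk].
have /andP[b0 _] := b01 _ Pk.
by rewrite mulr_le0_ge0// subr_le0 cdec// ltnW.
Qed.

(** Each [u _ k] stands for a rank-one piece of trace norm at most 1. Its coefficient in the
    difference has modulus 1 - c k below N and c k from N on; as all c k together add up to at most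
    N, the second group weighs no more than the first. *)
Lemma sum_cabs_weighted_error n N m (u : nat -> nat -> R[i]) :
  (forall k, (k < N)%N -> P k) -> (N <= m)%N ->
  (forall k, P k -> 0 <= c k <= 1) -> \sum_(0 <= k < m | P k) c k <= N%:R ->
  (forall k, P k -> \sum_(i < n) cabs (u i k) <= 1) ->
  \sum_(i < n) cabs (\sum_(0 <= k < N) u i k -
      \sum_(0 <= k < m | P k) rc (c k) * u i k) <=
    2 * (N%:R - \sum_(0 <= k < N) c k).
Proof.
move=> PN Nm c01 cN u1.
apply: (@le_trans _ _ (\sum_(i < n) (\sum_(0 <= k < N) (1 - c k) * cabs (u i k) +
    \sum_(N <= k < m | P k) c k * cabs (u i k)))).
  apply: ler_sum => i _.
  rewrite (big_nat_split_pred _ PN Nm) opprD addrA -sumrB.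
  apply: le_trans (cabsB _ _) _; apply: lerD.
    apply: le_trans (cabs_sum _ _ _) _; apply: ler_sum_nat => k kN.
    have /andP[_ c1] := c01 _ (PN _ kN).
    rewrite (_ : u i k - rc (c k) * u i k = rc (1 - c k) * u i k).
      by rewrite cabsM cabs_rc ger0_norm// subr_ge0.
    by rewrite rcB rc1; ring.
  apply: le_trans (cabs_sum _ _ _) _; apply: ler_sum => k Pk.
  have /andP[c0 _] := c01 _ Pk.
  by rewrite cabsM cabs_rc ger0_norm.
rewrite big_split /= exchange_big [X in _ + X]exchange_big /=.
rewrite (big_nat_split_pred _ PN Nm) in cN.
apply: (@le_trans _ _ (\sum_(0 <= k < N) (1 - c k) + \sum_(N <= k < m | P k) c k)).
  apply: lerD.
    apply: ler_sum_nat => k kN; have Pk := PN _ kN; have /andP[_ c1] := c01 _ Pk.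
    by rewrite -mulr_sumr ler_piMr ?subr_ge0// u1.
  apply: ler_sum => k Pk; have /andP[c0 _] := c01 _ Pk.
  by rewrite -mulr_sumr ler_piMr// u1.
rewrite sumrB sumr_const_nat subn0.
by lra.
Qed.

End WeightedSums.

Section Comparison.
Context d (T : measurableType d) (R : realType).
Variable mu : {measure set T -> \bar R}.
Local Notation L2 := (L2 mu).
Local Notation ip := (ip mu).
Local Notation nsq := (nsq mu).

Variable A : (T -> R[i]) -> T -> R[i].
Hypothesis LA : forall f, L2 f -> L2 (A f).
Variables (P : pred nat) (lam : nat -> R) (p : nat -> T -> R[i]).
Hypothesis Lp : forall k, P k -> L2 (p k).
Hypothesis po : forall j k, P j -> P k -> ip (p j) (p k) = (j == k)%:R.
Hypothesis Pdown : forall j k, (j <= k)%N -> P k -> P j.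
Hypothesis lam_dec : forall j k, P j -> P k -> (j <= k)%N -> lam k <= lam j.
Hypothesis Ap : spectral_expansion mu A P lam p.
Variables (w : nat -> R) (F : nat -> T -> R[i]).
Hypothesis LF : forall k, xpredT k -> L2 (F k).
Hypothesis Fo : forall j k, xpredT j -> xpredT k -> ip (F j) (F k) = (j == k)%:R.
Hypothesis AF : spectral_expansion mu A xpredT w F.
Hypothesis w01 : forall j, 0 <= w j <= 1.
Variable N : nat.
Hypothesis sum_w : forall n, \sum_(0 <= j < n) w j <= N%:R.
Hypothesis cvg_sum_w : (fun n => \sum_(0 <= j < n) w j) @ \oo --> (N%:R : R).

(** Doubly substochastic by Bessel's inequality. As a matrix it maps w to lam, and its transpose
    maps lam to w. *)
Let a k j := csq (ip (p k) (F j)).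

Let aC k j : P k -> a k j = csq (ip (F j) (p k)).
Proof. by move=> Pk; rewrite (ipC (Lp Pk) (@LF j isT)) csq_cj. Qed.

Let lam_sum k : P k -> (fun n => \sum_(0 <= j < n) w j * a k j) @ \oo --> lam k.
Proof.
by move=> Pk; rewrite -(spectral_eigen LA Lp po Ap Pk); apply: (spectral_quad LA LF AF); exact: Lp.
Qed.

Let w_sum j : (fun n => \sum_(0 <= k < n | P k) lam k * a k j) @ \oo --> w j.
Proof.
rewrite -(spectral_eigen LA LF Fo AF (isT : xpredT j)).
have := spectral_quad LA Lp Ap (@LF j isT).
by under eq_fun => n do under eq_bigr => k Pk do rewrite -(aC _ Pk).
Qed.

Let a_ge0 k j : 0 <= a k j. Proof. exact: csq_ge0. Qed.
Let bessel_j k n : P k -> \sum_(0 <= j < n) a k j <= 1.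
Proof.
move=> Pk; apply: le_trans (bessel LF Fo (Lp Pk) (iota_uniq _ _)) _.
by rewrite nsqE_ip po// eqxx.
Qed.
Let bessel_k j n : \sum_(0 <= k < n | P k) a k j <= 1.
Proof.
under eq_bigr => k Pk do rewrite (aC _ Pk).
apply: le_trans (bessel Lp po (@LF j isT) (iota_uniq _ _)) _.
by rewrite nsqE_ip Fo// eqxx.
Qed.

Let lam01 k : P k -> 0 <= lam k <= 1.
Proof.
move=> Pk; apply/andP; split.
  apply: (cvg_ge_cst (lam_sum Pk)) => n; apply: sumr_ge0 => j _.
  by have /andP[w0 _] := w01 j; exact: mulr_ge0.
apply: (cvg_le_cst (lam_sum Pk)) => n; apply: le_trans (bessel_j n Pk).
by apply: ler_sum => j _; have /andP[_ w1] := w01 j; rewrite ler_piMl.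
Qed.

Let sum_lam n : \sum_(0 <= k < n | P k) lam k <= N%:R.
Proof.
have h := @cvg_sumr R nat (index_iota 0 n) P _ _ lam_sum.
apply: (cvg_le_cst h) => m.
rewrite exchange_big /=; apply: le_trans (sum_w m).
apply: ler_sum => j _; rewrite -mulr_sumr ler_piMr ?bessel_k//.
by have /andP[] := w01 j.
Qed.

(** If index k were missing, at most k eigenvalues would exist, each at most 1, and the trace N
    would be at most k. Hence the ensemble kernel involves only genuine members of the
    eigenfamily. *)
Lemma index_lt_trace k : (k < N)%N -> P k.
Proof.
move=> kN; apply: contraT => nPk.
suff : (N%:R : R) <= k%:R by rewrite ler_nat leqNgt kN.
apply: (cvg_le_cst cvg_sum_w) => m.
have h := @cvg_sumr R nat (index_iota 0 m) xpredT _ _ (fun j _ => @w_sum j).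
apply: (cvg_le_cst h) => n; rewrite exchange_big /=.
apply: (@le_trans _ _ (\sum_(0 <= i < n | P i) 1)).
  apply: ler_sum => i Pi; rewrite -mulr_sumr; have /andP[l0 l1] := lam01 Pi.
  by rewrite mulr_ile1// ?bessel_j// sumr_ge0.
rewrite (_ : \sum_(0 <= i < n | P i) 1 = (count P (index_iota 0 n))%:R); last first.
  by rewrite -sum1_count natr_sum.
rewrite ler_nat -size_filter -[leqRHS](size_iota 0); apply: uniq_leq_size.
  by rewrite filter_uniq ?iota_uniq.
move=> i; rewrite mem_filter mem_iota add0n => /andP[Pi _] /=.
by rewrite ltnNge; apply: contra nPk => ki; exact: Pdown Pi.
Qed.

(** [ky_fan] with b k the sum over j < N of [a k j], the squared length of the projection of p k
    onto the span of the first N functions F j. *)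
Let w_sum_le_lam : \sum_(0 <= j < N) w j <= \sum_(0 <= k < N) lam k.
Proof.
have h := @cvg_sumr R nat (index_iota 0 N) xpredT _ _ (fun j _ => @w_sum j).
move: index_lt_trace h; case: (N) => [|M] PM h; first by rewrite !big_nil.
(* The shift puts the leading N indices into every truncation; the zero imaginary part casts the
   real sequence in the form of [ccvg_shift]. *)
have [h1 _] := ccvg_shift M.+1 (conj h (cvg_cst 0) : ccvg
  (fun n => Complex (\sum_(0 <= j < M.+1) \sum_(0 <= k < n | P k) lam k * a k j) 0) (Complex _ 0)).
apply: (cvg_le_cst h1) => n /=; rewrite exchange_big /=.
under eq_bigr do rewrite -mulr_sumr.
apply: (ky_fan (P := P)) => //.
- exact: leq_addl.
- by move=> k /lam01/andP[].
- by move=> k Pk; rewrite sumr_ge0// bessel_j.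
rewrite exchange_big /=; apply: (@le_trans _ _ (\sum_(0 <= j < M.+1) 1)); last first.
  by rewrite sumr_const_nat subn0.
by apply: ler_sum => j _; exact: bessel_k.
Qed.

(** A rank-one projection has trace norm at most 1: ab <= (a^2 + b^2) / 2, then Bessel's inequality
    for each family. *)
Let sum_cabs_ip_le1 n (e f : nat -> T -> R[i]) g :
  (forall i, (i < n)%N -> L2 (e i)) -> (forall i, (i < n)%N -> L2 (f i)) ->
  (forall i j, (i < n)%N -> (j < n)%N -> ip (e i) (e j) = (i == j)%:R) ->
  (forall i j, (i < n)%N -> (j < n)%N -> ip (f i) (f j) = (i == j)%:R) ->
  L2 g -> nsq g = 1 -> \sum_(i < n) cabs (ip (e i) g * ip g (f i)) <= 1.
Proof.
move=> Le Lf eo fo Lg g1.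
have be h : (forall i, (i < n)%N -> L2 (h i)) ->
    (forall i j, (i < n)%N -> (j < n)%N -> ip (h i) (h j) = (i == j)%:R) ->
    \sum_(i < n) csq (ip g (h i)) <= 1.
  move=> Lh ho; have := @bessel _ _ _ mu (fun i => (i < n)%N) h Lh ho g (index_iota 0 n) Lg (iota_uniq _ _).
  by rewrite g1 -(big_mkord xpredT (fun i => csq (ip g (h i)))) big_nat.
apply: (@le_trans _ _ (\sum_(i < n) (csq (ip g (e i)) + csq (ip g (f i))) / 2)).
  apply: ler_sum => i _; rewrite cabsM (ipC Lg (Le _ (ltn_ord i))) cabs_cj -!cabsE.
  by have := sqr_ge0 (cabs (ip g (e i)) - cabs (ip g (f i))); rewrite !expr2; lra.
rewrite -mulr_suml big_split /= ler_pdivrMr// mul1r.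
by apply: lerD; exact: be.
Qed.

(** The truncations Y and Z expand the same number [<A e_i, f_i>], so their difference tends to 0,
    while each projection differs from its own truncation by a bound uniform in the truncation
    length. *)
Theorem trace_distance n (e f : nat -> T -> R[i]) :
  (forall i, (i < n)%N -> L2 (e i)) -> (forall i, (i < n)%N -> L2 (f i)) ->
  (forall i j, (i < n)%N -> (j < n)%N -> ip (e i) (e j) = (i == j)%:R) ->
  (forall i j, (i < n)%N -> (j < n)%N -> ip (f i) (f j) = (i == j)%:R) ->
  \sum_(i < n) cabs (\sum_(0 <= k < N) ip (e i) (p k) * ip (p k) (f i) -
     \sum_(0 <= j < N) ip (e i) (F j) * ip (F j) (f i)) <=
  4 * (N%:R - \sum_(0 <= j < N) w j).
Proof.
move=> Le Lf eo fo.
pose u i k := ip (e i) (p k) * ip (p k) (f i).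
pose v i j := ip (e i) (F j) * ip (F j) (f i).
pose Y i m := \sum_(0 <= k < m | P k) rc (lam k) * u i k.
pose Z i m := \sum_(0 <= k < m) rc (w k) * v i k.
have u1 k : P k -> \sum_(i < n) cabs (u i k) <= 1.
  move=> Pk; apply: sum_cabs_ip_le1 => //; first exact: Lp.
  by rewrite nsqE_ip po// eqxx.
have v1 k : xpredT k -> \sum_(i < n) cabs (v i k) <= 1.
  move=> Pk; apply: sum_cabs_ip_le1 => //; first exact: LF.
  by rewrite nsqE_ip Fo// eqxx.
have YZ (i : 'I_n) : (fun m => cabs (Y i (m + N)%N - Z i (m + N)%N)) @ \oo --> (0 : R).
  have h := ccvgB (spectral_form LA Lp Ap (Le _ (ltn_ord i)) (Lf _ (ltn_ord i)))
    (spectral_form LA LF AF (Le _ (ltn_ord i)) (Lf _ (ltn_ord i))).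
  by have := ccvg_cabs (ccvg_shift N h); rewrite subrr cabs0.
have := @cvg_sumr R 'I_n (index_enum 'I_n) xpredT _ _ (fun i _ => @YZ i).
rewrite big1// => h.
pose B := 4 * (N%:R - \sum_(0 <= j < N) w j).
have hB : (fun m => \sum_(i < n) cabs (Y i (m + N)%N - Z i (m + N)%N) + B) @ \oo --> B.
  by rewrite -[X in _ --> X]add0r; apply: cvgD => //; exact: cvg_cst.
apply: (cvg_ge_cst hB) => m.
have hu := sum_cabs_weighted_error (n := n) (u := u) index_lt_trace (leq_addl m N) lam01 (sum_lam _) u1.
have hv := sum_cabs_weighted_error (n := n) (u := v) (P := xpredT) (fun _ _ => isT)
  (leq_addl m N) (fun j _ => w01 j) (sum_w _) v1.
apply: (@le_trans _ _ (\sum_(i < n) cabs (Y i (m + N)%N - Z i (m + N)%N) +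
   (2 * (N%:R - \sum_(0 <= k < N) lam k) + 2 * (N%:R - \sum_(0 <= k < N) w k)))); last first.
  by rewrite lerD2l /B; have := w_sum_le_lam; lra.
apply: le_trans (lerD (lexx _) (lerD hu hv)).
rewrite -!big_split /=; apply: ler_sum => i _.
rewrite -/(Y i (m + N)%N) -/(Z i (m + N)%N).
move: (Y _ _) (Z _ _) (\sum_(0 <= k < N) u i k) (\sum_(0 <= k < N) v i k) => y z U V.
rewrite (_ : U - V = (y - z) + ((U - y) - (V - z))); last by ring.
by apply: le_trans (cabsD _ _) _; rewrite lerD2l cabsB.
Qed.

End Comparison.

(** * The Chebyshev estimate *)

Section WeightDeficit.
Variables (R : realType) (r N : nat).
Local Notation leb2 := (@Defs.leb2 R).
Local Notation D := (polar_disk (N%:R : R)).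
Local Notation w := (@disk_weight R r D).
Local Notation rt n := (Num.sqrt n%:R : R).
Implicit Types (z : R * R) (j k : nat).

(** Off the disk [polar z > N >= j + r + 1], so the factor on the left is below the multiplier in
    [dsp_square]; then (a + b)^2 <= 2 (a^2 + b^2). At j = 0 or r = 0 the truncated predecessor has
    coefficient 0. *)
Let csq_hstft_off_disk j z : (j + r + 1 <= N)%N -> (~` D) z ->
  (N%:R - (j + r + 1)%:R) ^+ 2 * csq (hstft r j z) <=
  2 * (j.+1%:R * r.+1%:R * csq (hstft r.+1 j.+1 z) +
       j%:R * r%:R * csq (hstft r.-1 j.-1 z)).
Proof.
move=> jN /negP; rewrite /polar_disk /= -ltNge => Nz.
rewrite !csq_hstft; set x := Num.sqrt (polar z).
have xz : x ^+ 2 = polar z by rewrite sqr_sqrtr ?polar_ge0.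
have jN' : ((j + r + 1)%:R : R) <= N%:R by rewrite ler_nat.
have := dsp_square j r x; rewrite xz => e.
apply: (@le_trans _ _ ((polar z - (j + r + 1)%:R) ^+ 2 * dsp j r x ^+ 2)).
  rewrite ler_wpM2r ?sqr_ge0// ler_pXn2r ?nnegrE ?subr_ge0//.
    by rewrite lerD2r ltW.
  exact: le_trans jN' (ltW Nz).
rewrite -exprMn e sqrrN.
have := rt_sqr R j.+1; have := rt_sqr R r.+1; have := rt_sqr R j; have := rt_sqr R r.
move: (rt j.+1) (rt r.+1) (rt j) (rt r) => A B C E <- <- <- <-.
move: (dsp _ _ _) (dsp _ _ _) => q p.
have -> : 2 * (A * A * (B * B) * p ^+ 2 + C * C * (E * E) * q ^+ 2) =
  (A * B * p + C * E * q) ^+ 2 + (A * B * p - C * E * q) ^+ 2 by ring.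
by rewrite lerDl sqr_ge0.
Qed.

Let off_disk k j : Rintegral leb2 (~` D) (fun z => csq (hstft k j z)) <= 1.
Proof. by rewrite disk_weight_compl// gerBl disk_weight_ge0. Qed.

(** The pointwise bound is integrated off the disk, where every |F|^2 has mass at most 1; the
    constant comes from 2 ((j + 1)(r + 1) + j r) <= 4 N (r + 1). *)
Lemma disk_weight_deficit j : (j + r + 1 <= N)%N ->
  (N%:R - (j + r + 1)%:R) ^+ 2 * (1 - w j) <= 4 * N%:R * r.+1%:R.
Proof.
move=> jN; rewrite -(disk_weight_compl r N%:R j).
have mDc : measurable (~` D) by apply: measurableC; exact: measurable_polar_disk.
have i k l : leb2.-integrable (~` D) (EFin \o (fun z => csq (hstft k l z))).
  by apply: (integrableS measurableT) => //; have /L2P[_] := L2_hstft R k l.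
rewrite -RintegralZl//.
apply: (@le_trans _ _ (Rintegral leb2 (~` D) (fun z =>
  2 * (j.+1%:R * r.+1%:R) * csq (hstft r.+1 j.+1 z) +
  2 * (j%:R * r%:R) * csq (hstft r.-1 j.-1 z)))).
  apply: le_Rintegral => //; first exact: integrableZ_EFin.
  - by apply: integrableD_EFin => //; exact: integrableZ_EFin.
  - move=> z Dz; apply: le_trans (csq_hstft_off_disk jN Dz) _.
    by rewrite mulrDr !mulrA.
rewrite RintegralD//; try exact: integrableZ_EFin.
rewrite !RintegralZl//.
have h1 := off_disk r.+1 j.+1; have h2 := off_disk r.-1 j.-1.
apply: (@le_trans _ _ (2 * (j.+1%:R * r.+1%:R) + 2 * (j%:R * r%:R))).
  have c1 : (0 : R) <= 2 * (j.+1%:R * r.+1%:R) by rewrite !mulr_ge0.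
  have c2 : (0 : R) <= 2 * (j%:R * r%:R) by rewrite !mulr_ge0.
  exact: lerD (ler_piMr c1 h1) (ler_piMr c2 h2).
have a1 : j.+1%:R * r.+1%:R <= (N%:R : R) * r.+1%:R.
  by rewrite ler_wpM2r// ler_nat; lia.
have a2 : j%:R * r%:R <= (N%:R : R) * r.+1%:R.
  by rewrite ler_pM// ler_nat; lia.
move: a1 a2; rewrite -mulrA; clear.
move: (j.+1%:R * _) (j%:R * _) (N%:R * _) => x y n xn yn.
lra.
Qed.

Lemma sum_disk_weight_deficit :
  N%:R - \sum_(0 <= j < N) w j <= 9 * r.+1%:R * rt N.
Proof.
have [->|Npos] := posnP N.
  by rewrite big_nil subr0 mulr_ge0// ?mulr_ge0// ?sqrtr_ge0 ?ler0n.
have N1 : 1 <= rt N by rewrite -{1}(sqrtr1 R) ler_wsqrtr// ler1n.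
have r1 : (1 : R) <= r.+1%:R by rewrite ler1n.
(* With k = N - j - r - 1, the value of k at which the Chebyshev bound a^2 / k^2 crosses 1. *)
pose a := 2 * (rt r.+1 * rt N).
have a2 : a ^+ 2 = 4 * N%:R * r.+1%:R.
  transitivity (4 * (rt N * rt N) * (rt r.+1 * rt r.+1)); first by rewrite /a; ring.
  by rewrite !rt_sqr.
have rr : rt r.+1 <= r.+1%:R.
  by rewrite -[leRHS]sqr_sqrtr// expr2 ler_peMr ?sqrtr_ge0// -{1}(sqrtr1 R) ler_wsqrtr.
have a0 : 0 < a by rewrite !mulr_gt0// sqrtr_gt0 ltr0n.
rewrite (_ : N%:R - _ = \sum_(0 <= j < N) (1 - w j)); last first.
  by rewrite sumrB sumr_const_nat subn0.
pose M := (N - r.+1)%N; have MN : (M <= N)%N by exact: leq_subr.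
rewrite (big_cat_nat (leq0n M) MN)/=.
(* With k = M - j >= 1, min (1, a^2 / k^2) <= 4 a^2 / (k + a)^2 <= 4 a^2 (f j.+1 - f j), which
   telescopes to at most 4 a. *)
pose f j : R := (M%:R - j%:R + a)^-1.
have key j : (j < M)%N -> 1 - w j <= 4 * a ^+ 2 * (f j.+1 - f j).
  move=> jM; have jN : (j + r + 1 <= N)%N by rewrite /M in jM; lia.
  have := disk_weight_deficit jN; rewrite -a2.
  have -> : N%:R - (j + r + 1)%:R = M%:R - j%:R :> R.
    rewrite -!natrB//; last exact: ltnW.
    by congr _%:R; rewrite /M in jM *; lia.
  have x1 : 1 - w j <= 1 by rewrite gerBl disk_weight_ge0.
  have x0 : 0 <= 1 - w j by rewrite subr_ge0 disk_weight_le1.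
  have k1 : 1 <= M%:R - j%:R :> R by rewrite lerBrDl natr1 ler_nat.
  rewrite /f (_ : M%:R - j.+1%:R = M%:R - j%:R - 1 :> R); last first.
    by rewrite -(natr1 j) opprD addrA.
  move: (M%:R - j%:R) (1 - w j) k1 x0 x1 => k x k1 x0 x1 kx.
  have ka : 0 < k - 1 + a by lra.
  have ka' : 0 < k + a by lra.
  have -> : (k - 1 + a)^-1 - (k + a)^-1 = ((k - 1 + a) * (k + a))^-1.
    by field; rewrite !gt_eqF.
  rewrite ler_pdivlMr ?mulr_gt0//.
  apply: (@le_trans _ _ (x * (k + a) ^+ 2)).
    by apply: ler_wpM2l => //; nra.
  have [ak|ka2] := leP k a.
    apply: (@le_trans _ _ ((k + a) ^+ 2)); first by rewrite ler_piMl// sqr_ge0.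
    by nra.
  apply: (@le_trans _ _ (x * (4 * k ^+ 2))); last by lra.
  by apply: ler_wpM2l => //; nra.
(* At most r + 1 indices remain from M on, each with deficit at most 1. The 9 is 8 + 1, since 4 a =
   8 sqrt (r + 1) sqrt N. *)
apply: (@le_trans _ _ (4 * a + r.+1%:R)).
  apply: lerD.
    apply: (@le_trans _ _ (\sum_(0 <= j < M) 4 * a ^+ 2 * (f j.+1 - f j))).
      by apply: ler_sum_nat => j /key.
    rewrite -mulr_sumr telescope_sumr// /f subrr add0r subr0.
    have Y0 : 0 <= (M%:R + a)^-1 by rewrite invr_ge0 addr_ge0 ?ler0n ?(ltW a0).
    rewrite mulrBr (_ : 4 * a ^+ 2 * a^-1 = 4 * a); last by rewrite expr2 mulrA mulfK ?gt_eqF.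
    rewrite gerBl; apply: mulr_ge0 => //.
    by rewrite mulr_ge0// sqr_ge0.
  apply: (@le_trans _ _ (\sum_(M <= j < N) 1)).
    by apply: ler_sum => j _; rewrite gerBl disk_weight_ge0.
  by rewrite sumr_const_nat ler_nat /M; lia.
rewrite /a; move: (rt N) (rt r.+1) N1 rr => n s N1 rr.
nra.
Qed.

End WeightDeficit.

Section FiniteRank.
Variable R : realType.
Local Notation leb2 := (@Defs.leb2 R).
Local Notation D N := (polar_disk (N%:R : R)).
Implicit Types (e f : R * R -> R[i]).

Lemma disk_radius_area N : disk (radius_area R N) = D N.
Proof.
apply/seteqP; split => z; rewrite /disk /polar_disk /polar /radius_area /=;
  by rewrite sqr_sqrtr ?divr_ge0 ?pi_ge0// ler_pdivlMr ?pi_gt0// mulrC.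
Qed.

(** Stated for two kernels of the same shape because [Kprime r N] is convertible with
    [WH_kernel N (hstft r)]. *)
Lemma ip_intop_WH_kernel N (P : pred nat) (p q : nat -> R * R -> R[i]) e f :
  (forall k, P k -> L2 leb2 (p k)) -> (forall k, L2 leb2 (q k)) ->
  (forall k, (k < N)%N -> P k) -> L2 leb2 e -> L2 leb2 f ->
  ip2 (intop (fun z z' => WH_kernel N p z z' - WH_kernel N q z z') e) f =
  \sum_(0 <= k < N) ip leb2 e (p k) * ip leb2 (p k) f -
  \sum_(0 <= k < N) ip leb2 e (q k) * ip leb2 (q k) f.
Proof.
move=> Lp Lq PN Le Lf; have Lq' k : xpredT k -> L2 leb2 (q k) by [].
have sumP (u : nat -> R[i]) : \sum_(0 <= k < N | P k) u k = \sum_(0 <= k < N) u k.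
  by rewrite (big_nat_split_pred _ PN (leqnn N)) [X in _ + X]big_geq// addr0.
pose lp := lincomb P p (index_iota 0 N); pose lq := lincomb xpredT q (index_iota 0 N).
have -> : intop (fun z z' => WH_kernel N p z z' - WH_kernel N q z z') e =
    fun z => lp (fun k => ip leb2 e (p k)) z - lq (fun k => ip leb2 e (q k)) z.
  apply/funext => z.
  transitivity (ip leb2 e (fun z' => lp (fun k => cj (p k z)) z' - lq (fun k => cj (q k z)) z')).
    rewrite /intop -[LHS]/(cint leb2 setT _); apply: eq_cint => z' _.
    rewrite mulrC cjB /lp /lq /lincomb sumP !cj_sum !big_mkord; congr (_ * (_ - _));
      by apply: eq_bigr => k _; rewrite cjM cjK.
  rewrite ipBr//; [|exact: (L2_lincomb Lp)|exact: (L2_lincomb Lq')].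
  rewrite (ip_lincombr Lp)// (ip_lincombr Lq')//; congr (_ - _);
    by apply: eq_bigr => k _; rewrite cjK mulrC.
rewrite -[LHS]/(ip leb2 _ f) ipBl//; [|exact: (L2_lincomb Lp)|exact: (L2_lincomb Lq')].
by rewrite (ip_lincombl Lp)// (ip_lincombl Lq')// sumP.
Qed.

Lemma l2norm_cvg_nsq (g : nat -> R * R -> R[i]) : (forall n, L2 leb2 (g n)) ->
  (fun n => l2norm2_2 (g n)) @ \oo --> 0%E -> (fun n => nsq leb2 (g n)) @ \oo --> (0 : R).
Proof.
move=> Lg h.
have <- : fine \o (fun n => l2norm2_2 (g n)) = fun n => nsq leb2 (g n).
  by apply/funext => n /=; rewrite /l2norm2_2 (nsqE (Lg n)).
exact: (fine_cvg h).
Qed.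

End FiniteRank.

Theorem theorem5p4 (R : realType) (r : nat) :
  exists Cr Cr' : R, forall (N : nat) (card : option nat) (lam : nat -> R)
    (p : nat -> R * R -> R[i]),
    spectral_decomposition (hermite r) (disk (radius_area R N)) card lam p ->
    (trace_norm (fun z z' => (WH_kernel N p z z' - Kprime r N z z')%R)
       <= (Cr * disk_perimeter (radius_area R N))%:E)%E /\
    Cr * disk_perimeter (radius_area R N) <= Cr' * Num.sqrt N%:R.
Proof.
(* 36 is the 4 of [trace_distance] times the 9 of [sum_disk_weight_deficit]. With R the radius, sqrt
   N = sqrt pi R is at most the perimeter 2 pi R, and R <= sqrt N gives the second constant. *)
exists (36 * r.+1%:R), (36 * r.+1%:R * (2 * pi)) => N card lam p.
rewrite disk_radius_area => -[Lp' po' _ lam_dec Mp].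
have Lp k : in_index card k -> L2 (@Defs.leb2 R) (p k) by exact: Lp'.
have po j k : in_index card j -> in_index card k ->
    ip (@Defs.leb2 R) (p j) (p k) = (j == k)%:R by exact: po'.
have pi1 : (1 : R) <= pi by apply: le_trans (pi_ge2 R); rewrite ler1n.
have pi0 : (0 : R) < pi by apply: lt_le_trans pi1.
have C0 : (0 : R) <= 36 * r.+1%:R by rewrite mulr_ge0.
set x := radius_area R N; have x0 : 0 <= x by exact: sqrtr_ge0.
have xE : Num.sqrt N%:R = Num.sqrt pi * x.
  by rewrite /x /radius_area -sqrtrM ?ltW// mulrCA divff ?gt_eqF// mulr1.
have sp1 : 1 <= Num.sqrt (pi : R) by rewrite -(sqrtr1 R) ler_wsqrtr.
split; last first.
  rewrite /disk_perimeter !mulrA ler_wpM2l//; first by rewrite !mulr_ge0// ltW.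
  by rewrite xE ler_peMl.
have N0 : 0 <= N%:R :> R by exact: ler0n.
pose A := intop (Mkernel (hermite r) (polar_disk (N%:R : R))).
have LA f : L2 (@Defs.leb2 R) f -> L2 (@Defs.leb2 R) (A f) by move=> /(intop_L2 r N0)[].
have AF : spectral_expansion (@Defs.leb2 R) A xpredT
    (@disk_weight R r (polar_disk N%:R)) (hstft r) by move=> f /(intop_L2 r N0)[].
have Ap : spectral_expansion (@Defs.leb2 R) A (in_index card) lam p.
  move=> f Lf; apply: l2norm_cvg_nsq => [n|].
    by apply: L2B; [exact: LA|exact: (L2_lincomb Lp)].
  have := Mp f Lf; rewrite (_ : (fun n => _) = fun n => l2norm2_2 (fun z => A f z -
    lincomb (in_index card) p (index_iota 0 n) (fun k => rc (lam k) * ip (@Defs.leb2 R) f (p k)) z))//.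
  apply/funext => n; congr l2norm2_2; apply/funext => z.
  by rewrite /lincomb big_mkord.
have down j k : (j <= k)%N -> in_index card k -> in_index card j.
  by rewrite /in_index; case: card {Lp po Lp' po' lam_dec Mp Ap} => // n; exact: leq_ltn_trans.
have LF k : xpredT k -> L2 (@Defs.leb2 R) (hstft r k) by move=> _; exact: L2_hstft.
have Fo j k : xpredT j -> xpredT k -> ip (@Defs.leb2 R) (hstft r j) (hstft r k) = (j == k)%:R.
  by move=> _ _; exact: hstft_orthonormal.
have w01 j : 0 <= disk_weight r (polar_disk (N%:R : R)) j <= 1.
  by rewrite disk_weight_ge0 disk_weight_le1.
have sw := sum_disk_weight_le r N0.
have cw := @cvg_sum_disk_weight R r _ N0.
have PN := index_lt_trace LA Lp po down Ap LF Fo AF w01 cw.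
apply: ge_ereal_sup => _ [n [e [f [[Le eo] [Lf fo] ->]]]]; rewrite lee_fin.
apply: (@le_trans _ _ (4 * (N%:R - \sum_(0 <= j < N) disk_weight r (polar_disk (N%:R : R)) j))).
  apply: le_trans (trace_distance LA Lp po down lam_dec Ap LF Fo AF w01 sw cw Le Lf eo fo).
  apply: ler_sum => i _.
  by rewrite -(@ip_intop_WH_kernel _ N (in_index card))//; [exact: L2_hstft|exact: Le|exact: Lf].
have := sum_disk_weight_deficit R r N; rewrite xE => h.
have sp : Num.sqrt (pi : R) <= 2 * pi.
  rewrite -[pi in leRHS]sqr_sqrtr ?ltW// expr2; nra.
apply: le_trans (_ : 36 * r.+1%:R * (Num.sqrt pi * x) <= _); first by lra.
by rewrite /disk_perimeter; do 2?[rewrite ler_wpM2l//|rewrite ler_wpM2r//].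
Qed.
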